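(* Let $a,b,c\in\mathbb{C}$ with $ab\neq 0$ and $c\neq 0,-1,-2,\dots$, set $f(z)=z\,{}_2F_1(a,b;c;z)$ for $z\in\mathbb{D}$, and let $-\pi/2<\lambda<\pi/2$. Suppose that $f$ is $\lambda$-spirallike. Then the following hold according to the value of $c-a-b$: (i) If $\operatorname{Re}(c-a-b)>1$, then $$\left|\lambda-\arg\left(1+\frac{ab}{c-a-b-1}\right)\right|\le\frac{\pi}{2}.$$ (ii) If $c-a-b=1+si$ with $s\in\mathbb{R}\setminus\{0\}$, then $R_1\le|w_1|$ and $$\left|\lambda-\arg w_1\right|\le\arccos\frac{R_1}{|w_1|},$$ where $w_1=1-iab/s$ and $$R_1=\left|\frac{\Gamma(c-a)\Gamma(c-b)}{s\,\Gamma(a)\Gamma(b)}\right|e^{\pi|s|/2}=\left|\frac{(a+is)(b+is)}{s}\cdot\frac{\Gamma(a+is)\Gamma(b+is)}{\Gamma(a)\Gamma(b)}\right|e^{\pi|s|/2}.$$ (iii) If $c-a-b=1$, then $|\lambda-\arg(ab)|\le\pi/2$. (iv) If $0\le\operatorname{Re}(c-a-b)<1$, then $c-a-b\in\mathbb{R}$ and $$\left|\lambda-\arg\frac{\Gamma(c-a)\Gamma(c-b)}{\Gamma(a)\Gamma(b)}\right|\le(c-a-b)\frac{\pi}{2}.$$ (v) If $\operatorname{Re}(c-a-b)<0$, then $\lambda=\arg(a+b-c)$.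
   Context: $\mathbb{D}=\{z\in\mathbb{C}:|z|<1\}$. For $a,b,c\in\mathbb{C}$ with $c\ne0,-1,-2,\dots$, the Gaussian hypergeometric function is ${}_2F_1(a,b;c;z)=\sum_{n=0}^\infty\frac{(a)_n(b)_n}{(c)_n n!}z^n$ for $z\in\mathbb{D}$, where $(a)_0=1$ and $(a)_n=a(a+1)\cdots(a+n-1)$. For $\lambda\in(-\pi/2,\pi/2)$, an analytic function $f$ on $\mathbb{D}$ with $f(0)=0$, $f'(0)=1$ is called $\lambda$-spirallike if $\operatorname{Re}\left(e^{-i\lambda}\frac{zf'(z)}{f(z)}\right)>0$ for all $z\in\mathbb{D}$ (the quotient taking the value $1$ at $z=0$). $\Gamma$ is the Euler gamma function. $\arg$ denotes the principal argument, with values in $(-\pi,\pi]$.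
   Formalization: In (iv) and (v) it is additionally assumed that neither a nor b is a nonpositive integer (else f is a polynomial and both items fail); in (ii) the second expression for R_1 is asserted only when a+is and b+is are nonzero, where it is defined. *)

(* Defs.v *)
From Stdlib Require Import Reals Factorial.
From Coquelicot Require Import Coquelicot.
Open Scope R_scope.

Definition Cexp (z : C) : C := (exp (Re z) * cos (Im z), exp (Re z) * sin (Im z)).

(* Principal argument, with values in (-PI, PI]; [Carg 0 = 0] by convention. *)
Definition Carg (z : C) : R :=
  if Ceq_dec z 0 then 0
  else if Rle_dec 0 (Im z) then acos (Re z / Cmod z)
  else - acos (Re z / Cmod z).

(* Limits and sums of complex sequences, taken on real and imaginary parts;
   meaningful only when the sequence (resp. series) converges. *)
Definition CLim_seq (u : nat -> C) : C :=
  (real (Lim_seq (fun n => Re (u n))), real (Lim_seq (fun n => Im (u n)))).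

Definition CSeries (u : nat -> C) : C :=
  (Series (fun n => Re (u n)), Series (fun n => Im (u n))).

Fixpoint poch (a : C) (n : nat) : C :=
  match n with
  | O => 1
  | S m => (poch a m * (a + INR m))%C
  end.

Definition nonpos_int (z : C) : Prop := exists n : nat, z = RtoC (- INR n).

(* Euler's limit: Gamma z = lim n! n^z / (z (z+1) ... (z+n)), where
   n^z = exp (z ln n).  At the poles 0, -1, -2, ... the terms are eventually
   quotients by 0, so the value is 0; as [/ 0 = 0] in C, this gives
   [/ CGamma z = 0] there, in agreement with the entire function 1/Gamma. *)
Definition CGamma (z : C) : C :=
  CLim_seq (fun n =>
    (INR (fact n) * Cexp (z * ln (INR n)) / poch z (S n))%C).

(* Meaningful for |z| < 1 and c not a nonpositive integer. *)
Definition hyp2F1 (a b c z : C) : C :=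
  CSeries (fun n =>
    (poch a n * poch b n / (poch c n * INR (fact n)) * z ^ n)%C).

(* In the last clause a zero z <> 0 of f is ruled out, since then the quotient
   is [_ / 0 = 0]. *)
Definition spirallike (lam : R) (f : C -> C) : Prop :=
  (forall z : C, Cmod z < 1 -> @ex_derive C_AbsRing C_NormedModule f z) /\
  f 0 = 0 /\
  C_derive f 0 = 1 /\
  (forall z : C, Cmod z < 1 ->
     0 < Re (Cexp (- (Ci * lam)) *
             (if Ceq_dec z 0 then 1 else z * C_derive f z / f z))%C).

(* Main.v *)
(** Let [F = 2F1(a,b;c;.)], [g = c - a - b] and [w = 1 + z F'/F], so that spirallikeness reads
    [Re (e^(-i lam) w) > 0]. The inequalities come from letting [z = 1 - t e^(i th)] tend to 1 along
    every ray [|th| < pi/2].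
    - The coefficients of [F] are, up to a factor with a limit given by Gamma values (Euler's
      product), those of [(1 - z)^g]; an Abelian argument then gives
      [F ~ (1 - z)^g G(c) G(-g) / (G(a) G(b))] when [Re g < 0], and the same for [F'] when
      [Re g < 1].
    - For [Re g > 0], Euler's transformation turns this into Gauss's value of [F] at 1. If that
      value is 0, then [(1 - z) w] tends to [-g], which is incompatible with spirallikeness.
    - For [Re g = 0] (for [F], or for [F'] in case (ii)) the contiguous relation
      [g F = (c-a)(c-b)/c F(c+1) - (1 - z) F'] gives [F = A + B (1 - z)^g + o(1)].
    Imaginary parts of the exponents rotate the limit of [w] by an arbitrary phase along suitable
    sequences [t -> 0], and the half-plane condition for all phases and all [th] gives the
    constraints on [lam]. *)

Require Import Defs.
From Stdlib Require Import Reals Factorial Lra Lia.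
From Coquelicot Require Import Coquelicot.
Open Scope R_scope.

(** * Limits of complex functions along a filter *)

(** Gamma enters only through Euler's limit, and everything about it is derived from the reciprocals
    [euler_recip], whose limit 1/Gamma is entire. With [/ 0 = 0] the asymptotic constants built from
    [/ CGamma _] hold at the poles too: a pole merely makes a constant vanish. Non-vanishing is
    therefore the recurring obstacle. For the values at 1 it is extracted from spirallikeness itself
    ([spirallike_gauss_neq_0]), while in (iv) and (v) the condition that [a] and [b] are not poles
    keeps the leading coefficient of F' nonzero. The ray th = 0 alone yields the bounds pi/2 of (i)
    and (iii). Turning th through the open interval sharpens them: at each th the factor (1 - z)^al
    contributes its own phase and modulus, which gives the sector in (iv), the factor e^(pi |s|/2)
    in (ii), and a single direction in (v). Limits are stated with [Cmod] over an arbitrary filter,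
    so that t -> 0+ and sequences t_n -> 0 chosen for their phase obey the same laws. *)

Definition Ctends {T : Type} (F : (T -> Prop) -> Prop) (g : T -> C) (l : C) : Prop :=
  forall eps : R, 0 < eps -> F (fun x => Cmod (g x - l)%C < eps).

Lemma Cmod_sub_sym (x y : C) : Cmod (x - y)%C = Cmod (y - x)%C.
Proof. rewrite <- Cmod_opp. f_equal. ring. Qed.

Lemma Cmod_le_add (x y : C) : Cmod x <= Cmod (x - y)%C + Cmod y.
Proof. replace x with ((x - y) + y)%C at 1 by ring. apply Cmod_triangle. Qed.

Lemma Cmod_sub_le (x y : C) : Cmod (x - y)%C <= Cmod x + Cmod y.
Proof. unfold Cminus. rewrite <- (Cmod_opp y). apply Cmod_triangle. Qed.

Lemma Cmod_pos_neq (x : C) : 0 < Cmod x -> x <> 0.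
Proof. apply Cmod_gt_0. Qed.

Lemma Cinv_0 : (/ 0)%C = 0.
Proof. unfold Cinv, RtoC; simpl. f_equal; unfold Rdiv; ring. Qed.

Section Limits.
Context {T : Type} (F : (T -> Prop) -> Prop) {FF : Filter F}.

Lemma Ctends_ext_loc (f g : T -> C) (l : C) :
  F (fun x => f x = g x) -> Ctends F f l -> Ctends F g l.
Proof.
  intros H H1 eps He.
  generalize (filter_and _ _ H (H1 eps He)); apply filter_imp.
  intros x [<- Hx]; exact Hx.
Qed.

Lemma Ctends_ext (f g : T -> C) (l : C) :
  (forall x, f x = g x) -> Ctends F f l -> Ctends F g l.
Proof. intros H. apply Ctends_ext_loc, filter_forall, H. Qed.

Lemma Ctends_const (l : C) : Ctends F (fun _ => l) l.
Proof.
  intros eps He; apply filter_forall; intros _.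
  replace (l - l)%C with (RtoC 0) by ring. rewrite Cmod_0; exact He.
Qed.

Lemma Ctends_le_loc (f : T -> C) (g : T -> R) (l : C) :
  F (fun x => Cmod (f x - l)%C <= g x) -> filterlim g F (locally 0) -> Ctends F f l.
Proof.
  intros H Hg eps He.
  assert (H1 : F (fun x => Rabs (g x - 0) < eps)).
  { apply (Hg (fun y => Rabs (y - 0) < eps)). exists (mkposreal _ He). intros y Hy; exact Hy. }
  generalize (filter_and _ _ H H1); apply filter_imp. intros x [Ha Hb].
  rewrite Rminus_0_r in Hb. generalize (Rle_abs (g x)); lra.
Qed.

Lemma Ctends_plus (f g : T -> C) (lf lg : C) :
  Ctends F f lf -> Ctends F g lg -> Ctends F (fun x => f x + g x)%C (lf + lg)%C.
Proof.
  intros Hf Hg eps He.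
  assert (He2 : 0 < eps / 2) by lra.
  generalize (filter_and _ _ (Hf _ He2) (Hg _ He2)); apply filter_imp; intros x [H1 H2].
  replace (f x + g x - (lf + lg))%C with ((f x - lf) + (g x - lg))%C by ring.
  eapply Rle_lt_trans; [apply Cmod_triangle|lra].
Qed.

Lemma Ctends_bounded (f : T -> C) (l : C) :
  Ctends F f l -> F (fun x => Cmod (f x) <= Cmod l + 1).
Proof.
  intros H; generalize (H 1 Rlt_0_1); apply filter_imp; intros x Hx.
  generalize (Cmod_le_add (f x) l); lra.
Qed.

Lemma Ctends_mult (f g : T -> C) (lf lg : C) :
  Ctends F f lf -> Ctends F g lg -> Ctends F (fun x => f x * g x)%C (lf * lg)%C.
Proof.
  intros Hf Hg eps He.
  set (M := Cmod lf + 1 + Cmod lg).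
  assert (HM : 0 < M) by (unfold M; generalize (Cmod_ge_0 lf) (Cmod_ge_0 lg); lra).
  assert (He2 : 0 < eps / (2 * M)) by (apply Rdiv_lt_0_compat; lra).
  generalize (filter_and _ _ (Ctends_bounded f lf Hf) (filter_and _ _ (Hf _ He2) (Hg _ He2))).
  apply filter_imp; intros x [H0 [H1 H2]].
  replace (f x * g x - lf * lg)%C with (f x * (g x - lg) + (f x - lf) * lg)%C by ring.
  eapply Rle_lt_trans; [apply Cmod_triangle|]. rewrite !Cmod_mult.
  set (d := eps / (2 * M)) in *.
  assert (Cmod (f x) * Cmod (g x - lg)%C <= M * d).
  { apply Rmult_le_compat; try apply Cmod_ge_0; try lra. unfold M; generalize (Cmod_ge_0 lg); lra. }
  assert (Cmod (f x - lf)%C * Cmod lg < d * M).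
  { apply Rle_lt_trans with (d * Cmod lg).
    - apply Rmult_le_compat_r; [apply Cmod_ge_0|lra].
    - apply Rmult_lt_compat_l; [lra|]. unfold M; generalize (Cmod_ge_0 lf); lra. }
  assert (M * d = eps / 2) by (unfold d; field; lra). lra.
Qed.

Lemma Ctends_scal (k : C) (f : T -> C) (l : C) :
  Ctends F f l -> Ctends F (fun x => k * f x)%C (k * l)%C.
Proof. apply Ctends_mult, Ctends_const. Qed.

Lemma Ctends_opp (f : T -> C) (l : C) :
  Ctends F f l -> Ctends F (fun x => - f x)%C (- l)%C.
Proof.
  intros H. replace (- l)%C with (- (1) * l)%C by ring.
  apply (Ctends_ext (fun x => - (1) * f x)%C); [intros; ring|]. apply Ctends_scal, H.
Qed.

Lemma Ctends_minus (f g : T -> C) (lf lg : C) :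
  Ctends F f lf -> Ctends F g lg -> Ctends F (fun x => f x - g x)%C (lf - lg)%C.
Proof. intros Hf Hg. apply Ctends_plus; [exact Hf|apply Ctends_opp, Hg]. Qed.

Lemma Ctends_neq (f : T -> C) (l : C) :
  l <> 0 -> Ctends F f l -> F (fun x => Cmod l / 2 < Cmod (f x)).
Proof.
  intros Hl H. assert (Hp : 0 < Cmod l / 2) by (apply Cmod_gt_0 in Hl; lra).
  generalize (H _ Hp); apply filter_imp; intros x Hx.
  rewrite Cmod_sub_sym in Hx. generalize (Cmod_le_add l (f x)); lra.
Qed.

Lemma Ctends_inv (f : T -> C) (l : C) :
  l <> 0 -> Ctends F f l -> Ctends F (fun x => / f x)%C (/ l)%C.
Proof.
  intros Hl H eps He.
  assert (Hp : 0 < Cmod l) by (apply Cmod_gt_0; exact Hl).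
  assert (Hd : 0 < eps * (Cmod l * Cmod l / 2)).
  { apply Rmult_lt_0_compat; [exact He|]. generalize (Rmult_lt_0_compat _ _ Hp Hp); lra. }
  generalize (filter_and _ _ (H _ Hd) (Ctends_neq f l Hl H)); apply filter_imp.
  intros x [H1 H2].
  assert (Hfx : f x <> 0) by (apply Cmod_gt_0; lra).
  replace (/ f x - / l)%C with ((l - f x) / (f x * l))%C by (field; split; assumption).
  rewrite Cmod_div, Cmod_mult, Cmod_sub_sym by (apply Cmult_neq_0; assumption).
  assert (Hm : Cmod l / 2 * Cmod l < Cmod (f x) * Cmod l) by (apply Rmult_lt_compat_r; lra).
  apply (Rmult_lt_reg_r (Cmod (f x) * Cmod l)).
  - assert (0 < Cmod l / 2 * Cmod l) by (apply Rmult_lt_0_compat; lra). lra.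
  - unfold Rdiv; rewrite Rmult_assoc, Rinv_l, Rmult_1_r.
    + assert (eps * (Cmod l / 2 * Cmod l) < eps * (Cmod (f x) * Cmod l))
        by (apply Rmult_lt_compat_l; lra). lra.
    + apply Rgt_not_eq. apply Rmult_lt_0_compat; lra.
Qed.

Lemma Ctends_div (f g : T -> C) (lf lg : C) :
  lg <> 0 -> Ctends F f lf -> Ctends F g lg -> Ctends F (fun x => f x / g x)%C (lf / lg)%C.
Proof. intros Hl Hf Hg. apply Ctends_mult; [exact Hf|apply Ctends_inv; assumption]. Qed.

Context {PF : ProperFilter F}.

Lemma Ctends_unique (f : T -> C) (l l' : C) : Ctends F f l -> Ctends F f l' -> l = l'.
Proof.
  intros H H'. destruct (Ceq_dec l l') as [E|E]; [exact E|exfalso].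
  assert (Hd : 0 < Cmod (l - l')%C / 2).
  { assert (0 < Cmod (l - l')%C); [|lra]. apply Cmod_gt_0, Cminus_eq_contra, E. }
  destruct (filter_ex _ (filter_and _ _ (H _ Hd) (H' _ Hd))) as [x [H1 H2]].
  generalize (Cmod_triangle (l - f x) (f x - l')).
  replace (l - f x + (f x - l'))%C with (l - l')%C by ring.
  rewrite (Cmod_sub_sym l (f x)). lra.
Qed.

Lemma Ctends_Re_ge0 (f : T -> C) (l : C) :
  Ctends F f l -> F (fun x => 0 <= Re (f x)) -> 0 <= Re l.
Proof.
  intros H H0. destruct (Rle_dec 0 (Re l)) as [E|E]; [exact E|exfalso].
  assert (Hd : 0 < - Re l) by lra.
  destruct (filter_ex _ (filter_and _ _ (H _ Hd) H0)) as [x [H1 H2]].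
  generalize (re_le_Cmod (f x - l)%C) (Rle_abs (Re (f x - l)%C)).
  replace (Re (f x - l)%C) with (Re (f x) - Re l) by (unfold Re; simpl; ring). lra.
Qed.

(** Allows a comparison of limits when only the moduli of the terms agree, as for Euler's products
    at conjugate points. *)
Lemma Ctends_Cmod_unique (f g : T -> C) (l m : C) :
  (forall x, Cmod (f x) = Cmod (g x)) -> Ctends F f l -> Ctends F g m -> Cmod l = Cmod m.
Proof.
  intros Hfg Hf Hg.
  assert (forall eps, 0 < eps -> Rabs (Cmod l - Cmod m) <= eps).
  { intros eps He. assert (He2 : 0 < eps / 2) by lra.
    destruct (filter_ex _ (filter_and _ _ (Hf _ He2) (Hg _ He2))) as [x [H1 H2]].
    generalize (Cmod_le_add (f x) l) (Cmod_le_add (g x) m) (Cmod_le_add l (f x)) (Cmod_le_add m (g x)).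
    rewrite (Cmod_sub_sym l), (Cmod_sub_sym m), (Hfg x). intros.
    apply Rabs_le; lra. }
  destruct (Req_dec (Cmod l) (Cmod m)) as [E|E]; [exact E|exfalso].
  assert (0 < Rabs (Cmod l - Cmod m)) by (apply Rabs_pos_lt; lra).
  generalize (H (Rabs (Cmod l - Cmod m) / 2)). lra.
Qed.

End Limits.

Lemma Ctends_comp {T U : Type} (F : (T -> Prop) -> Prop) (G : (U -> Prop) -> Prop)
  (f : T -> C) (phi : U -> T) (l : C) :
  filterlim phi G F -> Ctends F f l -> Ctends G (fun x => f (phi x)) l.
Proof. intros H Hf eps He. exact (H _ (Hf eps He)). Qed.

Lemma Ctends_CLim_seq (u : nat -> C) (l : C) : Ctends eventually u l -> CLim_seq u = l.
Proof.
  intros H.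
  assert (HR : forall f : C -> R, (forall x y, f (x - y)%C = f x - f y) ->
     (forall x, Rabs (f x) <= Cmod x) -> is_lim_seq (fun n => f (u n)) (f l)).
  { intros f Hf Hb. apply is_lim_seq_spec. intros eps.
    destruct (H eps (cond_pos eps)) as [N HN]. exists N. intros n Hn.
    rewrite <- Hf. eapply Rle_lt_trans; [apply Hb|apply HN, Hn]. }
  unfold CLim_seq.
  rewrite (is_lim_seq_unique _ _ (HR Re ltac:(intros; unfold Re; simpl; ring) re_le_Cmod)).
  assert (HI := HR Im ltac:(intros; unfold Im; simpl; ring)
    (fun x => Rle_trans _ _ _ (Rmax_r _ _) (Rmax_Cmod x))).
  rewrite (is_lim_seq_unique _ _ HI). destruct l; reflexivity.
Qed.

Lemma Ctends_seq_cauchy (u : nat -> C) :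
  (forall eps, 0 < eps -> exists N, forall n m, (N <= n)%nat -> (N <= m)%nat ->
     Cmod (u n - u m)%C < eps) ->
  exists l, Ctends eventually u l.
Proof.
  intros H.
  assert (HR : forall f : C -> R, (forall x y, f (x - y)%C = f x - f y) ->
     (forall x, Rabs (f x) <= Cmod x) -> exists l : R, is_lim_seq (fun n => f (u n)) l).
  { intros f Hf Hb. apply ex_lim_seq_cauchy_corr. intros eps.
    destruct (H eps (cond_pos eps)) as [N HN]. exists N. intros n m Hn Hm.
    rewrite <- Hf. eapply Rle_lt_trans; [apply Hb|apply HN; assumption]. }
  destruct (HR Re ltac:(intros; unfold Re; simpl; ring) re_le_Cmod) as [a Ha].
  destruct (HR Im ltac:(intros; unfold Im; simpl; ring)
    (fun x => Rle_trans _ _ _ (Rmax_r _ _) (Rmax_Cmod x))) as [b Hb].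
  exists (a, b). intros eps He.
  assert (Hs : 0 < sqrt 2) by (apply sqrt_lt_R0; lra).
  (* [Cmod_2Rmax] loses a factor sqrt 2 when passing from the components to the modulus. *)
  assert (He2 : 0 < eps / sqrt 2) by (apply Rdiv_lt_0_compat; lra).
  apply is_lim_seq_spec in Ha; apply is_lim_seq_spec in Hb.
  destruct (Ha (mkposreal _ He2)) as [N1 H1], (Hb (mkposreal _ He2)) as [N2 H2].
  exists (Nat.max N1 N2). intros n Hn.
  specialize (H1 n ltac:(lia)); specialize (H2 n ltac:(lia)). simpl in H1, H2.
  eapply Rle_lt_trans; [apply Cmod_2Rmax|].
  replace eps with (sqrt 2 * (eps / sqrt 2)) by (field; lra).
  apply Rmult_lt_compat_l; [exact Hs|].
  apply Rmax_lub_lt; [exact H1|exact H2].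
Qed.

(** * The complex exponential *)

Lemma Cmod_le_Re_Im (w : C) : Cmod w <= Rabs (Re w) + Rabs (Im w).
Proof.
  destruct w as [x y]; unfold Re, Im, Cmod; simpl.
  apply Rsqr_incr_0_var; [|generalize (Rabs_pos x) (Rabs_pos y); lra].
  rewrite Rsqr_sqrt by nra. unfold Rsqr.
  generalize (Rabs_pos x) (Rabs_pos y) (Rsqr_abs x) (Rsqr_abs y); unfold Rsqr; nra.
Qed.

Lemma Cmod_sqr (w : C) : Cmod w * Cmod w = Re w * Re w + Im w * Im w.
Proof. unfold Cmod. rewrite sqrt_sqrt; unfold Re, Im; [ring|nra]. Qed.

Lemma im_le_Cmod (w : C) : Rabs (Im w) <= Cmod w.
Proof. exact (Rle_trans _ _ _ (Rmax_r _ _) (Rmax_Cmod w)). Qed.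

Lemma Rabs_sin_le (x : R) : Rabs (sin x) <= Rabs x.
Proof.
  destruct (MVT_gen sin 0 x cos) as [c [_ Hc]].
  - intros y _. auto_derive; [exact I|ring].
  - intros y _. apply continuity_sin.
  - rewrite sin_0 in Hc. replace (sin x) with (cos c * x) by lra.
    rewrite Rabs_mult. generalize (COS_bound c); intros B.
    assert (Rabs (cos c) <= 1) by (apply Rabs_le; lra).
    generalize (Rabs_pos x) (Rabs_pos (cos c)); nra.
Qed.

Lemma one_sub_cos_bound (x : R) : 0 <= 1 - cos x <= x * x / 2.
Proof.
  generalize (COS_bound x); intros B. split; [lra|].
  replace x with (2 * (x / 2)) at 1 by field. rewrite cos_2a_sin.
  generalize (Rabs_sin_le (x / 2)); intros H.
  apply Rsqr_le_abs_1 in H. unfold Rsqr in H. lra.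
Qed.

Lemma Rabs_sin_sub_le (x : R) : Rabs x <= / 2 -> Rabs (sin x - x) <= x * x.
Proof.
  intros Hx.
  destruct (MVT_gen (fun t => sin t - t) 0 x (fun t => cos t - 1)) as [c [Hc1 Hc]].
  - intros y _. auto_derive; [exact I|ring].
  - intros y _. apply continuity_pt_minus; [apply continuity_sin|apply derivable_continuous_pt, derivable_pt_id].
  - rewrite sin_0 in Hc. replace (sin x - x) with ((cos c - 1) * x) by lra.
    rewrite Rabs_mult. generalize (one_sub_cos_bound c); intros B.
    assert (Hcx : c * c <= x * x).
    { unfold Rmin, Rmax in Hc1; destruct (Rle_dec 0 x); nra. }
    rewrite (Rabs_left1 (cos c - 1)) by lra.
    generalize (Rabs_pos x) (Rsqr_abs x); unfold Rsqr; intros H1 H2.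
    assert (-(cos c - 1) * Rabs x <= x * x / 2 * Rabs x) by (apply Rmult_le_compat_r; lra). nra.
Qed.

(** Only exp x >= 1 + x is used: at [- a] it gives exp a (1 - a) <= 1, hence exp a - 1 - a <= a^2 /
    (1 - a). *)
Lemma exp_quadratic_bound (a : R) :
  Rabs a <= / 2 -> Rabs (exp a - 1 - a) <= 2 * (a * a) /\ exp a <= 2.
Proof.
  intros Ha. apply Rabs_le_between in Ha.
  generalize (exp_ineq1_le a) (exp_ineq1_le (- a)); intros H1 H2.
  assert (H3 : exp a * exp (- a) = 1) by (rewrite <- exp_plus, Rplus_opp_r; apply exp_0).
  generalize (exp_pos a); intros H4.
  assert (exp a * (1 - a) <= 1) by nra.
  assert (exp a <= 2) by nra.
  split; [|assumption]. rewrite Rabs_right by lra. nra.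
Qed.

(** Serves both the derivative of [Cexp] and the convergence of Euler's product. The constant 4
    comes from adding the bounds 2 a^2 + b^2 and a^2 + 3 b^2 of the two components. *)
Lemma Cexp_quadratic_bound (w : C) :
  Cmod w <= / 2 -> Cmod (Cexp w - 1 - w)%C <= 4 * (Cmod w * Cmod w).
Proof.
  intros Hw. rewrite Cmod_sqr.
  generalize (re_le_Cmod w) (im_le_Cmod w).
  destruct w as [a b]; simpl. intros Ha Hb.
  eapply Rle_trans; [apply Cmod_le_Re_Im|]. unfold Cexp, Re, Im; simpl.
  destruct (exp_quadratic_bound a ltac:(lra)) as [He He2].
  generalize (exp_pos a); intros He0.
  generalize (one_sub_cos_bound b) (Rabs_sin_sub_le b ltac:(lra)); intros Hc Hs.
  assert (Rabs (exp a * cos b + - (1) + - a) <= 2 * (a * a) + b * b).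
  { replace (exp a * cos b + - (1) + - a) with ((exp a - 1 - a) + exp a * (cos b - 1)) by ring.
    eapply Rle_trans; [apply Rabs_triang|]. apply Rplus_le_compat; [exact He|].
    rewrite Rabs_mult, (Rabs_right (exp a)), (Rabs_left1 (cos b - 1)) by lra. nra. }
  assert (Rabs (exp a * sin b + - 0 + - b) <= a * a + 3 * (b * b)).
  { replace (exp a * sin b + - 0 + - b) with (exp a * (sin b - b) + b * (exp a - 1)) by ring.
    eapply Rle_trans; [apply Rabs_triang|]. rewrite !Rabs_mult, (Rabs_right (exp a)) by lra.
    assert (exp a * Rabs (sin b - b) <= 2 * (b * b)) by (apply Rmult_le_compat; try lra; apply Rabs_pos).
    assert (Rabs (exp a - 1) <= 2 * Rabs a).
    { replace (exp a - 1) with ((exp a - 1 - a) + a) by ring.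
      eapply Rle_trans; [apply Rabs_triang|].
      generalize (Rabs_pos a) (Rsqr_abs a); unfold Rsqr; intros P1 P2. nra. }
    assert (Rabs b * Rabs (exp a - 1) <= Rabs b * (2 * Rabs a))
      by (apply Rmult_le_compat_l; [apply Rabs_pos|assumption]).
    generalize (Rsqr_abs a) (Rsqr_abs b) (Rle_0_sqr (Rabs a - Rabs b)); unfold Rsqr; nra. }
  nra.
Qed.

Lemma Cexp_plus (z w : C) : Cexp (z + w)%C = (Cexp z * Cexp w)%C.
Proof.
  destruct z as [a b], w as [c d]; unfold Cexp, Re, Im, Cmult; simpl.
  rewrite exp_plus, cos_plus, sin_plus. f_equal; ring.
Qed.

Lemma Cexp_0 : Cexp 0 = 1.
Proof. unfold Cexp, Re, Im, RtoC; simpl. rewrite exp_0, cos_0, sin_0. f_equal; ring. Qed.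

Lemma Cmod_Cexp (z : C) : Cmod (Cexp z) = exp (Re z).
Proof.
  assert (H := Cmod_sqr (Cexp z)). generalize (exp_pos (Re z)) (Cmod_ge_0 (Cexp z)); intros P Q.
  assert (E : Cmod (Cexp z) * Cmod (Cexp z) = exp (Re z) * exp (Re z)).
  { rewrite H. unfold Cexp, Re, Im; simpl. generalize (sin2_cos2 (snd z)); unfold Rsqr. nra. }
  nra.
Qed.

Lemma Cexp_neq_0 (z : C) : Cexp z <> 0.
Proof. apply Cmod_pos_neq. rewrite Cmod_Cexp. apply exp_pos. Qed.

Lemma Cexp_opp (z : C) : Cexp (- z)%C = (/ Cexp z)%C.
Proof.
  assert (H : (Cexp (- z) * Cexp z)%C = 1).
  { rewrite <- Cexp_plus, <- Cexp_0. f_equal. ring. }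
  generalize (Cexp_neq_0 z); intros Hz.
  replace (Cexp (- z)) with (Cexp (- z) * Cexp z / Cexp z)%C by (field; exact Hz).
  rewrite H. field. exact Hz.
Qed.

Lemma Cexp_minus (z w : C) : Cexp (z - w)%C = (Cexp z / Cexp w)%C.
Proof. unfold Cminus. rewrite Cexp_plus, Cexp_opp. reflexivity. Qed.

Lemma Cexp_RtoC (x : R) : Cexp x = RtoC (exp x).
Proof. unfold Cexp, RtoC; simpl. rewrite cos_0, sin_0. f_equal; ring. Qed.

(** C is taken as a normed module over itself, the structure for which the product rule
    [is_derive_mult] is stated; [is_Cderive_C_derive] leads back to [C_derive]. *)
Definition is_Cderive (f : C -> C) (z l : C) : Prop :=
  @is_derive C_AbsRing (AbsRing_NormedModule C_AbsRing) f z l.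

Lemma is_derive_Cexp (z : C) : is_Cderive Cexp z (Cexp z).
Proof.
  split; [apply is_linear_scal_l|].
  intros x Hx. apply (@is_filter_lim_locally_unique C_AbsRing (AbsRing_NormedModule C_AbsRing)) in Hx. subst x.
  intros eps.
  assert (HE : 0 < exp (Re z)) by apply exp_pos.
  assert (Hd : 0 < Rmin (/ 2) (eps / (4 * exp (Re z)))).
  { apply Rmin_pos; [lra|]. apply Rdiv_lt_0_compat; [apply cond_pos|lra]. }
  apply (@locally_le_locally_norm C_AbsRing (AbsRing_NormedModule C_AbsRing)).
  exists (mkposreal _ Hd). intros y Hy.
  change (Cmod (y - z)%C < Rmin (/ 2) (eps / (4 * exp (Re z)))) in Hy.
  change (Cmod (Cexp y - Cexp z - (y - z) * Cexp z)%C <= eps * Cmod (y - z)%C).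
  replace (Cexp y) with (Cexp z * Cexp (y - z))%C by (rewrite <- Cexp_plus; f_equal; ring).
  replace (Cexp z * Cexp (y - z) - Cexp z - (y - z) * Cexp z)%C
    with (Cexp z * (Cexp (y - z) - 1 - (y - z)))%C by ring.
  set (h := (y - z)%C) in *. rewrite Cmod_mult, Cmod_Cexp.
  assert (H1 : Cmod h < / 2) by (eapply Rlt_le_trans; [exact Hy|apply Rmin_l]).
  assert (H2 : Cmod h < eps / (4 * exp (Re z))) by (eapply Rlt_le_trans; [exact Hy|apply Rmin_r]).
  generalize (Cexp_quadratic_bound h ltac:(lra)) (Cmod_ge_0 h); intros H3 H4.
  assert (H5 : exp (Re z) * Cmod (Cexp h - 1 - h)%C <= exp (Re z) * (4 * (Cmod h * Cmod h)))
    by (apply Rmult_le_compat_l; lra).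
  assert (H6 : 4 * exp (Re z) * Cmod h <= eps).
  { apply Rmult_le_reg_r with (/ (4 * exp (Re z))); [apply Rinv_0_lt_compat; lra|].
    replace (4 * exp (Re z) * Cmod h * / (4 * exp (Re z))) with (Cmod h) by (field; lra).
    unfold Rdiv in H2; lra. }
  nra.
Qed.

(** * The Gamma function *)

Lemma exp_le_compat (x y : R) : x <= y -> exp x <= exp y.
Proof. intros [H| ->]; [left; apply exp_increasing, H|right; reflexivity]. Qed.

(* The weight [|u n| exp (M / n)] decreases, so [u] is bounded; then
   [|u (n+1) - u n|] is dominated by the telescoping [1/n - 1/(n+1)]. *)
Lemma Ctends_of_ratio (u : nat -> C) (M : R) (N : nat) :
  0 <= M -> (1 <= N)%nat ->
  (forall n, (N <= n)%nat ->
     Cmod (u (S n) - u n)%C <= M / (INR (S n) * INR (S n)) * Cmod (u n)) ->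
  exists l, Ctends eventually u l.
Proof.
  intros HM HN H.
  assert (HI : forall n, (N <= n)%nat -> 0 < INR n) by (intros; apply lt_0_INR; lia).
  assert (Hsq : forall n, (N <= n)%nat -> / (INR (S n) * INR (S n)) <= / INR n - / INR (S n)).
  { intros n Hn. generalize (HI n Hn); intros Hp. rewrite S_INR.
    replace (/ INR n - / (INR n + 1)) with (/ (INR n * (INR n + 1))) by (field; lra).
    apply Rinv_le_contravar; nra. }
  assert (Hb : forall n, (N <= n)%nat ->
    Cmod (u n) * exp (M / INR n) <= Cmod (u N) * exp (M / INR N)).
  { intros n Hn. induction n as [|n IH]; [lia|].
    destruct (Nat.eq_dec N (S n)) as [->|E]; [lra|].
    assert (Hn' : (N <= n)%nat) by lia. specialize (IH Hn').
    eapply Rle_trans; [|exact IH].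
    generalize (H n Hn') (Cmod_le_add (u (S n)) (u n)) (Cmod_ge_0 (u n)); intros H1 H2 H3.
    set (x := / (INR (S n) * INR (S n))) in *.
    assert (Hx : M * x <= M / INR n - M / INR (S n)).
    { unfold Rdiv. rewrite <- Rmult_minus_distr_l. apply Rmult_le_compat_l; [exact HM|].
      apply Hsq, Hn'. }
    assert (H4 : Cmod (u (S n)) <= Cmod (u n) * exp (M / INR n - M / INR (S n))).
    { apply Rle_trans with (Cmod (u n) * (1 + M * x)); [unfold Rdiv in H1; fold x in H1; lra|].
      apply Rmult_le_compat_l; [exact H3|].
      eapply Rle_trans; [apply exp_ineq1_le|]. apply exp_le_compat; exact Hx. }
    replace (exp (M / INR n)) with (exp (M / INR n - M / INR (S n)) * exp (M / INR (S n)))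
      by (rewrite <- exp_plus; f_equal; ring).
    rewrite <- Rmult_assoc. apply Rmult_le_compat_r; [left; apply exp_pos|exact H4]. }
  set (B := Cmod (u N) * exp (M / INR N)) in *.
  assert (HB : forall n, (N <= n)%nat -> Cmod (u n) <= B).
  { intros n Hn. eapply Rle_trans; [|apply Hb, Hn].
    rewrite <- (Rmult_1_r (Cmod (u n))) at 1. apply Rmult_le_compat_l; [apply Cmod_ge_0|].
    rewrite <- exp_0. apply exp_le_compat. apply Rdiv_le_0_compat; [exact HM|apply HI, Hn]. }
  assert (HB0 : 0 <= B) by (eapply Rle_trans; [apply Cmod_ge_0|apply (HB N); lia]).
  assert (Ht : forall n k, (N <= n)%nat ->
    Cmod (u (n + k)%nat - u n)%C <= M * B * (/ INR n - / INR (n + k))).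
  { intros n k Hn. induction k as [|k IH].
    - rewrite Nat.add_0_r. replace (u n - u n)%C with (RtoC 0) by ring. rewrite Cmod_0; lra.
    - replace (n + S k)%nat with (S (n + k)) by lia.
      replace (u (S (n + k)) - u n)%C
        with ((u (S (n + k)) - u (n + k)%nat) + (u (n + k)%nat - u n))%C by ring.
      eapply Rle_trans; [apply Cmod_triangle|].
      assert (Hk : (N <= n + k)%nat) by lia.
      generalize (H _ Hk) (HB _ Hk) (Hsq _ Hk) (Cmod_ge_0 (u (n + k)%nat)).
      unfold Rdiv. set (x := / (INR (S (n + k)) * INR (S (n + k)))). intros H1 H2 H3 H4.
      assert (0 < x).
      { apply Rinv_0_lt_compat. generalize (lt_0_INR (S (n + k)) ltac:(lia)); nra. }
      assert (M * x * Cmod (u (n + k)%nat) <= M * x * B) by (apply Rmult_le_compat_l; nra).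
      assert (M * B * x <= M * B * (/ INR (n + k) - / INR (S (n + k))))
        by (apply Rmult_le_compat_l; nra).
      lra. }
  apply Ctends_seq_cauchy. intros eps He.
  destruct (nfloor_ex (2 * M * B / eps)) as [K [_ HK]].
  { apply Rdiv_le_0_compat; [nra|exact He]. }
  set (n0 := (N + K + 1)%nat).
  assert (Hn0 : M * B * / INR n0 < eps / 2).
  { assert (HK' : 2 * M * B / eps < INR n0).
    { eapply Rlt_le_trans; [exact HK|]. unfold n0. rewrite !plus_INR.
      generalize (pos_INR N); simpl; lra. }
    assert (0 < INR n0) by (apply HI; unfold n0; lia).
    apply Rmult_lt_reg_r with (INR n0); [assumption|].
    rewrite Rmult_assoc, Rinv_l, Rmult_1_r by lra.
    apply Rmult_lt_reg_r with (2 / eps); [apply Rdiv_lt_0_compat; lra|].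
    replace (M * B * (2 / eps)) with (2 * M * B / eps) by (field; lra).
    replace (eps / 2 * INR n0 * (2 / eps)) with (INR n0) by (field; lra). exact HK'. }
  assert (Hd : forall n, (n0 <= n)%nat -> Cmod (u n - u n0)%C < eps / 2).
  { intros n Hn. replace n with (n0 + (n - n0))%nat by lia.
    eapply Rle_lt_trans; [apply Ht; unfold n0; lia|].
    eapply Rle_lt_trans; [|exact Hn0]. apply Rmult_le_compat_l; [nra|].
    assert (0 < / INR (n0 + (n - n0))) by (apply Rinv_0_lt_compat, HI; unfold n0; lia). lra. }
  exists n0. intros n m Hn Hm.
  replace (u n - u m)%C with ((u n - u n0) - (u m - u n0))%C by ring.
  eapply Rle_lt_trans; [apply Cmod_sub_le|]. generalize (Hd n Hn) (Hd m Hm). lra.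
Qed.

(** The reciprocals of Euler's terms: the Pochhammer symbol stands in the numerator, so the poles of
    Gamma become harmless zeros. *)
Definition euler_recip (z : C) (n : nat) : C :=
  (poch z (S n) / (INR (fact n) * Cexp (z * ln (INR n))))%C.

Lemma RtoC_neq_0 (x : R) : x <> 0 -> RtoC x <> 0.
Proof. intros H E. apply H. now apply RtoC_inj. Qed.

Lemma INR_fact_neq_C (n : nat) : RtoC (INR (fact n)) <> 0.
Proof. apply RtoC_neq_0, INR_fact_neq_0. Qed.

Lemma poch_neq_0 (z : C) : ~ nonpos_int z -> forall n, poch z n <> 0.
Proof.
  intros Hz n. induction n as [|n IH]; simpl; [exact C1_nz|].
  apply Cmult_neq_0; [exact IH|]. intros E. apply Hz. exists n.
  rewrite RtoC_opp. replace z with (z + INR n - INR n)%C by ring. rewrite E. ring.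
Qed.

Lemma poch_eq_0 (n k : nat) : (n < k)%nat -> poch (RtoC (- INR n)) k = 0.
Proof.
  induction k as [|k IH]; [lia|]. intros H; simpl.
  destruct (Nat.eq_dec n k) as [->|E].
  - rewrite RtoC_opp. ring.
  - rewrite IH by lia. ring.
Qed.

Lemma euler_recip_step (z : C) (n : nat) : (1 <= n)%nat ->
  euler_recip z (S n) =
    (euler_recip z n * ((1 + z * / INR (S n)) * Cexp (z * (ln (INR n) - ln (INR (S n)))%R)))%C.
Proof.
  intros Hn. unfold euler_recip.
  rewrite RtoC_minus. replace (z * (ln (INR n) - ln (INR (S n))))%C
    with (z * ln (INR n) - z * ln (INR (S n)))%C by ring.
  rewrite Cexp_minus. change (poch z (S (S n))) with (poch z (S n) * (z + INR (S n)))%C.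
  rewrite fact_simpl, mult_INR, RtoC_mult.
  assert (RtoC (INR (S n)) <> 0) by (apply RtoC_neq_0, not_0_INR; lia).
  field. repeat split; try apply Cexp_neq_0; try assumption; apply INR_fact_neq_C.
Qed.

(** With x = 1/(n+1) and L = ln (n/(n+1)), the first-order terms z x and z L of (1 + z x) e^(z L)
    cancel up to O(x^2), since - 1/n <= L <= - x. *)
Lemma euler_recip_ratio (z : C) : exists (M : R) (N : nat), 0 <= M /\ (1 <= N)%nat /\
  forall n, (N <= n)%nat ->
    Cmod ((1 + z * / INR (S n)) * Cexp (z * (ln (INR n) - ln (INR (S n)))%R) - 1)%C
      <= M / (INR (S n) * INR (S n)).
Proof.
  set (m := Cmod z). assert (Hm : 0 <= m) by apply Cmod_ge_0.
  destruct (nfloor_ex (2 * m)) as [K [_ HK]]; [lra|].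
  (* The three summands bound z (x + L), z^2 x L and (1 + z x) times the quadratic remainder of
     [Cexp]. The choice of K makes |z L| <= 1/2, as that remainder estimate requires. *)
  exists (2 * m + 2 * m * m + 16 * m * m * (1 + m)), (K + 1)%nat.
  split; [nra|]. split; [lia|]. intros n Hn.
  assert (Hn1 : 1 <= INR n) by (change 1 with (INR 1); apply le_INR; lia).
  assert (Hn2 : 2 * m <= INR n).
  { generalize (le_INR _ _ Hn). rewrite plus_INR; simpl; lra. }
  set (x := / INR (S n)). set (L := ln (INR n) - ln (INR (S n))).
  assert (HSn : INR (S n) = INR n + 1) by apply S_INR.
  assert (Hx : 0 < x) by (apply Rinv_0_lt_compat; lra).
  assert (Hxn : x * INR n = 1 - x) by (unfold x; rewrite HSn; field; lra).
  set (y := / INR n). assert (Hy : 0 < y) by (apply Rinv_0_lt_compat; lra).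
  assert (Hyn : y * INR n = 1) by (unfold y; apply Rinv_l; lra).
  assert (Hxy : y - x = x * y).
  { unfold x, y. rewrite HSn. field. lra. }
  assert (Hy2 : y <= 2 * x) by nra.
  assert (HL1 : L <= - x).
  { unfold L. rewrite <- ln_div by lra.
    replace (INR n / INR (S n)) with (1 + - x) by (unfold x; rewrite HSn; field; lra).
    rewrite <- (ln_exp (- x)) at 2. apply ln_le; [nra|apply exp_ineq1_le]. }
  assert (HL2 : - y <= L).
  { assert (ln (INR (S n)) - ln (INR n) <= y); [|unfold L; lra].
    rewrite <- ln_div by lra.
    replace (INR (S n) / INR n) with (1 + y) by (unfold y; rewrite HSn; field; lra).
    rewrite <- (ln_exp y) at 2. apply ln_le; [lra|apply exp_ineq1_le]. }
  assert (HLa : Rabs L <= y) by (apply Rabs_le; lra).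
  set (w := (z * L)%C).
  assert (Hw : Cmod w <= m * y).
  { unfold w. rewrite Cmod_mult, Cmod_R. apply Rmult_le_compat_l; assumption. }
  assert (Hw2 : m * y <= / 2).
  { apply Rmult_le_reg_r with (INR n); [lra|]. rewrite Rmult_assoc, Hyn. lra. }
  generalize (Cexp_quadratic_bound w ltac:(lra)); intros HE.
  set (E := (Cexp w - 1 - w)%C) in *.
  replace ((1 + z * / INR (S n)) * Cexp w - 1)%C
    with (z * (x + L)%R + z * z * (x * L)%R + (1 + z * x) * E)%C.
  2:{ unfold E, w. rewrite RtoC_plus, RtoC_mult. unfold x. rewrite RtoC_inv by lra. ring. }
  replace (/ (INR (S n) * INR (S n))) with (x * x) by (unfold x; field; lra).
  unfold Rdiv. replace (/ (INR (S n) * INR (S n))) with (x * x) by (unfold x; field; lra).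
  eapply Rle_trans; [apply Cmod_triangle|].
  eapply Rle_trans; [apply Rplus_le_compat_r, Cmod_triangle|].
  rewrite !Cmod_mult, !Cmod_R. fold m.
  assert (B1 : Rabs (x + L) <= 2 * (x * x)).
  { rewrite Rabs_left1 by lra. nra. }
  assert (B2 : Rabs (x * L) <= 2 * (x * x)).
  { rewrite Rabs_mult, (Rabs_right x) by lra. generalize (Rabs_pos L); nra. }
  assert (B3 : Cmod (1 + z * x)%C <= 1 + m).
  { eapply Rle_trans; [apply Cmod_triangle|]. rewrite Cmod_1, Cmod_mult, Cmod_R. fold m.
    rewrite (Rabs_right x) by lra. assert (x <= 1) by nra. nra. }
  assert (B4 : Cmod E <= 16 * m * m * (x * x)).
  { eapply Rle_trans; [exact HE|]. generalize (Cmod_ge_0 w); intros W.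
    assert (Cmod w * Cmod w <= (m * y) * (m * y)) by (apply Rmult_le_compat; assumption).
    assert (y * y <= (2 * x) * (2 * x)) by (apply Rmult_le_compat; lra).
    assert (m * m * (y * y) <= m * m * (2 * x * (2 * x))) by (apply Rmult_le_compat_l; nra). lra. }
  assert (m * Rabs (x + L) <= m * (2 * (x * x))) by (apply Rmult_le_compat_l; assumption).
  assert (m * m * Rabs (x * L) <= m * m * (2 * (x * x))) by (apply Rmult_le_compat_l; nra).
  assert (Cmod (1 + z * x)%C * Cmod E <= (1 + m) * (16 * m * m * (x * x)))
    by (apply Rmult_le_compat; try apply Cmod_ge_0; assumption).
  lra.
Qed.

Lemma euler_recip_neq_0 (z : C) (n : nat) : ~ nonpos_int z -> euler_recip z n <> 0.
Proof.
  intros Hz E. apply (poch_neq_0 z Hz (S n)).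
  replace (poch z (S n)) with (euler_recip z n * (INR (fact n) * Cexp (z * ln (INR n))))%C.
  - rewrite E; ring.
  - unfold euler_recip. field. split; [apply Cexp_neq_0|apply INR_fact_neq_C].
Qed.

(** The convergence criterion applies to Euler's terms and to their reciprocals alike. The product
    of the two limits is 1, which gives the non-vanishing of Gamma without a reflection formula. *)
Lemma CGamma_regular (z : C) : ~ nonpos_int z ->
  CGamma z <> 0 /\ Ctends eventually (euler_recip z) (/ CGamma z)%C.
Proof.
  intros Hz. destruct (euler_recip_ratio z) as [M [N [HM [HN H]]]].
  set (q n := ((1 + z * / INR (S n)) * Cexp (z * (ln (INR n) - ln (INR (S n)))%R))%C) in *.
  assert (Hq : forall n, (N <= n)%nat -> euler_recip z (S n) = (euler_recip z n * q n)%C).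
  { intros n Hn. apply euler_recip_step. lia. }
  destruct (Ctends_of_ratio (euler_recip z) M N HM HN) as [r Hr].
  { intros n Hn. rewrite Hq by exact Hn.
    replace (euler_recip z n * q n - euler_recip z n)%C with ((q n - 1) * euler_recip z n)%C by ring.
    rewrite Cmod_mult. apply Rmult_le_compat_r; [apply Cmod_ge_0|apply H, Hn]. }
  set (g n := (/ euler_recip z n)%C).
  (* From here on |q n - 1| <= 1/2, hence |1 / q n - 1| <= 2 |q n - 1|; this is the constant 2 M for
     the reciprocals. *)
  destruct (nfloor_ex (2 * M)) as [K [_ HK]]; [lra|].
  destruct (Ctends_of_ratio g (2 * M) (N + K + 1)%nat ltac:(lra) ltac:(lia)) as [G HG].
  { intros n Hn. assert (Hn' : (N <= n)%nat) by lia.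
    assert (Hq2 : Cmod (q n - 1)%C <= / 2).
    { eapply Rle_trans; [apply H, Hn'|].
      assert (Hs : 2 * M <= INR (S n)).
      { apply Rle_trans with (INR (N + K + 1)); [|apply le_INR; lia].
        rewrite !plus_INR. generalize (pos_INR N); simpl; lra. }
      assert (1 <= INR (S n)) by (change 1 with (INR 1); apply le_INR; lia).
      apply Rmult_le_reg_r with (INR (S n) * INR (S n)); [nra|].
      unfold Rdiv. rewrite Rmult_assoc, Rinv_l, Rmult_1_r by nra. nra. }
    assert (Hqh : / 2 <= Cmod (q n)).
    { generalize (Cmod_le_add 1 (q n)). rewrite Cmod_1, Cmod_sub_sym. lra. }
    assert (Hq0 : q n <> 0) by (apply Cmod_pos_neq; lra).
    assert (He0 : euler_recip z n <> 0) by (apply euler_recip_neq_0, Hz).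
    unfold g. rewrite Hq by exact Hn'.
    replace (/ (euler_recip z n * q n) - / euler_recip z n)%C
      with ((1 - q n) / q n * / euler_recip z n)%C by (field; split; assumption).
    rewrite Cmod_mult. apply Rmult_le_compat_r; [apply Cmod_ge_0|].
    rewrite Cmod_div, Cmod_sub_sym by exact Hq0.
    assert (H1 : Cmod (q n - 1)%C <= M / (INR (S n) * INR (S n))) by (apply H, Hn').
    apply Rle_trans with (Cmod (q n - 1)%C * 2).
    - apply Rmult_le_compat_l; [apply Cmod_ge_0|].
      rewrite <- (Rinv_inv 2). apply Rinv_le_contravar; lra.
    - unfold Rdiv in H1 |- *. lra. }
  assert (HGG : CGamma z = G).
  { apply Ctends_CLim_seq. apply (Ctends_ext eventually g); [|exact HG].
    intros n. unfold g, euler_recip. field.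
    repeat split; [exact (poch_neq_0 z Hz (S n))|apply Cexp_neq_0|apply INR_fact_neq_C]. }
  assert (HrG : (r * G)%C = 1).
  { apply (Ctends_unique eventually (fun n => euler_recip z n * g n)%C).
    - apply (Ctends_mult eventually); [exact Hr|exact HG].
    - apply (Ctends_ext eventually (fun _ => RtoC 1)); [|apply (Ctends_const eventually)].
      intros n. unfold g. field. apply euler_recip_neq_0, Hz. }
  assert (HG0 : G <> 0).
  { intros E. rewrite E in HrG. apply C1_nz. rewrite <- HrG. ring. }
  rewrite HGG. split; [exact HG0|].
  replace (/ G)%C with r; [exact Hr|]. replace r with (r * G / G)%C by (field; exact HG0).
  rewrite HrG. field. exact HG0.
Qed.

Lemma CGamma_pole (z : C) : nonpos_int z -> CGamma z = 0.
Proof.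
  intros [k ->]. apply Ctends_CLim_seq.
  apply (Ctends_ext_loc eventually (fun _ => RtoC 0)); [|apply (Ctends_const eventually)].
  exists k. intros n Hn. rewrite poch_eq_0 by lia. unfold Cdiv. rewrite Cinv_0. ring.
Qed.

Lemma CGamma_neq_0 (z : C) : ~ nonpos_int z -> CGamma z <> 0.
Proof. intros Hz. apply CGamma_regular, Hz. Qed.

(* Also true at the poles of Gamma, where both sides are [0]. *)
Lemma euler_recip_lim (z : C) : Ctends eventually (euler_recip z) (/ CGamma z)%C.
Proof.
  destruct (Classical_Prop.classic (nonpos_int z)) as [Hz|Hz]; [|apply CGamma_regular, Hz].
  rewrite (CGamma_pole z Hz), Cinv_0. destruct Hz as [k ->].
  apply (Ctends_ext_loc eventually (fun _ => RtoC 0)); [|apply (Ctends_const eventually)].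
  exists k. intros n Hn. unfold euler_recip. rewrite poch_eq_0 by lia. unfold Cdiv. ring.
Qed.

(** * Functional equation, conjugation and positivity of Gamma *)

Lemma poch_S_left (z : C) (n : nat) : poch z (S n) = (z * poch (z + 1) n)%C.
Proof.
  induction n as [|n IH]; [simpl; ring|].
  change (poch z (S (S n))) with (poch z (S n) * (z + INR (S n)))%C.
  rewrite IH. change (poch (z + 1) (S n)) with (poch (z + 1) n * (z + 1 + INR n))%C.
  rewrite S_INR, RtoC_plus. ring.
Qed.

Lemma Ctends_inv_INR : Ctends eventually (fun n => RtoC (/ INR n)) 0.
Proof.
  apply (Ctends_le_loc eventually _ (fun n => / INR n)).
  - exists 1%nat. intros n Hn. replace (RtoC (/ INR n) - 0)%C with (RtoC (/ INR n)) by ring.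
    rewrite Cmod_R, Rabs_right; [lra|]. apply Rle_ge. left. apply Rinv_0_lt_compat, lt_0_INR. lia.
  - apply (is_lim_seq_inv INR p_infty is_lim_seq_INR). discriminate.
Qed.

(** In reciprocal form the functional equation holds at every z, poles and 0 included. At finite n
    the two sides differ by the factor 1 + (z + 1)/n, which tends to 1. *)
Lemma inv_CGamma_succ (z : C) : (/ CGamma z)%C = (z * / CGamma (z + 1))%C.
Proof.
  apply (Ctends_unique eventually (fun n => z * euler_recip (z + 1) n)%C).
  2:{ apply (Ctends_scal eventually), euler_recip_lim. }
  apply (Ctends_ext_loc eventually (fun n => euler_recip z n * (1 + (z + 1) * / INR n)%C)%C).
  - exists 1%nat. intros n Hn. unfold euler_recip.
    assert (Hn0 : 0 < INR n) by (apply lt_0_INR; lia).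
    replace (Cexp ((z + 1) * ln (INR n))) with (Cexp (z * ln (INR n)) * INR n)%C.
    2:{ rewrite <- (exp_ln (INR n)) at 2 by exact Hn0. rewrite <- Cexp_RtoC, <- Cexp_plus.
        f_equal. ring. }
    replace (z * (poch (z + 1) (S n) / (INR (fact n) * (Cexp (z * ln (INR n)) * INR n))))%C
      with ((z * poch (z + 1) (S n)) / (INR (fact n) * (Cexp (z * ln (INR n)) * INR n)))%C
      by (unfold Cdiv; ring).
    rewrite <- poch_S_left.
    change (poch z (S (S n))) with (poch z (S n) * (z + INR (S n)))%C.
    rewrite S_INR, RtoC_plus. field.
    repeat split; try apply Cexp_neq_0; try apply INR_fact_neq_C. apply RtoC_neq_0; lra.
  - replace (/ CGamma z)%C with (/ CGamma z * (1 + (z + 1) * 0))%C by ring.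
    apply (Ctends_mult eventually); [apply euler_recip_lim|]. apply (Ctends_plus eventually); [apply (Ctends_const eventually)|].
    apply (Ctends_scal eventually). apply (Ctends_ext_loc eventually (fun n => RtoC (/ INR n)));
      [|apply Ctends_inv_INR].
    exists 1%nat. intros n Hn. rewrite RtoC_inv; [reflexivity|]. apply not_0_INR. lia.
Qed.

Lemma Cinv_invol (z : C) : (/ / z)%C = z.
Proof.
  destruct (Ceq_dec z 0) as [->|Hz]; [rewrite !Cinv_0; reflexivity|]. field. exact Hz.
Qed.

Lemma Cinv_mult (x y : C) : (/ (x * y))%C = (/ x * / y)%C.
Proof.
  destruct (Ceq_dec x 0) as [->|Hx]; [rewrite Cmult_0_l, Cinv_0; ring|].
  destruct (Ceq_dec y 0) as [->|Hy]; [rewrite Cmult_0_r, Cinv_0; ring|]. field. tauto.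
Qed.

Lemma CGamma_succ (z : C) : z <> 0 -> CGamma (z + 1)%C = (z * CGamma z)%C.
Proof.
  intros Hz. rewrite <- (Cinv_invol (CGamma z)), inv_CGamma_succ, Cinv_mult, Cinv_invol.
  field. exact Hz.
Qed.

Lemma poch_conj (z : C) (n : nat) : poch (Cconj z) n = Cconj (poch z n).
Proof.
  induction n as [|n IH]; simpl.
  - unfold Cconj, RtoC; simpl; f_equal; ring.
  - rewrite IH, Cmult_conj, Cplus_conj. do 2 f_equal. unfold Cconj, RtoC; simpl; f_equal; ring.
Qed.

Lemma Cmod_inv' (z : C) : Cmod (/ z)%C = / Cmod z.
Proof.
  destruct (Ceq_dec z 0) as [->|Hz]; [|apply Cmod_inv, Hz]. rewrite Cinv_0, Cmod_0, Rinv_0. reflexivity.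
Qed.

(** Euler's terms at z and at its conjugate have equal moduli, because |n^z| depends on Re z only.
    It is needed for |Gamma(1 - is) / Gamma(1 + is)| = 1. *)
Lemma Cmod_CGamma_conj (z : C) : Cmod (CGamma (Cconj z)) = Cmod (CGamma z).
Proof.
  rewrite <- (Cinv_invol (CGamma (Cconj z))), <- (Cinv_invol (CGamma z)), !(Cmod_inv' (/ _)).
  f_equal. apply (Ctends_Cmod_unique eventually (euler_recip (Cconj z)) (euler_recip z));
    [|apply euler_recip_lim..].
  intros n. unfold euler_recip, Cdiv. rewrite !Cmod_mult, !Cmod_inv', poch_conj, Cmod_conj. f_equal.
  rewrite !Cmod_mult, !Cmod_Cexp. do 3 f_equal. destruct z; unfold Re, Cconj, RtoC; simpl; ring.
Qed.

Lemma nonpos_int_Re (z : C) : nonpos_int z -> Re z <= 0.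
Proof. intros [n ->]. rewrite re_RtoC. generalize (pos_INR n); lra. Qed.

Lemma poch_RtoC_pos (x : R) (n : nat) : 0 < x -> exists p, 0 < p /\ poch x n = RtoC p.
Proof.
  intros Hx. induction n as [|n [p [Hp E]]]; [exists 1; split; [lra|reflexivity]|].
  exists (p * (x + INR n)). split.
  - generalize (pos_INR n); nra.
  - simpl. rewrite E, RtoC_mult, RtoC_plus. reflexivity.
Qed.

Lemma CGamma_pos (x : R) : 0 < x -> exists g, 0 < g /\ CGamma x = RtoC g.
Proof.
  intros Hx.
  assert (Hz : ~ nonpos_int x) by (intros H; apply nonpos_int_Re in H; rewrite re_RtoC in H; lra).
  assert (Hn : forall n, exists p, 0 < p /\ euler_recip x n = RtoC p).
  { intros n. destruct (poch_RtoC_pos x (S n) Hx) as [p [Hp E]].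
    generalize (INR_fact_lt_0 n) (exp_pos (x * ln (INR n))); intros P1 P2.
    assert (0 < INR (fact n) * exp (x * ln (INR n))) by (apply Rmult_lt_0_compat; assumption).
    exists (p / (INR (fact n) * exp (x * ln (INR n)))). split; [apply Rdiv_lt_0_compat; assumption|].
    unfold euler_recip. rewrite E, <- RtoC_mult, Cexp_RtoC, <- RtoC_mult, RtoC_div by lra. reflexivity. }
  generalize (euler_recip_lim x); intros HL.
  assert (H1 : 0 <= Re (/ CGamma x)%C).
  { apply (Ctends_Re_ge0 eventually _ _ HL). apply filter_forall. intros n.
    destruct (Hn n) as [p [Hp ->]]. rewrite re_RtoC; lra. }
  (* Multiplying the positive terms by i and by -i makes their real parts 0, so the imaginary part
     of the limit has both signs and vanishes. *)
  assert (HI : forall k : R, 0 <= Re ((k * Ci) * / CGamma x)%C).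
  { intros k. apply (Ctends_Re_ge0 eventually _ _ (Ctends_scal eventually (k * Ci)%C _ _ HL)).
    apply filter_forall. intros n. destruct (Hn n) as [p [Hp ->]].
    unfold Re, Ci, RtoC; simpl; lra. }
  assert (Him : Im (/ CGamma x)%C = 0).
  { generalize (HI 1) (HI (-1)). unfold Re, Im, Ci, RtoC. destruct (/ CGamma x)%C as [p q]. simpl. lra. }
  assert (E : (/ CGamma x)%C = RtoC (Re (/ CGamma x)%C)).
  { apply injective_projections; [reflexivity|exact Him]. }
  set (r := Re (/ CGamma x)%C) in *.
  assert (Hr : r <> 0).
  { intros E0. rewrite E0 in E. apply (CGamma_neq_0 x Hz).
    rewrite <- (Cinv_invol (CGamma x)), E, Cinv_0. reflexivity. }
  exists (/ r). split; [apply Rinv_0_lt_compat; lra|].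
  rewrite <- (Cinv_invol (CGamma x)), E, RtoC_inv by exact Hr. reflexivity.
Qed.

(** * Complex power series *)

Lemma ex_Rseries_scal (k : R) (u : nat -> R) : ex_series u -> ex_series (fun n => k * u n).
Proof. apply (ex_series_scal_l k u). Qed.

Lemma ex_Rseries_ext (u v : nat -> R) : (forall n, u n = v n) -> ex_series u -> ex_series v.
Proof. apply ex_series_ext. Qed.

Definition Csummable (u : nat -> C) : Prop := ex_series (fun n => Cmod (u n)).

Lemma Csummable_le (u : nat -> C) (v : nat -> R) :
  (forall n, Cmod (u n) <= v n) -> ex_series v -> Csummable u.
Proof.
  intros H Hv. apply (@ex_series_le R_AbsRing R_CompleteNormedModule _ v); [|exact Hv].
  intros n. change (Rabs (Cmod (u n)) <= v n).
  rewrite Rabs_right by (apply Rle_ge, Cmod_ge_0). apply H.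
Qed.

Lemma Csummable_Re_abs (u : nat -> C) : Csummable u -> ex_series (fun n => Rabs (Re (u n))).
Proof.
  apply (@ex_series_le R_AbsRing R_CompleteNormedModule). intros n.
  change (Rabs (Rabs (Re (u n))) <= Cmod (u n)). rewrite Rabs_Rabsolu. apply re_le_Cmod.
Qed.

Lemma Csummable_Im_abs (u : nat -> C) : Csummable u -> ex_series (fun n => Rabs (Im (u n))).
Proof.
  apply (@ex_series_le R_AbsRing R_CompleteNormedModule). intros n.
  change (Rabs (Rabs (Im (u n))) <= Cmod (u n)). rewrite Rabs_Rabsolu. apply im_le_Cmod.
Qed.

Lemma Csummable_Re (u : nat -> C) : Csummable u -> ex_series (fun n => Re (u n)).
Proof. intros H. apply ex_series_Rabs, Csummable_Re_abs, H. Qed.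

Lemma Csummable_Im (u : nat -> C) : Csummable u -> ex_series (fun n => Im (u n)).
Proof. intros H. apply ex_series_Rabs, Csummable_Im_abs, H. Qed.

Lemma Csummable_scal (k : C) (u : nat -> C) : Csummable u -> Csummable (fun n => k * u n)%C.
Proof.
  intros H. apply (ex_Rseries_ext (fun n => Cmod k * Cmod (u n))).
  - intros n. symmetry; apply Cmod_mult.
  - apply ex_Rseries_scal, H.
Qed.

Lemma CSeries_ext (u v : nat -> C) : (forall n, u n = v n) -> CSeries u = CSeries v.
Proof. intros H. unfold CSeries. f_equal; apply Series_ext; intros n; rewrite H; reflexivity. Qed.

Lemma CSeries_plus (u v : nat -> C) : Csummable u -> Csummable v ->
  CSeries (fun n => u n + v n)%C = (CSeries u + CSeries v)%C.
Proof.
  intros Hu Hv. unfold CSeries, Cplus; simpl. f_equal.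
  - apply (Series_plus (fun n => Re (u n)) (fun n => Re (v n))); apply Csummable_Re; assumption.
  - apply (Series_plus (fun n => Im (u n)) (fun n => Im (v n))); apply Csummable_Im; assumption.
Qed.

Lemma CSeries_scal (k : C) (u : nat -> C) : Csummable u ->
  CSeries (fun n => k * u n)%C = (k * CSeries u)%C.
Proof.
  intros Hu. assert (HR := Csummable_Re u Hu). assert (HI := Csummable_Im u Hu).
  unfold CSeries, Cmult; simpl. f_equal.
  - rewrite <- !Series_scal_l, <- Series_minus; [reflexivity| |];
      apply ex_Rseries_scal; assumption.
  - rewrite <- !Series_scal_l, <- Series_plus; [reflexivity| |];
      apply ex_Rseries_scal; assumption.
Qed.

Lemma CSeries_minus (u v : nat -> C) : Csummable u -> Csummable v ->
  CSeries (fun n => u n - v n)%C = (CSeries u - CSeries v)%C.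
Proof.
  intros Hu Hv. replace (CSeries u - CSeries v)%C with (CSeries u + - (1) * CSeries v)%C by ring.
  rewrite <- CSeries_scal by exact Hv. rewrite <- CSeries_plus.
  - apply CSeries_ext; intros; ring.
  - exact Hu.
  - apply Csummable_scal, Hv.
Qed.

Lemma Csummable_minus (u v : nat -> C) :
  Csummable u -> Csummable v -> Csummable (fun n => u n - v n)%C.
Proof.
  intros Hu Hv. apply (Csummable_le _ (fun n => Cmod (u n) + Cmod (v n))).
  - intros n. apply Cmod_sub_le.
  - apply (ex_series_plus (fun n => Cmod (u n)) (fun n => Cmod (v n))); assumption.
Qed.

Lemma Csummable_incr_1 (u : nat -> C) : Csummable u <-> Csummable (fun n => u (S n)).
Proof. apply (ex_series_incr_1 (fun n => Cmod (u n))). Qed.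

Lemma CSeries_incr_1 (u : nat -> C) : Csummable u ->
  CSeries u = (u O + CSeries (fun n => u (S n)))%C.
Proof.
  intros H. unfold CSeries, Cplus; simpl. f_equal; rewrite Series_incr_1; try reflexivity.
  - apply Csummable_Re, H.
  - apply Csummable_Im, H.
Qed.

(** Summing by components would cost a constant. Multiplication by the conjugate of the sum S turns
    |S|^2 into a real series whose terms are at most |S| v n in absolute value. *)
Lemma Cmod_CSeries_le (u : nat -> C) (v : nat -> R) :
  (forall n, Cmod (u n) <= v n) -> ex_series v -> Cmod (CSeries u) <= Series v.
Proof.
  intros Hv Ev. set (S := CSeries u). assert (Hs := Csummable_le u v Hv Ev).
  destruct (Ceq_dec S 0) as [E|E].
  - rewrite E, Cmod_0. rewrite <- (Rmult_0_l (Series v)), <- Series_scal_l.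
    apply Series_le; [|exact Ev]. intros n. generalize (Cmod_ge_0 (u n)) (Hv n); lra.
  - assert (Hp : 0 < Cmod S) by (apply Cmod_gt_0, E).
    assert (H : Cmod S * Cmod S <= Cmod S * Series v).
    { rewrite Cmod_sqr.
      replace (Re S * Re S + Im S * Im S) with (Re (Cconj S * S)%C)
        by (destruct S; unfold Re, Im, Cconj; simpl; ring).
      unfold S at 2. rewrite <- CSeries_scal by exact Hs. rewrite <- Series_scal_l.
      unfold CSeries, Re at 1; simpl fst.
      eapply Rle_trans; [apply Rle_abs|].
      eapply Rle_trans; [apply Series_Rabs|].
      + apply (Csummable_Re_abs (fun n => Cconj S * u n)%C), Csummable_scal, Hs.
      + apply Series_le.
        * intros n. split; [apply Rabs_pos|]. eapply Rle_trans; [exact (re_le_Cmod (Cconj S * u n)%C)|].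
          rewrite Cmod_mult, Cmod_conj. apply Rmult_le_compat_l; [lra|apply Hv].
        * apply ex_Rseries_scal, Ev. }
    nra.
Qed.

Definition Csum (u : nat -> C) (n : nat) : C :=
  (sum_f_R0 (fun k => Re (u k)) n, sum_f_R0 (fun k => Im (u k)) n).

Lemma Csum_0 (u : nat -> C) : Csum u O = u O.
Proof. unfold Csum; simpl. destruct (u O); reflexivity. Qed.

Lemma Csum_S (u : nat -> C) (n : nat) : Csum u (S n) = (Csum u n + u (S n))%C.
Proof. reflexivity. Qed.

Lemma Csum_ext (u v : nat -> C) (n : nat) :
  (forall k, (k <= n)%nat -> u k = v k) -> Csum u n = Csum v n.
Proof. intros H. unfold Csum. f_equal; apply sum_eq; intros i Hi; rewrite H by exact Hi; reflexivity. Qed.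

Lemma Csum_scal (k : C) (u : nat -> C) (n : nat) : (k * Csum u n)%C = Csum (fun i => k * u i)%C n.
Proof. induction n as [|n IH]; [rewrite !Csum_0|rewrite !Csum_S, <- IH]; ring. Qed.

Lemma Csum_minus (u v : nat -> C) (n : nat) :
  (Csum u n - Csum v n)%C = Csum (fun i => u i - v i)%C n.
Proof. induction n as [|n IH]; [rewrite !Csum_0|rewrite !Csum_S, <- IH]; ring. Qed.

(** Four real Cauchy products, one for each pairing of real and imaginary parts; this is where
    absolute convergence is needed. *)
Lemma CSeries_mult (a b : nat -> C) : Csummable a -> Csummable b ->
  (CSeries a * CSeries b)%C = CSeries (fun n => Csum (fun k => a k * b (n - k)%nat)%C n).
Proof.
  intros Ha Hb.
  assert (P : forall f g : C -> R,
    ex_series (fun n => Rabs (f (a n))) -> ex_series (fun n => Rabs (g (b n))) ->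
    is_series (fun n => sum_f_R0 (fun k => f (a k) * g (b (n - k)%nat)) n)
      (Series (fun n => f (a n)) * Series (fun n => g (b n)))).
  { intros f g Hf Hg. apply (is_series_mult (fun n => f (a n)) (fun n => g (b n)));
      try assumption; apply Series_correct, ex_series_Rabs; assumption. }
  assert (Ra := Csummable_Re_abs a Ha). assert (Ia := Csummable_Im_abs a Ha).
  assert (Rb := Csummable_Re_abs b Hb). assert (Ib := Csummable_Im_abs b Hb).
  unfold CSeries, Cmult; simpl. symmetry; f_equal; apply is_series_unique.
  - eapply is_series_ext; [|apply (is_series_minus _ _ _ _ (P Re Re Ra Rb) (P Im Im Ia Ib))].
    intros n. unfold Csum, Re; simpl. symmetry. apply minus_sum.
  - eapply is_series_ext; [|apply (is_series_plus _ _ _ _ (P Re Im Ra Ib) (P Im Re Ia Rb))].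
    intros n. unfold Csum, Im; simpl. symmetry. rewrite plus_sum. reflexivity.
Qed.

(** * Power series in the unit disc *)

Definition Cpseries (d : nat -> C) (z : C) : C := CSeries (fun n => d n * z ^ n)%C.

Definition radius_ge_1 (d : nat -> C) : Prop :=
  forall r, 0 <= r < 1 -> ex_series (fun n => Cmod (d n) * r ^ n).

Lemma radius_ge_1_CV (d : nat -> C) (r : R) : radius_ge_1 d -> 0 <= r < 1 ->
  Rbar_lt r (CV_radius (fun n => Cmod (d n))).
Proof.
  (* Absolute convergence at the midpoint of r and 1 is what makes the inequality with the radius
     strict. *)
  intros H Hr. assert (Hm : 0 <= (r + 1) / 2 < 1) by lra.
  apply Rbar_lt_le_trans with ((r + 1) / 2); [simpl; lra|].
  unfold CV_radius. apply (proj1 (Lub_Rbar_correct (CV_disk (fun n => Cmod (d n))))).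
  eapply ex_Rseries_ext; [|apply (H _ Hm)].
  intros n; simpl. symmetry. apply Rabs_right, Rle_ge, Rmult_le_pos; [apply Cmod_ge_0|apply pow_le; lra].
Qed.

Lemma radius_ge_1_of_CV (d : nat -> C) :
  (forall r, 0 <= r < 1 -> Rbar_lt r (CV_radius (fun n => Cmod (d n)))) -> radius_ge_1 d.
Proof.
  intros H r Hr. eapply ex_Rseries_ext; [|apply (CV_disk_inside (fun n => Cmod (d n)) r)].
  - intros n. apply Rabs_right, Rle_ge, Rmult_le_pos; [apply Cmod_ge_0|apply pow_le; lra].
  - rewrite Rabs_right by lra. apply H, Hr.
Qed.

Definition Cderive_seq (d : nat -> C) (n : nat) : C := (INR (S n) * d (S n))%C.

Lemma Cmod_Cderive_seq (d : nat -> C) (n : nat) :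
  Cmod (Cderive_seq d n) = INR (S n) * Cmod (d (S n)).
Proof.
  unfold Cderive_seq. rewrite Cmod_mult, Cmod_R, Rabs_right; [reflexivity|apply Rle_ge, pos_INR].
Qed.

Lemma radius_ge_1_derive (d : nat -> C) : radius_ge_1 d -> radius_ge_1 (Cderive_seq d).
Proof.
  intros H. apply radius_ge_1_of_CV. intros r Hr.
  rewrite (CV_radius_ext _ (PS_derive (fun n => Cmod (d n)))) by (apply Cmod_Cderive_seq).
  rewrite CV_radius_derive. apply radius_ge_1_CV; assumption.
Qed.

Lemma Csummable_pseries (d : nat -> C) (z : C) : radius_ge_1 d -> Cmod z < 1 ->
  Csummable (fun n => d n * z ^ n)%C.
Proof.
  intros H Hz. apply (Csummable_le _ (fun n => Cmod (d n) * Cmod z ^ n)).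
  - intros n. rewrite Cmod_mult, Cmod_pow. lra.
  - apply H. split; [apply Cmod_ge_0|exact Hz].
Qed.

(** The factor n(n-1), twice the sharp one, is kept because it is exactly the coefficient produced
    by differentiating twice; summation then gives the twice derived series of moduli. The exponents
    start at 2, where the remainder starts. *)
Lemma Cpow_taylor_bound (z h : C) (rho : R) (n : nat) :
  Cmod z <= rho -> Cmod (z + h)%C <= rho ->
  Cmod ((z + h) ^ S (S n) - z ^ S (S n) - h * (INR (S (S n)) * z ^ S n))%C
    <= INR (S (S n)) * INR (S n) * rho ^ n * (Cmod h * Cmod h).
Proof.
  intros Hz Hzh. assert (Hr : 0 <= rho) by (eapply Rle_trans; [apply Cmod_ge_0|exact Hz]).
  induction n as [|n IH].
  - simpl INR. replace ((z + h) ^ 2 - z ^ 2 - h * ((1 + 1)%R * z ^ 1))%C with (h * h)%C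
      by (rewrite RtoC_plus; simpl; ring).
    rewrite Cmod_mult. simpl. generalize (Cmod_ge_0 h); nra.
  - set (m := S n) in *.
    replace ((z + h) ^ S (S m) - z ^ S (S m) - h * (INR (S (S m)) * z ^ S m))%C
      with ((z + h) * ((z + h) ^ S m - z ^ S m - h * (INR (S m) * z ^ m))
            + h * h * (INR (S m) * z ^ m))%C.
    2:{ rewrite (S_INR (S m)), RtoC_plus, !Cpow_S. ring. }
    eapply Rle_trans; [apply Cmod_triangle|]. rewrite !Cmod_mult, Cmod_pow, Cmod_R.
    rewrite (Rabs_right (INR (S m))) by apply Rle_ge, pos_INR.
    set (T := Cmod _) in IH at 1. set (T' := Cmod _) at 2. change T' with T.
    assert (Hp : Cmod z ^ m <= rho ^ m) by (apply pow_incr; split; [apply Cmod_ge_0|exact Hz]).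
    set (H2 := Cmod h * Cmod h) in *. assert (0 <= H2) by (unfold H2; generalize (Cmod_ge_0 h); nra).
    assert (Hrm : 0 <= rho ^ m) by (apply pow_le, Hr).
    assert (HT : 0 <= T) by apply Cmod_ge_0.
    assert (B1 : Cmod (z + h)%C * T <= rho * (INR (S m) * INR m * rho ^ n * H2))
      by (apply Rmult_le_compat; try assumption; apply Cmod_ge_0).
    replace (rho * (INR (S m) * INR m * rho ^ n * H2)) with (INR (S m) * INR m * rho ^ m * H2) in B1
      by (unfold m; simpl pow; ring).
    assert (B2 : H2 * (INR (S m) * Cmod z ^ m) <= H2 * (INR (S m) * rho ^ m)).
    { apply Rmult_le_compat_l; [assumption|]. apply Rmult_le_compat_l; [apply pos_INR|exact Hp]. }
    assert (B3 : INR (S m) * INR m * rho ^ m * H2 + H2 * (INR (S m) * rho ^ m)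
                 <= INR (S (S m)) * INR (S m) * rho ^ m * H2).
    { rewrite (S_INR (S m)), (S_INR m).
      assert (0 <= rho ^ m * H2) by (apply Rmult_le_pos; assumption).
      generalize (pos_INR m); intros. nra. }
    lra.
Qed.

Lemma is_derive_Cpseries (d : nat -> C) (z : C) : radius_ge_1 d -> Cmod z < 1 ->
  is_Cderive (Cpseries d) z (Cpseries (Cderive_seq d) z).
Proof.
  intros Hd Hz. split; [apply is_linear_scal_l|].
  intros x Hx. apply (@is_filter_lim_locally_unique C_AbsRing (AbsRing_NormedModule C_AbsRing)) in Hx.
  subst x. intros eps.
  (* A radius strictly between |z| and 1: it leaves room for z + h and still lies inside the disc of
     convergence, so the remainder is at most M |h|^2 with M independent of h. *)
  set (rho := (1 + Cmod z) / 2). assert (Hrho : Cmod z < rho < 1) by (unfold rho; lra).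
  assert (Hz0 := Cmod_ge_0 z).
  set (m n := Cmod (Cderive_seq (Cderive_seq d) n) * rho ^ n).
  assert (Hm : ex_series m) by (apply (radius_ge_1_derive _ (radius_ge_1_derive _ Hd)); lra).
  set (M := Series m).
  assert (HM : 0 <= M).
  { unfold M. rewrite <- (Rmult_0_l (Series m)), <- Series_scal_l. apply Series_le; [|exact Hm].
    intros n. assert (0 <= m n); [|lra].
    apply Rmult_le_pos; [apply Cmod_ge_0|apply pow_le; lra]. }
  assert (Hdl : 0 < Rmin (rho - Cmod z) (eps / (M + 1))).
  { apply Rmin_pos; [lra|]. apply Rdiv_lt_0_compat; [apply cond_pos|lra]. }
  apply (@locally_le_locally_norm C_AbsRing (AbsRing_NormedModule C_AbsRing)).
  exists (mkposreal _ Hdl). intros y Hy.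
  change (Cmod (y - z)%C < Rmin (rho - Cmod z) (eps / (M + 1))) in Hy.
  change (Cmod (Cpseries d y - Cpseries d z - (y - z) * Cpseries (Cderive_seq d) z)%C
          <= eps * Cmod (y - z)%C).
  set (h := (y - z)%C) in *.
  assert (H1 : Cmod h < rho - Cmod z) by (eapply Rlt_le_trans; [exact Hy|apply Rmin_l]).
  assert (H2 : Cmod h < eps / (M + 1)) by (eapply Rlt_le_trans; [exact Hy|apply Rmin_r]).
  assert (Ey : @eq C y (z + h)%C) by (unfold h; generalize (y : C); intros; ring).
  assert (Hyr : Cmod (z + h)%C <= rho) by (eapply Rle_trans; [apply Cmod_triangle|lra]).
  assert (S1 : Csummable (fun n => d n * (z + h) ^ n)%C) by (apply Csummable_pseries; [exact Hd|lra]).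
  assert (S2 : Csummable (fun n => d n * z ^ n)%C) by (apply Csummable_pseries; [exact Hd|lra]).
  assert (S3 : Csummable (fun n => h * (Cderive_seq d n * z ^ n))%C).
  { apply Csummable_scal, Csummable_pseries; [apply radius_ge_1_derive, Hd|lra]. }
  assert (E : (Cpseries d y - Cpseries d z - h * Cpseries (Cderive_seq d) z)%C =
    CSeries (fun n => d (S (S n)) *
      ((z + h) ^ S (S n) - z ^ S (S n) - h * (INR (S (S n)) * z ^ S n)))%C).
  { rewrite Ey. unfold Cpseries. rewrite <- CSeries_scal by
      (apply Csummable_pseries; [apply radius_ge_1_derive, Hd|lra]).
    rewrite (CSeries_incr_1 _ S1), (CSeries_incr_1 _ S2).
    apply Csummable_incr_1 in S1. apply Csummable_incr_1 in S2.
    rewrite (CSeries_incr_1 _ S1), (CSeries_incr_1 _ S2), (CSeries_incr_1 _ S3).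
    apply Csummable_incr_1 in S1. apply Csummable_incr_1 in S2. apply Csummable_incr_1 in S3.
    match goal with |- (?a + (?b + ?A) - (?a' + (?b' + ?B)) - (?c + ?D))%C = _ =>
      replace (a + (b + A) - (a' + (b' + B)) - (c + D))%C with (A - B - D)%C end.
    2:{ unfold Cderive_seq. simpl. ring. }
    rewrite <- CSeries_minus, <- CSeries_minus; try assumption; [|apply Csummable_minus; assumption].
    apply CSeries_ext. intros n. unfold Cderive_seq. ring. }
  rewrite E.
  apply Rle_trans with (Series (fun n => (Cmod h * Cmod h) * m n)).
  - apply Cmod_CSeries_le; [|apply ex_Rseries_scal, Hm].
    intros n. rewrite Cmod_mult. unfold m. rewrite !Cmod_Cderive_seq.
    generalize (Cpow_taylor_bound z h rho n ltac:(lra) Hyr) (Cmod_ge_0 (d (S (S n)))); intros B D.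
    eapply Rle_trans; [apply Rmult_le_compat_l; [exact D|exact B]|]. right; ring.
  - rewrite Series_scal_l. fold M. generalize (Cmod_ge_0 h) (cond_pos eps); intros.
    assert (Cmod h * (M + 1) <= eps).
    { apply Rmult_le_reg_r with (/ (M + 1)); [apply Rinv_0_lt_compat; lra|].
      rewrite Rmult_assoc, Rinv_r, Rmult_1_r by lra. unfold Rdiv in H2; lra. }
    nra.
Qed.

(** * Complex derivatives and the binomial series *)

Lemma is_Cderive_C_derive (f : C -> C) (z l : C) : is_Cderive f z l -> C_derive f z = l.
Proof.
  intros H. apply is_C_derive_unique. split; [apply is_linear_scal_l|exact (proj2 H)].
Qed.

Lemma is_Cderive_mult (f g : C -> C) (z df dg : C) :
  is_Cderive f z df -> is_Cderive g z dg ->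
  is_Cderive (fun y => f y * g y)%C z (df * g z + f z * dg)%C.
Proof. intros Hf Hg. exact (is_derive_mult (K := C_AbsRing) f g z df dg Hf Hg Cmult_comm). Qed.

Lemma is_Cderive_comp (f g : C -> C) (z df dg : C) :
  is_Cderive f (g z) df -> is_Cderive g z dg -> is_Cderive (fun y => f (g y)) z (dg * df)%C.
Proof. intros Hf Hg. exact (is_derive_comp (K := C_AbsRing) (V := AbsRing_NormedModule C_AbsRing) f g z df dg Hf Hg). Qed.

Lemma is_Cderive_const (k z : C) : is_Cderive (fun _ => k) z 0.
Proof. exact (is_derive_const (K := C_AbsRing) (V := AbsRing_NormedModule C_AbsRing) k z). Qed.

Lemma is_Cderive_id (z : C) : is_Cderive (fun y => y) z 1.
Proof. exact (is_derive_id (K := C_AbsRing) z). Qed.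

Lemma is_Cderive_minus (f g : C -> C) (z df dg : C) :
  is_Cderive f z df -> is_Cderive g z dg -> is_Cderive (fun y => f y - g y)%C z (df - dg)%C.
Proof. exact (is_derive_minus (K := C_AbsRing) (V := AbsRing_NormedModule C_AbsRing) f g z df dg). Qed.

Lemma is_Cderive_scal (k : C) (f : C -> C) (z df : C) :
  is_Cderive f z df -> is_Cderive (fun y => k * f y)%C z (k * df)%C.
Proof.
  intros Hf. replace (k * df)%C with (0 * f z + k * df)%C by ring.
  apply is_Cderive_mult; [apply is_Cderive_const|exact Hf].
Qed.

(** [g] is [Re] or [Im]. Complex differentiability becomes real differentiability along a line,
    which makes the real mean value theorem available one component at a time. *)
Lemma is_derive_line (g : C -> R) (f : C -> C) (p v l : C) (x : R) :
  (forall a b, g (a - b)%C = g a - g b) -> (forall (r : R) a, g (r * a)%C = r * g a) ->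
  (forall a, Rabs (g a) <= Cmod a) ->
  is_Cderive f (p + x * v)%C l -> is_derive (fun t : R => g (f (p + t * v)%C)) x (g (l * v)%C).
Proof.
  intros Hg Hgs Hgb [_ H]. split; [apply is_linear_scal_l|].
  intros y Hy. apply (@is_filter_lim_locally_unique R_AbsRing R_NormedModule) in Hy. subst y.
  intros eps. specialize (H (p + x * v)%C (fun P HP => HP)).
  assert (He : 0 < eps / (Cmod v + 1))
    by (apply Rdiv_lt_0_compat; [apply cond_pos|generalize (Cmod_ge_0 v); lra]).
  specialize (H (mkposreal _ He)).
  apply (@locally_norm_le_locally C_AbsRing (AbsRing_NormedModule C_AbsRing)) in H.
  destruct H as [d H].
  assert (Hd : 0 < d / (Cmod v + 1))
    by (apply Rdiv_lt_0_compat; [apply cond_pos|generalize (Cmod_ge_0 v); lra]).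
  exists (mkposreal _ Hd). intros t Ht. change (Rabs (t - x) < d / (Cmod v + 1)) in Ht.
  assert (E : (p + t * v - (p + x * v))%C = ((t - x)%R * v)%C) by (rewrite RtoC_minus; ring).
  assert (Hv := Cmod_ge_0 v).
  specialize (H (p + t * v)%C).
  change (Cmod (p + t * v - (p + x * v))%C < d ->
    Cmod (f (p + t * v) - f (p + x * v) - (p + t * v - (p + x * v)) * l)%C
    <= eps / (Cmod v + 1) * Cmod (p + t * v - (p + x * v))%C) in H.
  rewrite E, Cmod_mult, Cmod_R in H.
  change (Rabs (g (f (p + t * v)%C) - g (f (p + x * v)%C) - (t - x) * g (l * v)%C)
    <= eps * Rabs (t - x)).
  rewrite <- Hg, <- Hgs, <- Hg.
  replace ((t - x)%R * (l * v))%C with ((t - x)%R * v * l)%C by ring.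
  eapply Rle_trans; [apply Hgb|]. eapply Rle_trans; [apply H|].
  - apply Rle_lt_trans with (Rabs (t - x) * (Cmod v + 1)).
    + apply Rmult_le_compat_l; [apply Rabs_pos|lra].
    + apply Rmult_lt_reg_r with (/ (Cmod v + 1)); [apply Rinv_0_lt_compat; lra|].
      rewrite Rmult_assoc, Rinv_r, Rmult_1_r by lra. exact Ht.
  - replace (eps / (Cmod v + 1) * (Rabs (t - x) * Cmod v))
      with (eps * Rabs (t - x) * (Cmod v / (Cmod v + 1))) by (field; lra).
    rewrite <- (Rmult_1_r (eps * Rabs (t - x))) at 2. apply Rmult_le_compat_l.
    + apply Rmult_le_pos; [left; apply cond_pos|apply Rabs_pos].
    + apply Rmult_le_reg_r with (Cmod v + 1); [lra|]. unfold Rdiv.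
      rewrite Rmult_assoc, Rinv_l by lra. lra.
Qed.

Lemma Re_minus (a b : C) : Re (a - b)%C = Re a - Re b.
Proof. unfold Re; simpl; ring. Qed.

Lemma Im_minus (a b : C) : Im (a - b)%C = Im a - Im b.
Proof. unfold Im; simpl; ring. Qed.

Lemma Cderive_0_segment (f : C -> C) (p q : C) :
  (forall x : R, 0 <= x <= 1 -> is_Cderive f (p + x * (q - p))%C 0) -> f q = f p.
Proof.
  intros H.
  assert (HG : forall g : C -> R, (forall a b, g (a - b)%C = g a - g b) ->
    (forall (r : R) a, g (r * a)%C = r * g a) -> (forall a, Rabs (g a) <= Cmod a) ->
    g (f q) = g (f p)).
  { intros g G1 G2 G3.
    assert (HD : forall x, 0 <= x <= 1 ->
      is_derive (fun t : R => g (f (p + t * (q - p))%C)) x 0).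
    { intros x Hx. replace 0 with (g (0 * (q - p))%C); [apply is_derive_line; auto|].
      rewrite G2. ring. }
    destruct (MVT_gen (fun t : R => g (f (p + t * (q - p))%C)) 0 1 (fun _ => 0)) as [c [_ Hc]].
    - intros x Hx. rewrite Rmin_left, Rmax_right in Hx by lra. apply HD; lra.
    - intros x Hx. rewrite Rmin_left, Rmax_right in Hx by lra.
      apply continuity_pt_filterlim. apply (ex_derive_continuous (K := R_AbsRing) (V := R_NormedModule)
        (fun t : R => g (f (p + t * (q - p))%C)) x). exists 0. apply HD; lra.
    - replace (p + 1 * (q - p))%C with q in Hc by ring.
      replace (p + 0 * (q - p))%C with p in Hc by ring. lra. }
  apply injective_projections.
  - apply (HG Re); [apply Re_minus|intros; apply re_scal_l|apply re_le_Cmod].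
  - apply (HG Im); [apply Im_minus|intros; apply im_scal_l|apply im_le_Cmod].
Qed.

(** A ratio test written without quotients, so that vanishing coefficients, as in terminating
    series, are allowed. For given r < 1 the choice of [q] makes q r < 1. *)
Lemma radius_ge_1_of_ratio (d : nat -> C) :
  (forall q, 1 < q < 2 -> exists N, forall n, (N <= n)%nat -> Cmod (d (S n)) <= q * Cmod (d n)) ->
  radius_ge_1 d.
Proof.
  intros H r Hr. set (q := 1 + (1 - r) / 2).
  destruct (H q ltac:(unfold q; lra)) as [N HN].
  apply (ex_series_incr_n _ N).
  apply (@ex_series_le R_AbsRing R_CompleteNormedModule _
    (fun k => (Cmod (d N) * r ^ N) * (q * r) ^ k)).
  - intros k. change (Rabs (Cmod (d (N + k)%nat) * r ^ (N + k)) <= Cmod (d N) * r ^ N * (q * r) ^ k).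
    rewrite Rabs_right by (apply Rle_ge, Rmult_le_pos; [apply Cmod_ge_0|apply pow_le; lra]).
    rewrite pow_add, Rpow_mult_distr.
    assert (B : Cmod (d (N + k)%nat) <= Cmod (d N) * q ^ k).
    { induction k as [|k IH]; [rewrite Nat.add_0_r; simpl; lra|].
      replace (N + S k)%nat with (S (N + k)) by lia.
      eapply Rle_trans; [apply HN; lia|]. simpl.
      replace (Cmod (d N) * (q * q ^ k)) with (q * (Cmod (d N) * q ^ k)) by ring.
      apply Rmult_le_compat_l; [unfold q; lra|exact IH]. }
    replace (Cmod (d N) * r ^ N * (q ^ k * r ^ k)) with (Cmod (d N) * q ^ k * (r ^ N * r ^ k)) by ring.
    apply Rmult_le_compat_r; [|exact B].
    apply Rmult_le_pos; apply pow_le; lra.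
  - apply ex_Rseries_scal. apply ex_series_geom. rewrite Rabs_right; unfold q; nra.
Qed.

(** * Hypergeometric coefficients and the binomial series *)

Definition hcoef (a b c : C) (n : nat) : C := (poch a n * poch b n / (poch c n * INR (fact n)))%C.

Lemma hcoef_S (a b c : C) (n : nat) :
  hcoef a b c (S n) = (hcoef a b c n * ((a + INR n) * (b + INR n) / ((c + INR n) * INR (S n))))%C.
Proof.
  unfold hcoef, Cdiv. rewrite fact_simpl, mult_INR, RtoC_mult, !Cinv_mult.
  simpl poch. rewrite !Cinv_mult. ring.
Qed.

Lemma radius_hcoef (a b c : C) : radius_ge_1 (hcoef a b c).
Proof.
  apply radius_ge_1_of_ratio. intros q Hq.
  (* Since e < 1, (1 + e)^2 <= 1 + 3 e = q. Each of (n + |a|)/(n - |c|) and (n + |b|)/(n + 1) is at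
     most 1 + e for large n. *)
  set (e := (q - 1) / 3). assert (He : 0 < e < 1) by (unfold e; lra).
  generalize (Cmod_ge_0 a) (Cmod_ge_0 b) (Cmod_ge_0 c); intros Pa Pb Pc.
  destruct (nfloor_ex ((Cmod a + Cmod b + 2 * Cmod c) / e)) as [K [_ HK]].
  { apply Rdiv_le_0_compat; lra. }
  exists (K + 1)%nat. intros n Hn.
  assert (Hn1 : Cmod a + Cmod b + 2 * Cmod c < e * INR n).
  { apply Rmult_lt_reg_r with (/ e); [apply Rinv_0_lt_compat; lra|].
    replace (e * INR n * / e) with (INR n) by (field; lra).
    eapply Rlt_le_trans; [exact HK|]. apply le_INR in Hn. rewrite plus_INR in Hn. simpl in Hn. lra. }
  assert (Hn0 : 0 <= INR n) by apply pos_INR.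
  rewrite hcoef_S, Cmod_mult, Rmult_comm. apply Rmult_le_compat_r; [apply Cmod_ge_0|].
  assert (HA : Cmod (a + INR n)%C <= INR n + Cmod a).
  { eapply Rle_trans; [apply Cmod_triangle|]. rewrite Cmod_R, Rabs_right by lra. lra. }
  assert (HB : Cmod (b + INR n)%C <= INR n + Cmod b).
  { eapply Rle_trans; [apply Cmod_triangle|]. rewrite Cmod_R, Rabs_right by lra. lra. }
  assert (HC : INR n - Cmod c <= Cmod (c + INR n)%C).
  { generalize (Cmod_sub_le (c + INR n) c). replace (c + INR n - c)%C with (RtoC (INR n)) by ring.
    rewrite Cmod_R, Rabs_right by lra. lra. }
  assert (Hcn : 0 < INR n - Cmod c) by nra.
  unfold Cdiv. rewrite Cmod_mult, Cmod_inv', !Cmod_mult, Cmod_R, Rabs_right by (apply Rle_ge, pos_INR).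
  rewrite S_INR.
  apply Rmult_le_reg_r with (Cmod (c + INR n)%C * (INR n + 1)); [nra|].
  rewrite Rmult_assoc, Rinv_l, Rmult_1_r by nra.
  apply Rle_trans with ((INR n + Cmod a) * (INR n + Cmod b)).
  { apply Rmult_le_compat; try apply Cmod_ge_0; assumption. }
  assert (B1 : INR n + Cmod a <= (1 + e) * (INR n - Cmod c)) by nra.
  assert (B2 : INR n + Cmod b <= (1 + e) * (INR n + 1)) by nra.
  apply Rle_trans with ((1 + e) * (INR n - Cmod c) * ((1 + e) * (INR n + 1))).
  { apply Rmult_le_compat; lra. }
  apply Rle_trans with (((1 + e) * (1 + e)) * ((INR n - Cmod c) * (INR n + 1))); [right; ring|].
  apply Rmult_le_compat.
  - nra.
  - nra.
  - unfold e in *. nra.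
  - apply Rmult_le_compat_r; lra.
Qed.

(** The Taylor coefficients of (1 - z)^(- al), as [bseries_eq] shows. *)
Definition bcoef (al : C) (n : nat) : C := (poch al n / INR (fact n))%C.

Lemma bcoef_S (al : C) (n : nat) : (INR (S n) * bcoef al (S n) = (al + INR n) * bcoef al n)%C.
Proof.
  unfold bcoef. rewrite fact_simpl, mult_INR, RtoC_mult. simpl poch. field.
  split; [apply INR_fact_neq_C|]. apply RtoC_neq_0, not_0_INR; lia.
Qed.

Lemma poch_1 (n : nat) : poch 1 n = INR (fact n).
Proof.
  induction n as [|n IH]; [reflexivity|].
  simpl poch. rewrite IH, fact_simpl, mult_INR, RtoC_mult, S_INR, RtoC_plus. ring.
Qed.

Lemma bcoef_hcoef (al : C) (n : nat) : bcoef al n = hcoef al 1 1 n.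
Proof. unfold bcoef, hcoef. rewrite poch_1. field. apply INR_fact_neq_C. Qed.

Lemma radius_ge_1_ext (d e : nat -> C) : (forall n, d n = e n) -> radius_ge_1 d -> radius_ge_1 e.
Proof.
  intros H Hd r Hr. apply (ex_Rseries_ext (fun n => Cmod (d n) * r ^ n)); [|apply Hd, Hr].
  intros n. rewrite H; reflexivity.
Qed.

Lemma radius_bcoef (al : C) : radius_ge_1 (bcoef al).
Proof. apply (radius_ge_1_ext (hcoef al 1 1)); [intros; symmetry; apply bcoef_hcoef|apply radius_hcoef]. Qed.

Lemma Cpseries_ext (d e : nat -> C) (z : C) :
  (forall n, d n = e n) -> Cpseries d z = Cpseries e z.
Proof. intros H. apply CSeries_ext. intros n. rewrite H. reflexivity. Qed.

Lemma Cpseries_plus (d e : nat -> C) (z : C) : radius_ge_1 d -> radius_ge_1 e -> Cmod z < 1 ->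
  Cpseries (fun n => d n + e n)%C z = (Cpseries d z + Cpseries e z)%C.
Proof.
  intros Hd He Hz. unfold Cpseries. rewrite <- CSeries_plus by (apply Csummable_pseries; assumption).
  apply CSeries_ext; intros; ring.
Qed.

Lemma Cpseries_minus (d e : nat -> C) (z : C) : radius_ge_1 d -> radius_ge_1 e -> Cmod z < 1 ->
  Cpseries (fun n => d n - e n)%C z = (Cpseries d z - Cpseries e z)%C.
Proof.
  intros Hd He Hz. unfold Cpseries. rewrite <- CSeries_minus by (apply Csummable_pseries; assumption).
  apply CSeries_ext; intros; ring.
Qed.

Lemma Cpseries_scal (k : C) (d : nat -> C) (z : C) : radius_ge_1 d -> Cmod z < 1 ->
  Cpseries (fun n => k * d n)%C z = (k * Cpseries d z)%C.
Proof.
  intros Hd Hz. unfold Cpseries. rewrite <- CSeries_scal by (apply Csummable_pseries; assumption).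
  apply CSeries_ext; intros; ring.
Qed.

Lemma Cpseries_mul_var (d : nat -> C) (z : C) : radius_ge_1 d -> Cmod z < 1 ->
  (z * Cpseries d z)%C = Cpseries (fun n => match n with O => RtoC 0 | S k => d k end) z.
Proof.
  intros Hd Hz. unfold Cpseries.
  assert (H : Csummable (fun n => z * (d n * z ^ n))%C)
    by (apply Csummable_scal, Csummable_pseries; assumption).
  rewrite <- CSeries_scal by (apply Csummable_pseries; assumption).
  rewrite (CSeries_incr_1 (fun n => match n with O => RtoC 0 | S k => d k end * z ^ n)%C).
  - rewrite Cmult_0_l, Cplus_0_l. apply CSeries_ext. intros n. simpl. ring.
  - apply Csummable_incr_1. apply (ex_Rseries_ext (fun n => Cmod (z * (d n * z ^ n))%C)); [|exact H].
    intros n. apply (f_equal Cmod). rewrite Cpow_S. ring.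
Qed.

Lemma Cpseries_euler_op (d : nat -> C) (z : C) : radius_ge_1 d -> Cmod z < 1 ->
  (z * Cpseries (Cderive_seq d) z)%C = Cpseries (fun n => INR n * d n)%C z.
Proof.
  intros Hd Hz. rewrite Cpseries_mul_var by (try apply radius_ge_1_derive; assumption).
  apply Cpseries_ext. intros [|n]; [simpl; ring|reflexivity].
Qed.

Lemma radius_ge_1_mulINR (d : nat -> C) : radius_ge_1 d -> radius_ge_1 (fun n => INR n * d n)%C.
Proof.
  intros Hd r Hr. apply ex_series_incr_1.
  apply (ex_Rseries_ext (fun n => r * (Cmod (Cderive_seq d n) * r ^ n))).
  - intros n. unfold Cderive_seq. simpl. ring.
  - apply ex_Rseries_scal, radius_ge_1_derive; assumption.
Qed.

Lemma radius_ge_1_scal (k : C) (d : nat -> C) : radius_ge_1 d -> radius_ge_1 (fun n => k * d n)%C.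
Proof.
  intros Hd r Hr. apply (ex_Rseries_ext (fun n => Cmod k * (Cmod (d n) * r ^ n))).
  - intros n. rewrite Cmod_mult. ring.
  - apply ex_Rseries_scal, Hd, Hr.
Qed.

Lemma radius_ge_1_minus (d e : nat -> C) :
  radius_ge_1 d -> radius_ge_1 e -> radius_ge_1 (fun n => d n - e n)%C.
Proof.
  intros Hd He r Hr. apply (@ex_series_le R_AbsRing R_CompleteNormedModule _
    (fun n => Cmod (d n) * r ^ n + Cmod (e n) * r ^ n)).
  - intros n. assert (0 <= r ^ n) by (apply pow_le; lra).
    change (Rabs (Cmod (d n - e n)%C * r ^ n) <= Cmod (d n) * r ^ n + Cmod (e n) * r ^ n).
    rewrite Rabs_right by (apply Rle_ge, Rmult_le_pos; [apply Cmod_ge_0|assumption]).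
    generalize (Cmod_sub_le (d n) (e n)). nra.
  - apply (ex_series_plus (fun n => Cmod (d n) * r ^ n)); [apply Hd, Hr|apply He, Hr].
Qed.

Lemma bseries_ode (al z : C) : Cmod z < 1 ->
  ((1 - z) * Cpseries (Cderive_seq (bcoef al)) z = al * Cpseries (bcoef al) z)%C.
Proof.
  intros Hz. assert (Hr := radius_bcoef al).
  replace ((1 - z) * Cpseries (Cderive_seq (bcoef al)) z)%C
    with (Cpseries (Cderive_seq (bcoef al)) z - z * Cpseries (Cderive_seq (bcoef al)) z)%C by ring.
  rewrite Cpseries_euler_op, <- Cpseries_minus, <- Cpseries_scal; try assumption.
  - apply Cpseries_ext. intros n. unfold Cderive_seq. rewrite bcoef_S. ring.
  - apply radius_ge_1_derive, Hr.
  - apply radius_ge_1_mulINR, Hr.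
Qed.

Lemma Cpseries_0 (d : nat -> C) : radius_ge_1 d -> Cpseries d 0 = d O.
Proof.
  intros Hd. unfold Cpseries. rewrite CSeries_incr_1.
  - assert (H0 : forall u : nat -> R, (forall n, u n = 0) -> Series u = 0).
    { intros u Hu. rewrite (Series_ext _ (fun n => 0 * u n)) by (intros; rewrite Hu; ring).
      rewrite Series_scal_l. ring. }
    unfold CSeries. rewrite !H0 by (intros n; simpl; ring).
    change ((0, 0) : C) with (RtoC 0). simpl. ring.
  - apply Csummable_pseries; [exact Hd|rewrite Cmod_0; lra].
Qed.

(** Because |1 - e^(x + iy)|^2 = 1 - e^x (2 cos y - e^x). *)
Lemma Cmod_1_sub_Cexp (x y : R) : exp x < 2 * cos y -> Cmod (1 - Cexp (x, y))%C < 1.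
Proof.
  intros H. generalize (exp_pos x) (Cmod_ge_0 (1 - Cexp (x, y))%C) (sin2_cos2 y); unfold Rsqr.
  intros P Q S. assert (E := Cmod_sqr (1 - Cexp (x, y))%C). unfold Cexp, Re, Im in E; simpl in E.
  unfold Cexp, Re, Im in Q |- *; simpl in Q |- *. set (m := Cmod _) in *. nra.
Qed.

(* The right-hand side times [Cexp (al * u)], as a function of [u = log (1 - z)], has derivative 0
   by [bseries_ode]; it is followed from [u = 0] along two axis-parallel segments. *)
Lemma bseries_eq (al : C) (t th : R) : 0 < t <= 1 -> - (PI / 2) < th < PI / 2 -> t < 2 * cos th ->
  Cpseries (bcoef al) (1 - Cexp (ln t, th))%C = Cexp (- (al * (ln t, th)))%C.
Proof.
  intros Ht Hth Hc.
  set (psi u := (Cpseries (bcoef al) (1 - Cexp u) * Cexp (al * u))%C).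
  assert (HD : forall u : C, Cmod (1 - Cexp u)%C < 1 -> is_Cderive psi u 0).
  { intros u Hu.
    assert (D1 : is_Cderive (fun y => 1 - Cexp y)%C u (- Cexp u)%C).
    { replace (- Cexp u)%C with (0 - Cexp u)%C by ring.
      apply is_Cderive_minus; [apply is_Cderive_const|apply is_derive_Cexp]. }
    assert (D2 := is_Cderive_comp (Cpseries (bcoef al)) (fun y => 1 - Cexp y)%C _ _ _ (is_derive_Cpseries _ _ (radius_bcoef al) Hu) D1).
    assert (D3 := is_Cderive_comp Cexp (fun y => al * y)%C u _ _ (is_derive_Cexp _)
      (is_Cderive_scal al _ _ _ (is_Cderive_id u))).
    assert (D := is_Cderive_mult _ _ _ _ _ D2 D3). unfold psi.
    match type of D with is_Cderive _ _ ?l => replace (RtoC 0) with l; [exact D|] end.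
    assert (O := bseries_ode al _ Hu). replace (1 - (1 - Cexp u))%C with (Cexp u) in O by ring.
    replace (- Cexp u * Cpseries (Cderive_seq (bcoef al)) (1 - Cexp u))%C
      with (- (al * Cpseries (bcoef al) (1 - Cexp u)))%C by (rewrite <- O; ring). ring. }
  assert (Hln : ln t <= 0) by (rewrite <- ln_1; apply ln_le; lra).
  assert (E1 : psi (ln t, 0) = psi 0).
  { apply Cderive_0_segment. intros x Hx. apply HD.
    replace (0 + x * ((ln t, 0) - 0))%C with ((x * ln t, 0) : C)
      by (apply injective_projections; simpl; ring).
    apply Cmod_1_sub_Cexp. rewrite cos_0. apply Rle_lt_trans with (exp 0); [|rewrite exp_0; lra].
    apply exp_le_compat. nra. }
  assert (E2 : psi (ln t, th) = psi (ln t, 0)).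
  { apply Cderive_0_segment. intros x Hx. apply HD.
    replace ((ln t, 0) + x * ((ln t, th) - (ln t, 0)))%C with ((ln t, x * th) : C)
      by (apply injective_projections; simpl; ring).
    apply Cmod_1_sub_Cexp. rewrite exp_ln by lra. eapply Rlt_le_trans; [exact Hc|].
    apply Rmult_le_compat_l; [lra|].
    destruct (Rle_dec 0 th) as [P|P].
    - apply cos_decr_1; nra.
    - rewrite <- (cos_neg th), <- (cos_neg (x * th)). apply cos_decr_1; nra. }
  assert (E3 : psi 0 = 1).
  { unfold psi. rewrite Cmult_0_r, Cexp_0. replace (1 - 1)%C with (RtoC 0) by ring.
    rewrite Cpseries_0 by apply radius_bcoef. unfold bcoef; simpl. field. }
  assert (E : psi (ln t, th) = 1) by (rewrite E2, E1; exact E3). unfold psi in E.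
  rewrite Cexp_opp. generalize (Cexp_neq_0 (al * (ln t, th))); intros N.
  replace (Cpseries (bcoef al) (1 - Cexp (ln t, th)))
    with (Cpseries (bcoef al) (1 - Cexp (ln t, th)) * Cexp (al * (ln t, th)) / Cexp (al * (ln t, th)))%C
    by (field; exact N).
  rewrite E. field. exact N.
Qed.

(** * Asymptotics along rays ending at 1 *)

(* [ray th t = 1 - t e^(i th)] for [t > 0]; thus [(ln t, th)] is the logarithm of [1 - z]. *)
Definition ray (th t : R) : C := (1 - Cexp (ln t, th))%C.

(** The Stolz condition: 1 - |z| is at least a fixed multiple of |1 - z|. For t <= cos th, |z|^2 = 1
    - 2 t cos th + t^2 <= 1 - t cos th. *)
Lemma ray_norm (th t : R) : 0 < t <= cos th -> Cmod (ray th t) <= 1 - cos th / 2 * t.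
Proof.
  intros Ht. assert (E := Cmod_sqr (ray th t)).
  unfold ray, Cexp, Re, Im in E |- *; simpl in E |- *. rewrite exp_ln in * by lra.
  set (m := Cmod _) in *. generalize (sin2_cos2 th) (COS_bound th); unfold Rsqr; intros S B.
  assert (E2 : m * m = 1 - 2 * t * cos th + t * t) by nra.
  assert (0 <= 1 - cos th / 2 * t) by nra.
  assert (0 <= m) by apply Cmod_ge_0. assert (m * m <= (1 - cos th / 2 * t) * (1 - cos th / 2 * t)) by nra.
  nra.
Qed.

Lemma at_right_lt (d : R) : 0 < d -> at_right 0 (fun t => 0 < t < d).
Proof.
  intros Hd. exists (mkposreal _ Hd). intros y Hy Hp. change (Rabs (y - 0) < d) in Hy.
  rewrite Rminus_0_r in Hy. apply Rabs_def2 in Hy. lra.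
Qed.

Lemma cos_pos_of (th : R) : - (PI / 2) < th < PI / 2 -> 0 < cos th <= 1.
Proof. intros H. split; [apply cos_gt_0; lra|apply COS_bound]. Qed.

Lemma ray_in_disc (th : R) : - (PI / 2) < th < PI / 2 ->
  at_right 0 (fun t => 0 < t < cos th /\ Cmod (ray th t) <= 1 - cos th / 2 * t /\
    Cmod (ray th t) < 1).
Proof.
  intros Hth. destruct (cos_pos_of th Hth) as [H1 H2].
  generalize (at_right_lt _ H1). apply filter_imp. intros t Ht.
  generalize (ray_norm th t ltac:(lra)); intros N. repeat split; try lra. nra.
Qed.

Lemma exp_scal_ln_small (s eps : R) : 0 < s -> 0 < eps -> at_right 0 (fun t => exp (s * ln t) < eps).
Proof.
  intros Hs He. set (d := exp (ln eps / s)).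
  generalize (at_right_lt d (exp_pos _)). apply filter_imp. intros t [Ht1 Ht2].
  rewrite <- (exp_ln eps) by exact He. apply exp_increasing.
  apply ln_increasing in Ht2; [|exact Ht1]. unfold d in Ht2. rewrite ln_exp in Ht2.
  apply Rmult_lt_compat_l with (r := s) in Ht2; [|exact Hs].
  replace (s * (ln eps / s)) with (ln eps) in Ht2 by (field; lra). exact Ht2.
Qed.

Lemma eventually_bounded (f : nat -> R) (M : R) :
  eventually (fun n => f n <= M) -> exists M', forall n, f n <= M'.
Proof.
  intros [N HN]. revert f HN. induction N as [|N IH]; intros f HN.
  - exists M. intros n. apply HN. lia.
  - destruct (IH (fun n => f (S n))) as [M' H']; [intros n Hn; apply HN; lia|].
    exists (Rmax (f O) M'). intros [|n]; [apply Rmax_l|].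
    eapply Rle_trans; [apply H'|apply Rmax_r].
Qed.

Lemma Ctends_unshift (u : nat -> C) (l : C) :
  Ctends eventually (fun n => u (S n)) l -> Ctends eventually u l.
Proof.
  intros H eps He. destruct (H eps He) as [N HN]. exists (S N). intros [|n] Hn; [lia|].
  apply HN. lia.
Qed.

(** The balance a + b = c + al makes the powers of n cancel. The index is [S n] because
    [euler_recip z n] contains n + 1 factors. *)
Lemma poch_quotient (a b c al : C) (n : nat) : ~ nonpos_int c -> ~ nonpos_int al ->
  (a + b = c + al)%C ->
  (poch a (S n) * poch b (S n) / (poch c (S n) * poch al (S n)))%C =
  (euler_recip a n * euler_recip b n / (euler_recip c n * euler_recip al n))%C.
Proof.
  intros Hc Hal E. unfold euler_recip.
  assert (X : (Cexp (a * ln (INR n)) * Cexp (b * ln (INR n)) =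
    Cexp (c * ln (INR n)) * Cexp (al * ln (INR n)))%C).
  { rewrite <- !Cexp_plus. f_equal.
    replace (a * ln (INR n) + b * ln (INR n))%C with ((a + b) * ln (INR n))%C by ring.
    rewrite E. ring. }
  assert (P1 := poch_neq_0 c Hc (S n)). assert (P2 := poch_neq_0 al Hal (S n)).
  assert (F := INR_fact_neq_C n).
  assert (Ea := Cexp_neq_0 (a * ln (INR n))). assert (Eb := Cexp_neq_0 (b * ln (INR n))).
  assert (Ec := Cexp_neq_0 (c * ln (INR n))). assert (El := Cexp_neq_0 (al * ln (INR n))).
  transitivity (poch a (S n) * poch b (S n) / (poch c (S n) * poch al (S n)) *
    ((Cexp (c * ln (INR n)) * Cexp (al * ln (INR n))) /
     (Cexp (a * ln (INR n)) * Cexp (b * ln (INR n)))))%C.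
  - rewrite <- X. field. tauto.
  - field. tauto.
Qed.

Lemma Re_pos_regular (z : C) : 0 < Re z -> ~ nonpos_int z.
Proof. intros H H'. apply nonpos_int_Re in H'. lra. Qed.

(** Remains true when [a] or [b] is a pole of Gamma: the terms are eventually 0 and so is the stated
    limit, by [/ 0 = 0]. *)
Lemma poch_quotient_lim (a b c al : C) : ~ nonpos_int c -> ~ nonpos_int al -> (a + b = c + al)%C ->
  Ctends eventually (fun n => poch a n * poch b n / (poch c n * poch al n))%C
    (CGamma c * CGamma al / (CGamma a * CGamma b))%C.
Proof.
  intros Hc Hal E. apply Ctends_unshift.
  apply (Ctends_ext eventually (fun n =>
    euler_recip a n * euler_recip b n / (euler_recip c n * euler_recip al n))%C).
  { intros n. symmetry. apply poch_quotient; assumption. }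
  assert (Gc := CGamma_neq_0 c Hc). assert (Gl := CGamma_neq_0 al Hal).
  replace (CGamma c * CGamma al / (CGamma a * CGamma b))%C
    with (/ CGamma a * / CGamma b / (/ CGamma c * / CGamma al))%C.
  2:{ unfold Cdiv. rewrite !Cinv_mult, !Cinv_invol. ring. }
  apply (Ctends_div eventually).
  - apply Cmult_neq_0; intros Z.
    + apply Gc. rewrite <- (Cinv_invol (CGamma c)), Z. apply Cinv_0.
    + apply Gl. rewrite <- (Cinv_invol (CGamma al)), Z. apply Cinv_0.
  - apply (Ctends_mult eventually); apply euler_recip_lim.
  - apply (Ctends_mult eventually); apply euler_recip_lim.
Qed.

(** n^al and n^(Re al) have the same modulus, so the quotient of moduli is that of two [euler_recip]
    sequences, which converges to a finite limit. The maximum with 1 takes care of n = 0, where both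
    coefficients are 1. *)
Lemma bcoef_le_Re (al : C) : 0 < Re al ->
  exists M, forall n, Cmod (bcoef al n) <= M * Cmod (bcoef (Re al) n).
Proof.
  intros Hal. assert (N1 := Re_pos_regular al Hal).
  assert (N2 : ~ nonpos_int (Re al)) by (apply Re_pos_regular; rewrite re_RtoC; exact Hal).
  assert (G2 : (/ CGamma (Re al))%C <> 0).
  { intros Z. apply (CGamma_neq_0 _ N2). rewrite <- (Cinv_invol (CGamma _)), Z. apply Cinv_0. }
  assert (H := Ctends_div eventually _ _ _ _ G2 (euler_recip_lim al) (euler_recip_lim (Re al))).
  apply (Ctends_bounded eventually) in H.
  destruct (eventually_bounded _ _ H) as [M HM].
  exists (Rmax M 1). intros [|n].
  { unfold bcoef; simpl. rewrite <- (Rmult_1_l (Cmod _)) at 1.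
    apply Rmult_le_compat_r; [apply Cmod_ge_0|apply Rmax_r]. }
  apply Rle_trans with (M * Cmod (bcoef (Re al) (S n))).
  2:{ apply Rmult_le_compat_r; [apply Cmod_ge_0|apply Rmax_l]. }
  assert (P2 := poch_neq_0 _ N2 (S n)). assert (F := INR_fact_neq_C (S n)).
  assert (Hb : Cmod (bcoef (Re al) (S n)) <> 0).
  { apply Rgt_not_eq, Cmod_gt_0. unfold bcoef. intros Z. apply P2.
    replace (poch (Re al) (S n)) with (poch (Re al) (S n) / INR (fact (S n)) * INR (fact (S n)))%C
      by (field; exact F). rewrite Z. ring. }
  assert (E : Cmod (bcoef al (S n)) =
    Cmod (euler_recip al n / euler_recip (Re al) n)%C * Cmod (bcoef (Re al) (S n))).
  2:{ rewrite E. apply Rmult_le_compat_r; [apply Cmod_ge_0|apply HM]. }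
  rewrite <- Cmod_mult.
  set (x := (Cexp (al * ln (INR n)) / Cexp (Re al * ln (INR n)))%C).
  assert (Hx : Cmod x = 1).
  { unfold x. rewrite Cmod_div by apply Cexp_neq_0. rewrite !Cmod_Cexp.
    replace (Re (Re al * ln (INR n))%C) with (Re (al * ln (INR n))%C)
      by (rewrite !re_scal_r, re_RtoC; reflexivity).
    field. apply Rgt_not_eq, exp_pos. }
  rewrite <- (Rmult_1_l (Cmod (_ * _)%C)), <- Hx, <- Cmod_mult. f_equal.
  unfold x, euler_recip, bcoef. field.
  repeat split; try apply Cexp_neq_0; try assumption; apply INR_fact_neq_C.
Qed.

(** For a positive exponent the binomial coefficients are positive, so the series of moduli is
    summed exactly; with x proportional to t it is the majorant on a ray. *)
Lemma bseries_real (s x : R) : 0 < s -> 0 < x <= 1 ->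
  is_series (fun n => Cmod (bcoef s n) * (1 - x) ^ n) (exp (- s * ln x)).
Proof.
  intros Hs Hx.
  assert (HP : 0 < PI / 2) by (generalize PI_RGT_0; lra).
  assert (E := bseries_eq s x 0 Hx ltac:(lra) ltac:(rewrite cos_0; lra)).
  replace (1 - Cexp (ln x, 0))%C with (RtoC (1 - x)) in E.
  2:{ change (ln x, 0) with (RtoC (ln x)). rewrite Cexp_RtoC, exp_ln, RtoC_minus by lra. reflexivity. }
  apply (f_equal Re) in E.
  change ((ln x, 0) : C) with (RtoC (ln x)) in E.
  rewrite <- RtoC_mult, <- RtoC_opp, Cexp_RtoC, re_RtoC in E.
  replace (- (s * ln x)) with (- s * ln x) in E by ring. rewrite <- E.
  unfold Cpseries, CSeries, Re at 1; simpl fst.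
  assert (Hn : forall n, Re (bcoef s n * RtoC (1 - x) ^ n)%C = Cmod (bcoef s n) * (1 - x) ^ n).
  { intros n. destruct (poch_RtoC_pos s n Hs) as [p [Hp Ep]].
    unfold bcoef. rewrite Ep. rewrite <- RtoC_div by apply INR_fact_neq_0.
    rewrite <- RtoC_pow, <- RtoC_mult, re_RtoC, Cmod_R, Rabs_right; [reflexivity|].
    apply Rle_ge, Rdiv_le_0_compat; [lra|apply INR_fact_lt_0]. }
  rewrite (Series_ext _ (fun n => Cmod (bcoef s n) * (1 - x) ^ n)) by exact Hn.
  apply Series_correct. apply (radius_bcoef s). lra.
Qed.

(* Abelian theorem along a ray: [d] is compared with the binomial coefficients of
   [(1 - z)^(-al)], and the error with those of the real exponent [Re al]. *)
Lemma ray_asymptotics (d q : nat -> C) (al K : C) (th : R) :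
  radius_ge_1 d -> 0 < Re al -> (forall n, d n = (q n * bcoef al n)%C) ->
  Ctends eventually q K -> - (PI / 2) < th < PI / 2 ->
  Ctends (at_right 0) (fun t => Cpseries d (ray th t) * Cexp (al * (ln t, th)))%C K.
Proof.
  intros Hd Hal Hq HK Hth.
  set (s := Re al) in *. set (kap := cos th / 2).
  assert (Hcos := cos_pos_of th Hth). assert (Hkap : 0 < kap <= / 2) by (unfold kap; lra).
  set (d' n := ((q n - K) * bcoef al n)%C).
  assert (Hrb := radius_bcoef al).
  assert (Hd' : radius_ge_1 d').
  { apply (radius_ge_1_ext (fun n => d n - K * bcoef al n)%C).
    - intros n. unfold d'. rewrite Hq. ring.
    - apply radius_ge_1_minus; [exact Hd|apply radius_ge_1_scal, Hrb]. }
  assert (Hmain : Ctends (at_right 0)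
    (fun t => Cpseries d' (ray th t) * Cexp (al * (ln t, th)))%C 0).
  2:{ apply (Ctends_ext_loc (at_right 0)
        (fun t => Cpseries d' (ray th t) * Cexp (al * (ln t, th)) + K)%C).
      - generalize (ray_in_disc th Hth). apply filter_imp. intros t [Ht [_ Hz]].
        transitivity ((Cpseries d' (ray th t) + K * Cpseries (bcoef al) (ray th t))
          * Cexp (al * (ln t, th)))%C.
        + unfold ray at 3. rewrite bseries_eq, Cexp_opp by lra. field. apply Cexp_neq_0.
        + f_equal. rewrite <- Cpseries_scal, <- Cpseries_plus by
            (try apply radius_ge_1_scal; assumption).
          apply Cpseries_ext. intros n. unfold d'. rewrite Hq. ring.
      - replace K with (0 + K)%C at 1 by ring.
        apply (Ctends_plus (at_right 0)); [exact Hmain|apply (Ctends_const (at_right 0))]. }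
  destruct (bcoef_le_Re al Hal) as [C2 HC2]. fold s in HC2.
  assert (HC2p : 0 <= C2).
  { specialize (HC2 O). unfold bcoef in HC2; simpl in HC2.
    rewrite Cmod_div, Cmod_1 in HC2 by exact C1_nz. lra. }
  set (C1 := exp (- (Im al * th))). assert (HC1 : 0 < C1) by apply exp_pos.
  assert (HE : forall t, Cmod (Cexp (al * (ln t, th))) = C1 * exp (s * ln t)).
  { intros t. rewrite Cmod_Cexp. unfold C1. rewrite <- exp_plus. f_equal.
    unfold s, Re, Im; simpl. ring. }
  set (A := C1 * C2 * exp (- s * ln kap)).
  assert (HA : 0 <= A).
  { apply Rmult_le_pos; [apply Rmult_le_pos; lra|left; apply exp_pos]. }
  intros eps He. set (e := eps / (A + 1)).
  assert (He' : 0 < e) by (apply Rdiv_lt_0_compat; lra).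
  assert (Hee : A * e + e = eps) by (unfold e; field; lra).
  destruct (HK e He') as [N HN].
  (* The finitely many terms before [q] is within [e] of [K] contribute at most a constant, which
     the factor t^s suppresses; the later terms are compared with [e] times the binomial
     majorant. *)
  set (m n := if Compare_dec.lt_dec n N then Cmod (d' n) else 0).
  assert (Hm0 : forall n, 0 <= m n) by (intros n; unfold m; destruct (Compare_dec.lt_dec n N); [apply Cmod_ge_0|lra]).
  assert (Hm : ex_series m).
  { apply (ex_series_incr_n _ N). apply (ex_Rseries_ext (fun n => 0 * (/ 2) ^ n)).
    - intros n. unfold m. destruct (Compare_dec.lt_dec (N + n) N); [lia|ring].
    - apply ex_Rseries_scal, ex_series_geom. rewrite Rabs_right; lra. }
  set (M := Series m).
  assert (HM : 0 <= M).
  { unfold M. rewrite <- (Rmult_0_l (Series m)), <- Series_scal_l. apply Series_le; [|exact Hm].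
    intros n. generalize (Hm0 n); lra. }
  assert (Hsm : 0 < e / (C1 * M + 1)) by (apply Rdiv_lt_0_compat; nra).
  generalize (filter_and _ _ (ray_in_disc th Hth) (exp_scal_ln_small s _ Hal Hsm)).
  apply filter_imp. intros t [[Ht [Hz1 Hz]] Hts].
  fold kap in Hz1.
  replace (Cpseries d' (ray th t) * Cexp (al * (ln t, th)) - 0)%C
    with (Cpseries d' (ray th t) * Cexp (al * (ln t, th)))%C by ring.
  rewrite Cmod_mult, HE.
  assert (Hkt : 0 < kap * t <= 1) by (unfold kap; split; nra).
  assert (HS := bseries_real s (kap * t) Hal Hkt).
  assert (B : Cmod (Cpseries d' (ray th t)) <= e * C2 * exp (- s * ln (kap * t)) + M).
  { rewrite <- (is_series_unique _ _ HS). unfold M. rewrite <- Series_scal_l.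
    assert (X1 : ex_series (fun n => e * C2 * (Cmod (bcoef s n) * (1 - kap * t) ^ n)))
      by (apply ex_Rseries_scal; eexists; exact HS).
    rewrite <- Series_plus; [|exact X1|exact Hm].
    apply Cmod_CSeries_le; [|apply (ex_series_plus _ _ X1 Hm)].
    intros n. rewrite Cmod_mult, Cmod_pow.
    assert (P : 0 <= Cmod (ray th t) ^ n <= (1 - kap * t) ^ n).
    { split; [apply pow_le, Cmod_ge_0|apply pow_incr; split; [apply Cmod_ge_0|lra]]. }
    assert (Q : Cmod (ray th t) ^ n <= 1).
    { rewrite <- (pow1 n). apply pow_incr; split; [apply Cmod_ge_0|lra]. }
    generalize (HC2 n) (Cmod_ge_0 (bcoef s n)) (Cmod_ge_0 (d' n)); intros D1 D2 D3.
    assert (D4 : 0 <= e * C2 * (Cmod (bcoef s n) * (1 - kap * t) ^ n))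
      by (apply Rmult_le_pos; [apply Rmult_le_pos; lra|apply Rmult_le_pos; lra]).
    unfold m. destruct (Compare_dec.lt_dec n N) as [L|L].
    - assert (Cmod (d' n) * Cmod (ray th t) ^ n <= Cmod (d' n) * 1)
        by (apply Rmult_le_compat_l; lra). lra.
    - assert (D5 : Cmod (d' n) <= e * (C2 * Cmod (bcoef s n))).
      { unfold d'. rewrite Cmod_mult. apply Rmult_le_compat; try apply Cmod_ge_0; [|exact D1].
        left. apply HN. lia. }
      assert (Cmod (d' n) * Cmod (ray th t) ^ n <= e * (C2 * Cmod (bcoef s n)) * (1 - kap * t) ^ n)
        by (apply Rmult_le_compat; lra). lra. }
  assert (Hp : 0 < exp (s * ln t)) by apply exp_pos.
  assert (X : exp (- s * ln (kap * t)) * exp (s * ln t) = exp (- s * ln kap)).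
  { rewrite <- exp_plus. f_equal. rewrite ln_mult by lra. ring. }
  apply Rle_lt_trans with ((e * C2 * exp (- s * ln (kap * t)) + M) * (C1 * exp (s * ln t))).
  { apply Rmult_le_compat_r; [nra|exact B]. }
  replace ((e * C2 * exp (- s * ln (kap * t)) + M) * (C1 * exp (s * ln t)))
    with (e * C2 * C1 * (exp (- s * ln (kap * t)) * exp (s * ln t)) + C1 * M * exp (s * ln t)) by ring.
  rewrite X. replace (e * C2 * C1 * exp (- s * ln kap)) with (A * e) by (unfold A; ring).
  rewrite <- Hee. apply Rplus_lt_compat_l.
  apply Rle_lt_trans with ((C1 * M + 1) * exp (s * ln t) - exp (s * ln t)); [right; ring|].
  assert ((C1 * M + 1) * exp (s * ln t) < e); [|lra].
  replace e with ((C1 * M + 1) * (e / (C1 * M + 1))) by (field; nra).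
  apply Rmult_lt_compat_l; [nra|exact Hts].
Qed.

Lemma hyp2F1_Cpseries (a b c z : C) : hyp2F1 a b c z = Cpseries (hcoef a b c) z.
Proof. reflexivity. Qed.

Lemma hyp2F1_ray_singular (a b c : C) (th : R) : ~ nonpos_int c -> 0 < Re (a + b - c)%C ->
  - (PI / 2) < th < PI / 2 ->
  Ctends (at_right 0) (fun t => hyp2F1 a b c (ray th t) * Cexp ((a + b - c) * (ln t, th)))%C
    (CGamma c * CGamma (a + b - c) / (CGamma a * CGamma b))%C.
Proof.
  intros Hc Hr Hth. assert (Hal := Re_pos_regular _ Hr).
  apply (ray_asymptotics (hcoef a b c)
    (fun n => poch a n * poch b n / (poch c n * poch (a + b - c) n))%C).
  - apply radius_hcoef.
  - exact Hr.
  - intros n. unfold hcoef, bcoef.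
    assert (P1 := poch_neq_0 c Hc n). assert (P2 := poch_neq_0 _ Hal n).
    assert (F := INR_fact_neq_C n). field. tauto.
  - apply poch_quotient_lim; [exact Hc|exact Hal|ring].
  - exact Hth.
Qed.

(** * Euler's transformation, Gauss's theorem and contiguous relations *)

Lemma nonpos_int_add_neq_0 (c : C) (n : nat) : ~ nonpos_int c -> (c + INR n)%C <> 0.
Proof.
  intros Hc E. apply Hc. exists n. rewrite RtoC_opp.
  replace c with (c + INR n - INR n)%C by ring. rewrite E. ring.
Qed.

Lemma regular_neq_0 (c : C) : ~ nonpos_int c -> c <> 0.
Proof.
  intros Hc E. apply (nonpos_int_add_neq_0 c 0 Hc). rewrite E. simpl. ring.
Qed.

Lemma regular_succ (c : C) : ~ nonpos_int c -> ~ nonpos_int (c + 1)%C.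
Proof.
  intros Hc [n E]. apply Hc. exists (S n). rewrite S_INR, RtoC_opp, RtoC_plus.
  replace c with (c + 1 - 1)%C by ring. rewrite E, RtoC_opp. ring.
Qed.

Lemma INR_S_neq_C (n : nat) : RtoC (INR (S n)) <> 0.
Proof. apply RtoC_neq_0, not_0_INR. lia. Qed.

Lemma hcoef_rec (a b c : C) (n : nat) : ~ nonpos_int c ->
  (INR (S n) * (c + INR n) * hcoef a b c (S n) = (a + INR n) * (b + INR n) * hcoef a b c n)%C.
Proof.
  intros Hc. rewrite hcoef_S. assert (N := nonpos_int_add_neq_0 c n Hc).
  assert (N' := INR_S_neq_C n). field. tauto.
Qed.

(* Zeilberger certificate for the first-order recurrence of the convolution: its summand is the
   difference of [- k (c + k - 1) A_k e_(n+1-k)]. *)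
Lemma euler_convolution_telescope (a b c : C) (n m : nat) : ~ nonpos_int c -> (m <= n)%nat ->
  let A := hcoef a b c in let e := bcoef (c - a - b)%C in
  Csum (fun k => INR (S n) * (c + INR n) * (A k * e (S n - k)%nat)
                 - (c - a + INR n) * (c - b + INR n) * (A k * e (n - k)%nat))%C m
  = (- ((a + INR m) * (b + INR m) * A m * e (n - m)%nat))%C.
Proof.
  intros Hc Hm A e. induction m as [|k IH].
  - rewrite Csum_0, !Nat.sub_0_r.
    replace (INR (S n) * (c + INR n) * (A 0%nat * e (S n)))%C
      with ((c + INR n) * A 0%nat * (INR (S n) * e (S n)))%C by ring.
    unfold e. rewrite bcoef_S. simpl INR. ring.
  - rewrite Csum_S, IH by lia.
    replace (S n - S k)%nat with (S (n - S k)) by lia. replace (n - k)%nat with (S (n - S k)) by lia.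
    set (j := (n - S k)%nat).
    assert (En : RtoC (INR n) = (INR k + 1 + INR j)%C).
    { replace n with (S k + j)%nat by (unfold j; lia). rewrite plus_INR, S_INR, !RtoC_plus. ring. }
    unfold A. rewrite <- (hcoef_rec a b c k Hc). fold A.
    replace (INR (S n) * (c + INR n) * (A (S k) * e (S j)))%C
      with ((INR n + 1) * (c + INR n) * A (S k) * e (S j))%C
      by (rewrite S_INR, RtoC_plus; ring).
    assert (Ej : ((INR j + 1) * e (S j) = (c - a - b + INR j) * e j)%C).
    { unfold e. rewrite <- bcoef_S, S_INR, RtoC_plus. ring. }
    rewrite !S_INR, !RtoC_plus, En.
    transitivity (A (S k) * ((c + 2 * (INR k + 1) + INR j) * ((INR j + 1) * e (S j))
      - (c - a + (INR k + 1 + INR j)) * (c - b + (INR k + 1 + INR j)) * e j))%C; [ring|].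
    rewrite Ej. ring.
Qed.

(** Both sides obey (n+1)(c+n) u_(n+1) = (c-a+n)(c-b+n) u_n. The telescoped sum stops at k = n, and
    its boundary term cancels the missing summand k = n + 1 by [hcoef_rec]. *)
Lemma euler_convolution (a b c : C) (n : nat) : ~ nonpos_int c ->
  Csum (fun k => hcoef a b c k * bcoef (c - a - b) (n - k)%nat)%C n = hcoef (c - a) (c - b) c n.
Proof.
  intros Hc. induction n as [|n IH].
  - rewrite Csum_0. unfold hcoef, bcoef; simpl. field.
  - assert (N := nonpos_int_add_neq_0 c n Hc). assert (N' := INR_S_neq_C n).
    assert (T := euler_convolution_telescope a b c n n Hc (Nat.le_refl n)). cbv zeta in T.
    rewrite <- Csum_minus, <- !Csum_scal, IH, Nat.sub_diag in T.
    rewrite Csum_S, Nat.sub_diag.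
    assert (R1 := hcoef_rec a b c n Hc). assert (R2 := hcoef_rec (c - a) (c - b) c n Hc).
    rewrite <- R2 in T.
    set (X := Csum (fun k => hcoef a b c k * bcoef (c - a - b) (S n - k)%nat)%C n) in *. set (e0 := bcoef _ 0) in *.
    assert (E : (INR (S n) * (c + INR n) * (X + hcoef a b c (S n) * e0) =
      INR (S n) * (c + INR n) * hcoef (c - a) (c - b) c (S n))%C).
    { transitivity (INR (S n) * (c + INR n) * X
        + INR (S n) * (c + INR n) * hcoef a b c (S n) * e0)%C; [ring|].
      rewrite R1.
      transitivity ((INR (S n) * (c + INR n) * X
        - INR (S n) * (c + INR n) * hcoef (c - a) (c - b) c (S n))
        + (a + INR n) * (b + INR n) * hcoef a b c n * e0
        + INR (S n) * (c + INR n) * hcoef (c - a) (c - b) c (S n))%C; [ring|].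
      rewrite T. ring. }
    set (P := (INR (S n) * (c + INR n))%C) in *.
    assert (HP : P <> 0) by (apply Cmult_neq_0; assumption).
    replace (hcoef (c - a) (c - b) c (S n)) with (P * hcoef (c - a) (c - b) c (S n) / P)%C
      by (field; exact HP).
    rewrite <- E. field. exact HP.
Qed.

Lemma euler_transformation (a b c z : C) : ~ nonpos_int c -> Cmod z < 1 ->
  (hyp2F1 a b c z * Cpseries (bcoef (c - a - b)) z)%C = hyp2F1 (c - a) (c - b) c z.
Proof.
  intros Hc Hz. unfold hyp2F1, Cpseries.
  rewrite CSeries_mult.
  - apply CSeries_ext. intros n. fold (hcoef (c - a) (c - b) c n).
    rewrite <- (euler_convolution a b c n Hc), (Cmult_comm (Csum _ n)), Csum_scal.
    apply Csum_ext. intros k Hk. fold (hcoef a b c k).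
    replace n with (k + (n - k))%nat at 3 by lia. rewrite Cpow_add_r. ring.
  - apply (Csummable_pseries (hcoef a b c)); [apply radius_hcoef|exact Hz].
  - apply Csummable_pseries; [apply radius_bcoef|exact Hz].
Qed.

Lemma euler_transformation_ray (a b c : C) (th t : R) : ~ nonpos_int c ->
  - (PI / 2) < th < PI / 2 -> 0 < t < cos th ->
  hyp2F1 a b c (ray th t) =
  (hyp2F1 (c - a) (c - b) c (ray th t) * Cexp ((c - a - b) * (ln t, th)))%C.
Proof.
  intros Hc Hth Ht. assert (Hcos := cos_pos_of th Hth).
  assert (Hz : Cmod (ray th t) < 1) by (generalize (ray_norm th t ltac:(lra)); nra).
  rewrite <- (euler_transformation a b c _ Hc Hz). unfold ray at 3.
  rewrite bseries_eq, Cexp_opp by lra. field. apply Cexp_neq_0.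
Qed.

(** The transformed function has exponent (c - a) + (c - b) - c = c - a - b, so the singular
    asymptotics apply to it. If [c - a] or [c - b] is a pole of Gamma the value is 0. *)
Lemma gauss_limit (a b c : C) (th : R) : ~ nonpos_int c -> 0 < Re (c - a - b)%C ->
  - (PI / 2) < th < PI / 2 ->
  Ctends (at_right 0) (fun t => hyp2F1 a b c (ray th t))
    (CGamma c * CGamma (c - a - b) / (CGamma (c - a) * CGamma (c - b)))%C.
Proof.
  intros Hc Hg Hth.
  assert (E : (c - a - b)%C = (c - a + (c - b) - c)%C) by ring. rewrite E in Hg |- *.
  apply (Ctends_ext_loc (at_right 0) (fun t =>
    hyp2F1 (c - a) (c - b) c (ray th t) * Cexp ((c - a + (c - b) - c) * (ln t, th)))%C).
  - generalize (ray_in_disc th Hth). apply filter_imp. intros t [Ht _].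
    rewrite (euler_transformation_ray a b c th t Hc Hth Ht), E. reflexivity.
  - apply hyp2F1_ray_singular; assumption.
Qed.

(** * Derivative, contiguous relations and terminating series *)

Definition hyp2F1' (a b c z : C) : C := (a * b / c * hyp2F1 (a + 1) (b + 1) (c + 1) z)%C.

Lemma hcoef_derive (a b c : C) (n : nat) : ~ nonpos_int c ->
  Cderive_seq (hcoef a b c) n = (a * b / c * hcoef (a + 1) (b + 1) (c + 1) n)%C.
Proof.
  intros Hc. unfold Cderive_seq, hcoef.
  rewrite !poch_S_left, fact_simpl, mult_INR, RtoC_mult.
  assert (N1 := regular_neq_0 c Hc). assert (N2 := poch_neq_0 _ (regular_succ c Hc) n).
  assert (N3 := INR_fact_neq_C n). assert (N4 := INR_S_neq_C n). field. tauto.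
Qed.

Lemma hyp2F1'_Cpseries (a b c z : C) : ~ nonpos_int c -> Cmod z < 1 ->
  hyp2F1' a b c z = Cpseries (Cderive_seq (hcoef a b c)) z.
Proof.
  intros Hc Hz. unfold hyp2F1'. rewrite hyp2F1_Cpseries.
  rewrite <- Cpseries_scal by (try apply radius_hcoef; exact Hz).
  apply Cpseries_ext. intros n. symmetry. apply hcoef_derive, Hc.
Qed.

Lemma is_Cderive_hyp2F1 (a b c z : C) : ~ nonpos_int c -> Cmod z < 1 ->
  is_Cderive (hyp2F1 a b c) z (hyp2F1' a b c z).
Proof.
  intros Hc Hz. rewrite hyp2F1'_Cpseries by assumption.
  apply (is_derive_Cpseries (hcoef a b c)); [apply radius_hcoef|exact Hz].
Qed.

Lemma hyp2F1_contiguous_c (a b c z : C) : ~ nonpos_int c -> Cmod z < 1 ->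
  ((c - a - b) * hyp2F1 a b c z =
   (c - a) * (c - b) / c * hyp2F1 a b (c + 1) z - (1 - z) * hyp2F1' a b c z)%C.
Proof.
  intros Hc Hz. rewrite hyp2F1'_Cpseries by assumption. rewrite !hyp2F1_Cpseries.
  assert (H1 := radius_hcoef a b c). assert (H2 := radius_hcoef a b (c + 1)).
  assert (H3 := radius_ge_1_derive _ H1). assert (H4 := radius_ge_1_mulINR _ H1).
  transitivity ((c - a) * (c - b) / c * Cpseries (hcoef a b (c + 1)) z
    - (Cpseries (Cderive_seq (hcoef a b c)) z - z * Cpseries (Cderive_seq (hcoef a b c)) z))%C; [|ring].
  rewrite Cpseries_euler_op, <- !Cpseries_scal, <- (Cpseries_minus (Cderive_seq _)) by assumption.
  rewrite <- Cpseries_minus;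
    [|apply radius_ge_1_scal, H2|apply radius_ge_1_minus; assumption|exact Hz].
  apply Cpseries_ext. intros n.
  assert (N0 := regular_neq_0 c Hc). assert (N1 := poch_neq_0 _ (regular_succ c Hc) n).
  assert (N2 := poch_neq_0 c Hc n). assert (N3 := INR_fact_neq_C n).
  assert (N4 := nonpos_int_add_neq_0 c n Hc). assert (N5 := INR_S_neq_C n).
  (* (c)_n and (c+1)_n differ by the factor (c + n)/c; the relation then reduces to a rational
     identity between coefficients of equal index. *)
  assert (E : hcoef a b (c + 1) n = (c / (c + INR n) * hcoef a b c n)%C).
  { unfold hcoef. assert (P : (c * poch (c + 1) n = poch c n * (c + INR n))%C)
      by (rewrite <- poch_S_left; reflexivity).
    replace (poch (c + 1) n) with (poch c n * (c + INR n) / c)%C by (rewrite <- P; field; exact N0).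
    field. tauto. }
  rewrite E. unfold Cderive_seq. rewrite hcoef_S. field. tauto.
Qed.

(** Raises [a] by one: for a = -n-1 it is the induction step towards the value at 1 of a terminating
    series. *)
Lemma hyp2F1_contiguous_a (a b c z : C) : ~ nonpos_int c -> Cmod z < 1 ->
  hyp2F1 a b c z =
  (hyp2F1 (a + 1) b c z - b / c * (z * hyp2F1 (a + 1) (b + 1) (c + 1) z))%C.
Proof.
  intros Hc Hz. rewrite !hyp2F1_Cpseries.
  rewrite Cpseries_mul_var by (try apply radius_hcoef; exact Hz).
  assert (H1 := radius_hcoef (a + 1) b c). assert (H2 := radius_hcoef (a + 1) (b + 1) (c + 1)).
  set (d n := match n with O => RtoC 0 | S k => hcoef (a + 1) (b + 1) (c + 1) k end).
  assert (Hd : radius_ge_1 d).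
  { intros r Hr. apply ex_series_incr_1.
    apply (ex_Rseries_ext (fun n => r * (Cmod (hcoef (a + 1) (b + 1) (c + 1) n) * r ^ n))).
    - intros n. simpl. ring.
    - apply ex_Rseries_scal, H2, Hr. }
  rewrite <- Cpseries_scal by assumption.
  unfold Cpseries. rewrite <- CSeries_minus.
  2:{ apply Csummable_pseries; assumption. }
  2:{ apply (Csummable_pseries (fun n => b / c * d n)%C); [apply radius_ge_1_scal, Hd|exact Hz]. }
  apply CSeries_ext. intros [|n].
  - unfold d, hcoef. simpl. ring.
  - unfold d, hcoef. rewrite (poch_S_left a), (poch_S_left b), (poch_S_left c).
    rewrite fact_simpl, mult_INR, RtoC_mult.
    change (poch (a + 1) (S n)) with (poch (a + 1) n * (a + 1 + INR n))%C.
    assert (N1 := regular_neq_0 c Hc). assert (N2 := poch_neq_0 _ (regular_succ c Hc) n).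
    assert (N3 := INR_fact_neq_C n). assert (N4 := INR_S_neq_C n).
    rewrite S_INR, RtoC_plus in N4 |- *. field. tauto.
Qed.

Lemma ray_lim (th : R) : Ctends (at_right 0) (ray th) 1.
Proof.
  intros eps He. generalize (at_right_lt eps He). apply filter_imp. intros t Ht.
  unfold ray. replace (1 - Cexp (ln t, th) - 1)%C with (- Cexp (ln t, th))%C by ring.
  rewrite Cmod_opp, Cmod_Cexp. unfold Re; simpl. rewrite exp_ln; lra.
Qed.

(** [gauss_limit] does not cover this, since the real part of the exponent may have any sign for a
    terminating series. [b] and [c] are quantified inside the induction because the contiguous
    relation shifts both. *)
Lemma chu_vandermonde_limit (n : nat) (th : R) : - (PI / 2) < th < PI / 2 ->
  forall b c, ~ nonpos_int c ->
  Ctends (at_right 0) (fun t => hyp2F1 (RtoC (- INR n)) b c (ray th t)) (poch (c - b) n / poch c n)%C.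
Proof.
  intros Hth. induction n as [|n IH]; intros b c Hc.
  - apply (Ctends_ext_loc (at_right 0) (fun _ => RtoC 1)).
    + generalize (ray_in_disc th Hth). apply filter_imp. intros t [_ [_ Hz]].
      rewrite hyp2F1_Cpseries.
      rewrite (Cpseries_ext _ (fun n => match n with O => RtoC 1 | S _ => RtoC 0 end)).
      * unfold Cpseries. rewrite CSeries_incr_1.
        -- rewrite (CSeries_ext _ (fun n => 0 * (hcoef 1 1 1 n * ray th t ^ n))%C) by (intros; ring).
           rewrite CSeries_scal; [simpl; ring|].
           apply Csummable_pseries; [apply radius_hcoef|exact Hz].
        -- apply Csummable_incr_1.
           apply (ex_Rseries_ext (fun n => Cmod (0 * (hcoef 1 1 1 n * ray th t ^ n))%C)).
           ++ intros n. f_equal. ring.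
           ++ apply Csummable_scal, Csummable_pseries; [apply radius_hcoef|exact Hz].
      * intros [|n].
        -- unfold hcoef. simpl. field.
        -- unfold hcoef. rewrite poch_eq_0 by lia. unfold Cdiv. ring.
    + simpl. replace (1 / 1)%C with (RtoC 1) by field. apply (Ctends_const (at_right 0)).
  - assert (Ha : (RtoC (- INR (S n)) + 1)%C = RtoC (- INR n)).
    { rewrite S_INR, !RtoC_opp, RtoC_plus. ring. }
    assert (N1 := regular_neq_0 c Hc). assert (Hc' := regular_succ c Hc).
    assert (N2 := poch_neq_0 c Hc n). assert (N3 := poch_neq_0 _ Hc' n).
    assert (N4 := nonpos_int_add_neq_0 c n Hc).
    replace (poch (c - b) (S n) / poch c (S n))%C
      with (poch (c - b) n / poch c n - b / c * (1 * (poch (c + 1 - (b + 1)) n / poch (c + 1) n)))%C.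
    + apply (Ctends_ext_loc (at_right 0) (fun t => hyp2F1 (RtoC (- INR n)) b c (ray th t)
        - b / c * (ray th t * hyp2F1 (RtoC (- INR n)) (b + 1) (c + 1) (ray th t)))%C).
      * generalize (ray_in_disc th Hth). apply filter_imp. intros t [_ [_ Hz]].
        rewrite (hyp2F1_contiguous_a (RtoC (- INR (S n)))), Ha by assumption. reflexivity.
      * apply (Ctends_minus (at_right 0)); [apply IH, Hc|].
        apply (Ctends_scal (at_right 0)), (Ctends_mult (at_right 0)); [apply ray_lim|apply IH, Hc'].
    + replace (c + 1 - (b + 1))%C with (c - b)%C by ring.
      assert (P : (c * poch (c + 1) n = poch c n * (c + INR n))%C)
        by (rewrite <- poch_S_left; reflexivity).
      replace (poch (c + 1) n) with (poch c n * (c + INR n) / c)%C by (rewrite <- P; field; exact N1).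
      simpl poch. field. tauto.
Qed.

(** * Arguments and half-planes *)

Lemma Cexp_Ci (x : R) : Cexp (Ci * x)%C = (cos x, sin x).
Proof.
  unfold Cexp, Re, Im; simpl. replace (0 * x - 1 * 0) with 0 by ring.
  replace (0 * 0 + 1 * x) with x by ring. rewrite exp_0. f_equal; ring.
Qed.

Lemma Cexp_Ci_opp (x : R) : Cexp (- (Ci * x))%C = (cos x, - sin x).
Proof.
  replace (- (Ci * x))%C with (Ci * RtoC (- x))%C by (rewrite RtoC_opp; ring).
  rewrite Cexp_Ci, cos_neg, sin_neg. reflexivity.
Qed.

Lemma Carg_spec (w : C) : w <> 0 ->
  - PI < Carg w <= PI /\ w = (Cmod w * Cexp (Ci * Carg w))%C.
Proof.
  intros Hw. assert (Hm : 0 < Cmod w) by (apply Cmod_gt_0, Hw).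
  assert (Hs := Cmod_sqr w). generalize (re_le_Cmod w); intros Hr. apply Rabs_le_between in Hr.
  set (x := Re w / Cmod w). assert (Hx : -1 <= x <= 1).
  { unfold x. split; apply Rmult_le_reg_r with (Cmod w); try lra; unfold Rdiv;
      rewrite Rmult_assoc, Rinv_l by lra; lra. }
  assert (Ex : x * Cmod w = Re w) by (unfold x; field; lra).
  assert (Hy : (Im w / Cmod w) * (Im w / Cmod w) = 1 - x * x).
  { apply Rmult_eq_reg_r with (Cmod w * Cmod w); [|nra].
    replace (Im w / Cmod w * (Im w / Cmod w) * (Cmod w * Cmod w)) with (Im w * Im w) by (field; lra).
    replace ((1 - x * x) * (Cmod w * Cmod w)) with (Cmod w * Cmod w - (x * Cmod w) * (x * Cmod w)) by ring.
    rewrite Ex. lra. }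
  assert (Hsin : forall y, 0 <= y -> y * y = 1 - x * x -> sin (acos x) = y).
  { intros y Hy0 Hyy. rewrite sin_acos by exact Hx. unfold Rsqr. rewrite <- Hyy. apply sqrt_square, Hy0. }
  generalize (acos_bound x) PI_RGT_0; intros Hb Hpi.
  unfold Carg. destruct (Ceq_dec w 0) as [E|_]; [contradiction|].
  fold x. destruct (Rle_dec 0 (Im w)) as [P|P].
  - split; [lra|]. rewrite Cexp_Ci, cos_acos by exact Hx.
    rewrite (Hsin (Im w / Cmod w)) by (try exact Hy; apply Rdiv_le_0_compat; lra).
    apply injective_projections; simpl; unfold Re, Im in *; [lra|field; lra].
  - assert (S : sin (acos x) = - (Im w / Cmod w)).
    { apply Hsin; [|lra]. unfold Rdiv. rewrite Ropp_mult_distr_l.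
      apply Rmult_le_pos; [lra|left; apply Rinv_0_lt_compat; lra]. }
    split.
    + split; [|lra]. assert (acos x <> PI); [|lra]. intros E. rewrite E, sin_PI in S.
      assert (0 < - Im w / Cmod w) by (apply Rdiv_lt_0_compat; lra). lra.
    + rewrite Cexp_Ci, cos_neg, sin_neg, S, cos_acos by exact Hx.
      apply injective_projections; simpl; unfold Re, Im in *; [lra|field; lra].
Qed.

Lemma Carg_polar (x lam : R) : 0 < x -> - (PI / 2) < lam < PI / 2 ->
  Carg (x * Cexp (Ci * lam))%C = lam.
Proof.
  intros Hx Hl. set (w := (x * Cexp (Ci * lam))%C).
  assert (Hm : Cmod w = x).
  { unfold w. rewrite Cmod_mult, Cmod_Cexp, Cmod_R, Rabs_right by lra.
    replace (Re (Ci * lam)%C) with 0 by (unfold Re; simpl; ring). rewrite exp_0; ring. }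
  assert (HR : Re w = x * cos lam) by (unfold w; rewrite Cexp_Ci; unfold Re; simpl; ring).
  assert (HI : Im w = x * sin lam) by (unfold w; rewrite Cexp_Ci; unfold Im; simpl; ring).
  unfold Carg. destruct (Ceq_dec w 0) as [E|_].
  { rewrite E, Cmod_0 in Hm. lra. }
  rewrite HR, HI, Hm. replace (x * cos lam / x) with (cos lam) by (field; lra).
  destruct (Rle_dec 0 (x * sin lam)) as [P|P].
  - apply acos_cos. split; [|lra]. destruct (Rle_dec 0 lam); [assumption|exfalso].
    assert (sin lam < 0) by (apply sin_lt_0_var; lra). nra.
  - assert (lam < 0).
    { destruct (Rlt_dec lam 0); [assumption|exfalso]. apply P.
      apply Rmult_le_pos; [lra|]. apply sin_ge_0; lra. }
    rewrite <- (cos_neg lam), acos_cos by lra. ring.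
Qed.

Lemma Re_rotate (lam : R) (w : C) : w <> 0 ->
  Re (Cexp (- (Ci * lam)) * w)%C = Cmod w * cos (lam - Carg w).
Proof.
  intros Hw. destruct (Carg_spec w Hw) as [_ E]. rewrite E at 1.
  rewrite Cexp_Ci, Cexp_Ci_opp, cos_minus. unfold Re; simpl. ring.
Qed.

(** [lam - Carg w] stays in this window because |lam| < pi/2 and |Carg w| <= pi; hence no multiple
    of 2 pi can intervene. *)
Lemma cos_nonneg_half (x : R) : - (3 * (PI / 2)) < x < 3 * (PI / 2) -> 0 <= cos x -> Rabs x <= PI / 2.
Proof.
  intros Hx Hc. destruct (Rle_dec (Rabs x) (PI / 2)) as [P|P]; [exact P|exfalso].
  assert (cos (Rabs x) < 0).
  { apply cos_lt_0; [lra|]. unfold Rabs; destruct (Rcase_abs x); lra. }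
  unfold Rabs in H; destruct (Rcase_abs x); [rewrite cos_neg in H|]; lra.
Qed.

Lemma cos_Rabs (x : R) : cos (Rabs x) = cos x.
Proof. unfold Rabs; destruct (Rcase_abs x); [apply cos_neg|reflexivity]. Qed.

Lemma Carg_diff_bound (lam : R) (w : C) : w <> 0 -> - (PI / 2) < lam < PI / 2 ->
  - (3 * (PI / 2)) < lam - Carg w < 3 * (PI / 2).
Proof. intros Hw Hl. destruct (Carg_spec w Hw) as [H _]. lra. Qed.

Lemma arg_bound (lam rho : R) (w : C) : - (PI / 2) < lam < PI / 2 -> w <> 0 -> 0 <= rho ->
  rho * Cmod w <= Re (Cexp (- (Ci * lam)) * w)%C -> Rabs (lam - Carg w) <= acos rho.
Proof.
  intros Hl Hw Hrho H. rewrite Re_rotate in H by exact Hw.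
  assert (Hm : 0 < Cmod w) by (apply Cmod_gt_0, Hw).
  assert (Hc : rho <= cos (lam - Carg w)).
  { apply Rmult_le_reg_r with (Cmod w); [exact Hm|]. lra. }
  set (d := lam - Carg w) in *.
  assert (Hd : Rabs d <= PI / 2).
  { apply cos_nonneg_half; [apply Carg_diff_bound; assumption|lra]. }
  generalize (COS_bound d) (Rabs_pos d) PI_RGT_0; intros B P Q.
  generalize (acos_bound rho); intros B2.
  destruct (Rle_dec (Rabs d) (acos rho)) as [L|L]; [exact L|exfalso].
  assert (X : cos (Rabs d) < cos (acos rho)) by (apply cos_decreasing_1; lra).
  rewrite cos_acos, cos_Rabs in X by lra. lra.
Qed.

Lemma arg_bound_half (lam : R) (w : C) : - (PI / 2) < lam < PI / 2 ->
  0 <= Re (Cexp (- (Ci * lam)) * w)%C -> Rabs (lam - Carg w) <= PI / 2.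
Proof.
  intros Hl H. destruct (Ceq_dec w 0) as [->|Hw].
  (* At w = 0 the convention [Carg 0 = 0] reduces the claim to |lam| <= pi/2. *)
  - unfold Carg. destruct (Ceq_dec 0 0) as [_|N]; [|contradiction N; reflexivity].
    apply Rabs_le; lra.
  - rewrite <- acos_0. apply arg_bound; try assumption; lra.
Qed.

(** For each sign of d = lam - Carg w, th may be taken of that sign; so |d| + be th <= pi/2 for all
    th < pi/2, and th tends to pi/2. *)
Lemma sector_bound (lam be : R) (w : C) : - (PI / 2) < lam < PI / 2 -> w <> 0 -> 0 <= be <= 1 ->
  (forall th, - (PI / 2) < th < PI / 2 ->
     0 <= Re (Cexp (- (Ci * lam)) * (w * Cexp (- (Ci * (be * th)%R))))%C) ->
  Rabs (lam - Carg w) <= (1 - be) * (PI / 2).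
Proof.
  intros Hl Hw Hbe H. assert (Hm : 0 < Cmod w) by (apply Cmod_gt_0, Hw).
  set (d := lam - Carg w). generalize PI_RGT_0; intros Hpi.
  assert (Hc : forall th, - (PI / 2) < th < PI / 2 -> 0 <= cos (d + be * th)).
  { intros th Hth. specialize (H th Hth).
    replace (Cexp (- (Ci * lam)) * (w * Cexp (- (Ci * (be * th)%R))))%C
      with (Cexp (- (Ci * (lam + be * th)%R)) * w)%C in H.
    - rewrite Re_rotate in H by exact Hw.
      replace (lam + be * th - Carg w) with (d + be * th) in H by (unfold d; ring). nra.
    - rewrite RtoC_plus.
      replace (- (Ci * (lam + (be * th)%R)))%C with (- (Ci * lam) + - (Ci * (be * th)%R))%C by ring.
      rewrite Cexp_plus. ring. }
  assert (Hd : Rabs d <= PI / 2).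
  { apply cos_nonneg_half; [apply Carg_diff_bound; assumption|].
    specialize (Hc 0 ltac:(lra)). replace (d + be * 0) with d in Hc by ring. exact Hc. }
  assert (Hc' : forall th, 0 <= th < PI / 2 -> Rabs d + be * th <= PI / 2).
  { intros th Hth. assert (X : 0 <= cos (Rabs d + be * th)).
    { unfold Rabs. destruct (Rcase_abs d).
      - specialize (Hc (- th) ltac:(lra)). rewrite <- cos_neg.
        replace (- (- d + be * th)) with (d + be * - th) by ring. exact Hc.
      - apply Hc; lra. }
    generalize (Rabs_pos d); intros P.
    assert (0 <= be * th <= th) by nra.
    apply cos_nonneg_half in X; [|lra]. rewrite Rabs_right in X; lra. }
  destruct (Rle_dec (Rabs d) ((1 - be) * (PI / 2))) as [L|L]; [exact L|exfalso].
  set (eta := Rabs d - (1 - be) * (PI / 2)). assert (He : 0 < eta) by (unfold eta; lra).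
  (* If the bound failed by eta, the angle pi/2 - eta/2 would already exceed it, since be <= 1; the
     maximum with 0 covers a large eta. *)
  assert (Hth : 0 <= Rmax 0 (PI / 2 - eta / 2) < PI / 2).
  { split; [apply Rmax_l|]. apply Rmax_lub_lt; lra. }
  specialize (Hc' _ Hth). assert (PI / 2 - eta / 2 <= Rmax 0 (PI / 2 - eta / 2)) by apply Rmax_r.
  unfold eta in *. nra.
Qed.

Lemma full_rotation_zero (k : C) : (forall phi : R, 0 <= Re (k * Cexp (Ci * phi))%C) -> k = 0.
Proof.
  intros H. assert (HR : forall phi, 0 <= Re k * cos phi - Im k * sin phi).
  { intros phi. specialize (H phi). rewrite Cexp_Ci in H. exact H. }
  generalize (HR 0) (HR PI) (HR (PI / 2)) (HR (- (PI / 2))).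
  rewrite cos_0, sin_0, cos_PI, sin_PI, cos_neg, sin_neg, cos_PI2, sin_PI2. intros.
  apply injective_projections; unfold Re, Im in *; simpl; lra.
Qed.

(** Half-planes rotated through an open half turn have only one closed ray in common, spanned by
    e^(i lam). *)
Lemma half_turn_direction (lam : R) (k : C) :
  (forall th, - (PI / 2) < th < PI / 2 ->
     0 <= Re (Cexp (- (Ci * lam)) * (k * Cexp (- (Ci * th))))%C) ->
  exists x, 0 <= x /\ k = (x * Cexp (Ci * lam))%C.
Proof.
  intros H. set (e := Cexp (- (Ci * lam))) in *. set (m := (e * k)%C).
  assert (HR : forall th, - (PI / 2) < th < PI / 2 -> 0 <= Re m * cos th + Im m * sin th).
  { intros th Hth. specialize (H th Hth).
    replace (e * (k * Cexp (- (Ci * th))))%C with (m * Cexp (- (Ci * th)))%C in H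
      by (unfold m; ring).
    rewrite Cexp_Ci_opp in H.
    assert (X : forall m : C, Re (m * (cos th, (- sin th)%R))%C = Re m * cos th + Im m * sin th)
      by (intros; unfold Re, Im; simpl; ring).
    rewrite <- X. exact H. }
  generalize PI_RGT_0; intros Hpi.
  assert (H0 := HR 0 ltac:(lra)). rewrite cos_0, sin_0 in H0.
  assert (HI : Im m = 0).
  { destruct (Req_dec (Im m) 0) as [E|E]; [exact E|exfalso].
    (* This angle makes Re m cos th + Im m sin th equal to - cos th < 0. *)
    set (th := - atan ((Re m + 1) / Im m)).
    assert (Hth : - (PI / 2) < th < PI / 2).
    { generalize (atan_bound ((Re m + 1) / Im m)). unfold th. lra. }
    assert (Hc : 0 < cos th) by (apply cos_gt_0; lra).
    assert (Ht : tan th = - ((Re m + 1) / Im m)) by (unfold th; rewrite tan_neg, tan_atan; reflexivity).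
    assert (Hs : sin th = tan th * cos th) by (unfold tan; field; lra).
    specialize (HR th Hth). rewrite Hs, Ht in HR.
    replace (Re m * cos th + Im m * (- ((Re m + 1) / Im m) * cos th)) with (- cos th) in HR
      by (field; exact E). lra. }
  exists (Re m). split; [lra|].
  assert (Em : m = RtoC (Re m)) by (apply injective_projections; [reflexivity|exact HI]).
  rewrite <- Em. unfold m, e. rewrite Cexp_opp. field. apply Cexp_neq_0.
Qed.

(** * Spirallikeness along the rays *)

Definition ray_spirallike (a b c : C) (lam : R) : Prop :=
  forall th, - (PI / 2) < th < PI / 2 ->
  at_right 0 (fun t => hyp2F1 a b c (ray th t) <> 0 /\
    0 < Re (Cexp (- (Ci * lam)) *
      (1 + ray th t * (hyp2F1' a b c (ray th t) / hyp2F1 a b c (ray th t))))%C).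

Lemma spirallike_ray (a b c : C) (lam : R) : ~ nonpos_int c ->
  spirallike lam (fun z : C => (z * hyp2F1 a b c z)%C) -> ray_spirallike a b c lam.
Proof.
  intros Hc [_ [_ [_ H]]] th Hth. destruct (cos_pos_of th Hth) as [Hc1 Hc2].
  generalize (ray_in_disc th Hth). apply filter_imp. intros t [Ht [_ Hz]].
  specialize (H _ Hz). set (z := ray th t) in *.
  assert (Hz0 : z <> 0).
  { intros E. assert (X : Cmod (1 - z)%C = t).
    { unfold z, ray. replace (1 - (1 - Cexp (ln t, th)))%C with (Cexp (ln t, th)) by ring.
      rewrite Cmod_Cexp. unfold Re; simpl. apply exp_ln; lra. }
    rewrite E in X. replace (1 - 0)%C with (RtoC 1) in X by ring. rewrite Cmod_1 in X. lra. }
  destruct (Ceq_dec z 0) as [E|_]; [contradiction|].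
  assert (D := is_Cderive_mult _ _ _ _ _ (is_Cderive_id z) (is_Cderive_hyp2F1 a b c z Hc Hz)).
  apply is_Cderive_C_derive in D. rewrite D in H.
  destruct (Ceq_dec (hyp2F1 a b c z) 0) as [E|E].
  - exfalso. rewrite E in H. unfold Cdiv in H. rewrite !Cmult_0_r, Cinv_0, !Cmult_0_r in H.
    rewrite re_RtoC in H. lra.
  - split; [exact E|].
    replace (z * (1 * hyp2F1 a b c z + z * hyp2F1' a b c z) / (z * hyp2F1 a b c z))%C
      with (1 + z * (hyp2F1' a b c z / hyp2F1 a b c z))%C in H by (field; tauto).
    exact H.
Qed.

Lemma hyp2F1_sym (a b c z : C) : hyp2F1 a b c z = hyp2F1 b a c z.
Proof. apply CSeries_ext. intros n. f_equal. unfold Cdiv. ring. Qed.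

Lemma ray_spirallike_sym (a b c : C) (lam : R) : ray_spirallike a b c lam -> ray_spirallike b a c lam.
Proof.
  intros H th Hth. generalize (H th Hth). apply filter_imp. intros t.
  unfold hyp2F1'. rewrite (hyp2F1_sym a b), (hyp2F1_sym (a + 1) (b + 1)), (Cmult_comm a b).
  exact (fun x => x).
Qed.

(* Passing to the limit in the spirallikeness inequality, after multiplication by a positive
   factor and along an arbitrary approach of [t] to [0+]. *)
Lemma spirallike_limit {T : Type} (G : (T -> Prop) -> Prop) {PG : ProperFilter G}
  (a b c : C) (lam th : R) (t mu : T -> R) (f : T -> C) (L k : C) :
  ray_spirallike a b c lam -> - (PI / 2) < th < PI / 2 -> filterlim t G (at_right 0) ->
  G (fun x => 0 < mu x) ->
  G (fun x => f x * k = mu x *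
    (1 + ray th (t x) * (hyp2F1' a b c (ray th (t x)) / hyp2F1 a b c (ray th (t x)))))%C ->
  Ctends G f L ->
  0 <= Re (Cexp (- (Ci * lam)) * (L * k))%C.
Proof.
  intros H Hth Ht Hmu Hf HL.
  apply (Ctends_Re_ge0 G (fun x => Cexp (- (Ci * lam)) * (f x * k))%C).
  - apply (Ctends_scal G), (Ctends_mult G); [exact HL|apply (Ctends_const G)].
  - assert (Hr := Ht _ (H th Hth)). unfold filtermap in Hr.
    generalize (filter_and _ _ Hr (filter_and _ _ Hmu Hf)).
    apply filter_imp. intros x [[_ H1] [H2 H3]]. rewrite H3.
    set (w := (1 + _)%C) in *.
    replace (Cexp (- (Ci * lam)) * (mu x * w))%C with (mu x * (Cexp (- (Ci * lam)) * w))%C by ring.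
    rewrite re_scal_l. apply Rmult_le_pos; lra.
Qed.

(** * Boundary behaviour of the hypergeometric function *)

Lemma Cexp_log (t th : R) : 0 < t -> Cexp (ln t, th) = (t * Cexp (Ci * th))%C.
Proof.
  intros Ht. rewrite Cexp_Ci. unfold Cexp, Re, Im; simpl. rewrite exp_ln by exact Ht.
  apply injective_projections; simpl; ring.
Qed.

Lemma Cexp_log_rotate (t th : R) : 0 < t -> (Cexp (ln t, th) * Cexp (- (Ci * th)))%C = t.
Proof.
  intros Ht. rewrite Cexp_log, Cexp_opp by exact Ht. field. apply Cexp_neq_0.
Qed.

Lemma Cexp_scal_log_lim (al : C) (th : R) : 0 < Re al ->
  Ctends (at_right 0) (fun t => Cexp (al * (ln t, th)))%C 0.
Proof.
  intros Hal eps He.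
  set (K := exp (- (Im al * th))). assert (HK : 0 < K) by apply exp_pos.
  assert (He' : 0 < eps / K) by (apply Rdiv_lt_0_compat; assumption).
  generalize (exp_scal_ln_small (Re al) _ Hal He'). apply filter_imp. intros t Ht.
  replace (Cexp (al * (ln t, th)) - 0)%C with (Cexp (al * (ln t, th))) by ring.
  rewrite Cmod_Cexp.
  replace (Re (al * (ln t, th))%C) with (- (Im al * th) + Re al * ln t)
    by (unfold Re, Im; simpl; ring).
  rewrite exp_plus. fold K. replace eps with (K * (eps / K)) by (field; lra).
  apply Rmult_lt_compat_l; assumption.
Qed.

Lemma Cexp_log_lim (th : R) : Ctends (at_right 0) (fun t => Cexp (ln t, th)) 0.
Proof.
  apply (Ctends_ext (at_right 0) (fun t => Cexp (1 * (ln t, th))%C)).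
  - intros t. f_equal. ring.
  - apply Cexp_scal_log_lim. rewrite re_RtoC; lra.
Qed.

Lemma at_right_pos : at_right 0 (fun t => 0 < t).
Proof. generalize (at_right_lt 1 Rlt_0_1). apply filter_imp. tauto. Qed.

Lemma hyp2F1'_ray_singular (a b c : C) (th : R) : ~ nonpos_int c -> Re (c - a - b)%C < 1 ->
  - (PI / 2) < th < PI / 2 ->
  Ctends (at_right 0) (fun t => hyp2F1' a b c (ray th t) * Cexp ((1 - (c - a - b)) * (ln t, th)))%C
    (CGamma c * CGamma (1 - (c - a - b)) / (CGamma a * CGamma b))%C.
Proof.
  intros Hc Hg Hth.
  assert (E : (1 - (c - a - b))%C = (a + 1 + (b + 1) - (c + 1))%C) by ring.
  replace (CGamma c * CGamma (1 - (c - a - b)) / (CGamma a * CGamma b))%C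
    with (a * b / c * (CGamma (c + 1) * CGamma (a + 1 + (b + 1) - (c + 1)) /
      (CGamma (a + 1) * CGamma (b + 1))))%C.
  - apply (Ctends_ext (at_right 0) (fun t => a * b / c * (hyp2F1 (a + 1) (b + 1) (c + 1) (ray th t)
      * Cexp ((a + 1 + (b + 1) - (c + 1)) * (ln t, th))))%C).
    + intros t. rewrite E. unfold hyp2F1'. ring.
    + apply (Ctends_scal (at_right 0)). apply hyp2F1_ray_singular.
      * apply regular_succ, Hc.
      * rewrite <- E. rewrite Re_minus, re_RtoC. lra.
      * exact Hth.
  - rewrite E, CGamma_succ by (apply regular_neq_0, Hc).
    unfold Cdiv. rewrite !Cinv_mult, (inv_CGamma_succ a), (inv_CGamma_succ b).
    generalize (/ CGamma (a + 1))%C (/ CGamma (b + 1))%C; intros x y.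
    field. apply regular_neq_0, Hc.
Qed.

Lemma poch_zero_inv (b : C) (n : nat) : poch b n = 0 -> exists k, (k < n)%nat /\ b = RtoC (- INR k).
Proof.
  induction n as [|n IH]; simpl; intros H.
  - exfalso. exact (C1_nz H).
  - destruct (Ceq_dec (poch b n) 0) as [E|E].
    + destruct (IH E) as [k [Hk ->]]. exists k. split; [lia|reflexivity].
    + exists n. split; [lia|]. destruct (Ceq_dec (b + INR n)%C 0) as [E'|E'].
      * rewrite RtoC_opp. replace b with (b + INR n - INR n)%C by ring. rewrite E'. ring.
      * exfalso. exact (Cmult_neq_0 _ _ E E' H).
Qed.

(** Since 1 - z = t e^(i th), dividing the limit by e^(i th) leaves the positive multiple [nu t * t]
    of w = z f'/f. The normalization [nu] is 1 for powers and - ln t when c - a - b = 0. *)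
Lemma spirallike_direction (a b c kap : C) (lam : R) (nu : R -> R) : ray_spirallike a b c lam ->
  at_right 0 (fun t => 0 < nu t) ->
  (forall th, - (PI / 2) < th < PI / 2 -> Ctends (at_right 0) (fun t => nu t *
    (Cexp (ln t, th) * (1 + ray th t * (hyp2F1' a b c (ray th t) / hyp2F1 a b c (ray th t)))))%C kap) ->
  exists x, 0 <= x /\ kap = (x * Cexp (Ci * lam))%C.
Proof.
  intros H Hnu HL. apply half_turn_direction. intros th Hth.
  apply (spirallike_limit (at_right 0) a b c lam th (fun t => t) (fun t => nu t * t) _ kap
    (Cexp (- (Ci * th))) H Hth (filterlim_id _ _)) with (3 := HL th Hth).
  - generalize (filter_and _ _ Hnu at_right_pos). apply filter_imp. intros t [H1 H2].
    apply Rmult_lt_0_compat; assumption.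
  - generalize at_right_pos. apply filter_imp. intros t Ht.
    rewrite RtoC_mult, <- (Cexp_log_rotate t th Ht) at 1. ring.
Qed.

Lemma Re_polar (x lam : R) : Re (x * Cexp (Ci * lam))%C = x * cos lam.
Proof. rewrite Cexp_Ci. unfold Re; simpl. ring. Qed.

(* If [c - a = -n], then [F = (1 - z)^(c-a-b) p] with [p] a polynomial that does not vanish at 1,
   hence [(1 - z) z f'/f] tends to [-(c-a-b)], whose real part has the wrong sign. *)
Lemma spirallike_gauss_neq_0_l (a b c : C) (lam : R) : ~ nonpos_int c -> - (PI / 2) < lam < PI / 2 ->
  ray_spirallike a b c lam -> 0 < Re (c - a - b)%C -> ~ nonpos_int (c - a)%C.
Proof.
  intros Hc Hlam H Hg [n Hn].
  (* A zero would mean b = -k with k < n, hence c - a - b = k - n < 0. So the polynomial factor does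
     not vanish at 1. *)
  assert (Hb : poch b n <> 0).
  { intros E. apply poch_zero_inv in E. destruct E as [k [Hk E]].
    rewrite Hn, E in Hg. rewrite <- RtoC_minus, re_RtoC in Hg.
    apply lt_INR in Hk. lra. }
  assert (HP : (poch (c - (c - b)) n / poch c n)%C <> 0).
  { replace (c - (c - b))%C with b by ring. apply Cmult_neq_0; [exact Hb|].
    intros E. apply (poch_neq_0 c Hc n). rewrite <- (Cinv_invol (poch c n)), E. apply Cinv_0. }
  assert (Hlim : forall th, - (PI / 2) < th < PI / 2 -> Ctends (at_right 0) (fun t => 1%R *
    (Cexp (ln t, th) * (1 + ray th t * (hyp2F1' a b c (ray th t) / hyp2F1 a b c (ray th t)))))%C
    (- (c - a - b))%C).
  { intros th Hth.
    set (p t := hyp2F1 (c - a) (c - b) c (ray th t)).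
    assert (Hp : Ctends (at_right 0) p (poch (c - (c - b)) n / poch c n)%C)
      by (unfold p; rewrite Hn; apply chu_vandermonde_limit; assumption).
    (* Euler's transformation with c + 1 for c gives the first term of the contiguous relation as p1
       (1 - z)^(c-a-b+1), one power more than F = p (1 - z)^(c-a-b). *)
    set (p1 t := ((c - a) * (c - b) / c * hyp2F1 (c + 1 - a) (c + 1 - b) (c + 1) (ray th t))%C).
    assert (Hp1 : exists l, Ctends (at_right 0) p1 l).
    (* For n = 0 the function in [p1] is not a terminating series, but its factor c - a is 0. *)
    { destruct n as [|m].
      - exists 0. apply (Ctends_ext (at_right 0) (fun _ => RtoC 0));
          [|apply (Ctends_const (at_right 0))].
        intros t. unfold p1. rewrite Hn. simpl INR. rewrite Ropp_0. unfold Cdiv. ring.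
      - assert (E : (c + 1 - a)%C = RtoC (- INR m)).
        { replace (c + 1 - a)%C with (c - a + 1)%C by ring.
          rewrite Hn, S_INR, !RtoC_opp, RtoC_plus. ring. }
        eexists. unfold p1. rewrite E. apply (Ctends_scal (at_right 0)).
        apply chu_vandermonde_limit; [exact Hth|apply regular_succ, Hc]. }
    destruct Hp1 as [l Hp1].
    replace (- (c - a - b))%C
      with (0 + 1 * (0 * (l / (poch (c - (c - b)) n / poch c n)) - (c - a - b)))%C by ring.
    apply (Ctends_ext_loc (at_right 0) (fun t => Cexp (ln t, th) +
      ray th t * (Cexp (ln t, th) * (p1 t / p t) - (c - a - b)))%C).
    - generalize (filter_and _ _ (H th Hth) (ray_in_disc th Hth)).
      apply filter_imp. intros t [[HF _] [Ht [_ Hz]]].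
      assert (C1 := hyp2F1_contiguous_c a b c (ray th t) Hc Hz).
      replace (1 - ray th t)%C with (Cexp (ln t, th)) in C1 by (unfold ray; ring).
      assert (E1 : (Cexp (ln t, th) * (p1 t / p t) - (c - a - b))%C =
        (Cexp (ln t, th) * (hyp2F1' a b c (ray th t) / hyp2F1 a b c (ray th t)))%C).
      { assert (E2 := euler_transformation_ray a b c th t Hc Hth ltac:(lra)). fold (p t) in E2.
        assert (E3 := euler_transformation_ray a b (c + 1) th t (regular_succ c Hc) Hth ltac:(lra)).
        assert (E4 : ((c - a) * (c - b) / c * hyp2F1 a b (c + 1) (ray th t))%C =
          (p1 t * (Cexp (ln t, th) * Cexp ((c - a - b) * (ln t, th))))%C).
        { rewrite E3, <- Cexp_plus. unfold p1.
          replace ((c + 1 - a - b) * (ln t, th))%C with ((ln t, th) + (c - a - b) * (ln t, th))%C by ring.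
          ring. }
        rewrite E4 in C1.
        assert (Hp0 : p t <> 0) by (intros Z; apply HF; rewrite E2, Z; ring).
        assert (HX := Cexp_neq_0 ((c - a - b) * (ln t, th))%C).
        set (X := Cexp ((c - a - b) * (ln t, th))%C) in *.
        set (F := hyp2F1 a b c (ray th t)) in *. set (F' := hyp2F1' a b c (ray th t)) in *.
        set (Y := Cexp (ln t, th)) in *.
        transitivity ((p1 t * (Y * X) - (c - a - b) * F) / F)%C.
        - rewrite E2. field. tauto.
        - rewrite C1. field. exact HF. }
      rewrite E1. ring.
    - apply (Ctends_plus (at_right 0)); [apply Cexp_log_lim|].
      apply (Ctends_mult (at_right 0)); [apply ray_lim|].
      apply (Ctends_minus (at_right 0)); [|apply (Ctends_const (at_right 0))].
      apply (Ctends_mult (at_right 0)); [apply Cexp_log_lim|].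
      apply (Ctends_div (at_right 0)); assumption. }
  destruct (spirallike_direction a b c _ lam (fun _ => 1) H
    (filter_forall _ (fun _ => Rlt_0_1)) Hlim) as [x [Hx E]].
  apply (f_equal Re) in E. rewrite Re_polar in E.
  assert (Hcl : 0 < cos lam) by (apply cos_gt_0; lra).
  replace (Re (- (c - a - b))%C) with (- Re (c - a - b)%C) in E by (unfold Re; simpl; ring).
  nra.
Qed.

Lemma spirallike_gauss_neq_0 (a b c : C) (lam : R) : ~ nonpos_int c -> - (PI / 2) < lam < PI / 2 ->
  ray_spirallike a b c lam -> 0 < Re (c - a - b)%C ->
  ~ nonpos_int (c - a)%C /\ ~ nonpos_int (c - b)%C.
Proof.
  intros Hc Hlam H Hg. split.
  - exact (spirallike_gauss_neq_0_l a b c lam Hc Hlam H Hg).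
  - apply (spirallike_gauss_neq_0_l b a c lam Hc Hlam (ray_spirallike_sym _ _ _ _ H)).
    replace (c - b - a)%C with (c - a - b)%C by ring. exact Hg.
Qed.

(** * Logarithmic and oscillating behaviour on a ray *)

Lemma at_right_log_large (B : R) : at_right 0 (fun t => B < - ln t).
Proof.
  generalize (at_right_lt (exp (- B)) (exp_pos _)). apply filter_imp. intros t [H1 H2].
  apply ln_increasing in H2; [|exact H1]. rewrite ln_exp in H2. lra.
Qed.

(** L'Hopital's rule in the variable x = ln t: the derivative of F(1 - e^(x + i th)) in x is - (1 -
    z) F'(z), which tends to - K as x tends to minus infinity. *)
Lemma log_growth (a b c K : C) (th : R) : ~ nonpos_int c -> - (PI / 2) < th < PI / 2 ->
  Ctends (at_right 0) (fun t => Cexp (ln t, th) * hyp2F1' a b c (ray th t))%C K ->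
  Ctends (at_right 0) (fun t => / (- ln t)%R * hyp2F1 a b c (ray th t))%C K.
Proof.
  intros Hc Hth HK eps He.
  set (phi u := hyp2F1 a b c (1 - Cexp u)%C).
  (* The mean value theorem is used on both components, which costs 2 e = eps/2; the constant of
     integration, divided by - ln t, takes less than another eps/4. *)
  set (e := eps / 4). assert (He' : 0 < e) by (unfold e; lra).
  destruct (filter_and _ _ (HK e He') (ray_in_disc th Hth)) as [d Hd].
  set (x0 := Rmin (ln d - 1) (-1)).
  assert (Hx0 : x0 <= -1) by apply Rmin_r.
  assert (Hx : forall x, x <= x0 -> Cmod (Cexp (x, th) * hyp2F1' a b c (1 - Cexp (x, th)) - K)%C < e
    /\ Cmod (1 - Cexp (x, th))%C < 1).
  { intros x Hx. specialize (Hd (exp x)). unfold ray in Hd. rewrite !ln_exp in Hd.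
    assert (P := exp_pos x). destruct Hd as [H1 [_ [_ H2]]].
    - change (Rabs (exp x - 0) < d). rewrite Rminus_0_r, Rabs_right by lra.
      rewrite <- (exp_ln d) by apply cond_pos. apply exp_increasing.
      assert (x0 <= ln d - 1) by apply Rmin_l. lra.
    - exact P.
    - split; assumption. }
  assert (HD : forall x, x <= x0 -> is_Cderive phi ((0, th) + x * 1)%C
    (- Cexp (x, th) * hyp2F1' a b c (1 - Cexp (x, th)))%C).
  { intros x Hx1. destruct (Hx x Hx1) as [_ Hz].
    replace ((0, th) + x * 1)%C with ((x, th) : C) by (apply injective_projections; simpl; ring).
    apply (is_Cderive_comp (hyp2F1 a b c) (fun y => 1 - Cexp y)%C).
    - apply is_Cderive_hyp2F1; assumption.
    - replace (- Cexp (x, th))%C with (0 - Cexp (x, th))%C by ring.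
      apply is_Cderive_minus; [apply is_Cderive_const|apply is_derive_Cexp]. }
  assert (HG : forall g : C -> R, (forall a b, g (a - b)%C = g a - g b) ->
    (forall (r : R) a, g (r * a)%C = r * g a) -> (forall a, Rabs (g a) <= Cmod a) ->
    forall x, x < x0 ->
    Rabs (g (phi (x, th) - phi (x0, th) - (x0 - x)%R * K)%C) <= e * (x0 - x)).
  { intros g G1 G2 G3 x Hx1.
    destruct (MVT_gen (fun y : R => g (phi ((0, th) + y * 1)%C)) x x0
      (fun y => g ((- Cexp (y, th) * hyp2F1' a b c (1 - Cexp (y, th))) * 1)%C)) as [y [Hy HM]].
    - intros y Hy. rewrite Rmin_left, Rmax_right in Hy by lra. apply is_derive_line; auto.
      apply HD. lra.
    - intros y Hy. rewrite Rmin_left, Rmax_right in Hy by lra. apply continuity_pt_filterlim.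
      apply (ex_derive_continuous (K := R_AbsRing) (V := R_NormedModule)
        (fun y : R => g (phi ((0, th) + y * 1)%C)) y).
      eexists. apply is_derive_line; auto. apply HD. lra.
    - rewrite Rmin_left, Rmax_right in Hy by lra.
      assert (E : forall y : R, ((0, th) + y * 1)%C = (y, th) :> C)
        by (intros; apply injective_projections; simpl; ring).
      rewrite !E, Cmult_1_r in HM. rewrite !G1, G2.
      set (w := (Cexp (y, th) * hyp2F1' a b c (1 - Cexp (y, th)))%C).
      assert (Hw : g (- Cexp (y, th) * hyp2F1' a b c (1 - Cexp (y, th)))%C = - g w).
      { replace (- Cexp (y, th) * hyp2F1' a b c (1 - Cexp (y, th)))%C with (RtoC (-1) * w)%C
          by (unfold w; ring). rewrite G2. ring. }
      rewrite Hw in HM.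
      replace (g (phi (x, th)) - g (phi (x0, th)) - (x0 - x) * g K) with ((x0 - x) * (g w - g K)) by lra.
      rewrite Rabs_mult, Rabs_right by lra. rewrite Rmult_comm.
      apply Rmult_le_compat_r; [lra|]. rewrite <- G1. eapply Rle_trans; [apply G3|].
      left. apply Hx; lra. }
  assert (HC : forall x, x < x0 ->
    Cmod (phi (x, th) - phi (x0, th) - (x0 - x)%R * K)%C <= 2 * e * (x0 - x)).
  { intros x Hx1. eapply Rle_trans; [apply Cmod_le_Re_Im|].
    assert (A1 := HG Re Re_minus (fun r w => re_scal_l r w) re_le_Cmod x Hx1).
    assert (A2 := HG Im Im_minus (fun r w => im_scal_l r w) im_le_Cmod x Hx1). lra. }
  set (M := Cmod (phi (x0, th) + x0 * K)%C). assert (HM : 0 <= M) by apply Cmod_ge_0.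
  generalize (filter_and _ _ at_right_pos
    (filter_and _ _ (at_right_log_large (- x0)) (at_right_log_large (4 * M / eps)))).
  apply filter_imp. intros t [Ht [H1 H2]].
  set (x := ln t) in *. specialize (HC x ltac:(lra)).
  change (hyp2F1 a b c (ray th t)) with (phi (x, th)).
  assert (Hx1 : RtoC (- x) <> 0) by (apply RtoC_neq_0; lra).
  replace (/ (- x)%R * phi (x, th) - K)%C
    with (((phi (x, th) - phi (x0, th) - (x0 - x)%R * K) + (phi (x0, th) + x0 * K)) / (- x)%R)%C.
  2:{ rewrite RtoC_minus, RtoC_opp in *. field. intros Z. apply Hx1. rewrite Z. ring. }
  rewrite Cmod_div, Cmod_R, Rabs_right by (try exact Hx1; lra).
  apply Rmult_lt_reg_r with (- x); [lra|].
  unfold Rdiv. rewrite Rmult_assoc, Rinv_l, Rmult_1_r by lra.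
  eapply Rle_lt_trans; [apply Cmod_triangle|]. fold M.
  assert (4 * M < eps * - x).
  { apply Rmult_lt_reg_r with (/ eps); [apply Rinv_0_lt_compat, He|].
    replace (eps * - x * / eps) with (- x) by (field; lra). unfold Rdiv in H2; lra. }
  unfold e in HC. nra.
Qed.

Lemma hyp2F1_ray_log (a b c : C) (th : R) : ~ nonpos_int c -> c = (a + b)%C ->
  - (PI / 2) < th < PI / 2 ->
  Ctends (at_right 0) (fun t => Cexp (ln t, th) * hyp2F1' a b c (ray th t))%C
    (CGamma c * CGamma 1 / (CGamma a * CGamma b))%C /\
  Ctends (at_right 0) (fun t => / (- ln t)%R * hyp2F1 a b c (ray th t))%C
    (CGamma c * CGamma 1 / (CGamma a * CGamma b))%C.
Proof.
  intros Hc Hcab Hth.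
  assert (E : (c - a - b)%C = 0) by (rewrite Hcab; ring).
  assert (X : Ctends (at_right 0) (fun t => Cexp (ln t, th) * hyp2F1' a b c (ray th t))%C
    (CGamma c * CGamma 1 / (CGamma a * CGamma b))%C); [|split; [exact X|apply log_growth; assumption]].
  assert (S := hyp2F1'_ray_singular a b c th Hc ltac:(rewrite E, re_RtoC; lra) Hth).
  rewrite E in S. replace (1 - 0)%C with (RtoC 1) in S by ring.
  apply (Ctends_ext (at_right 0)) with (2 := S). intros t. rewrite Cmult_1_l. ring.
Qed.

(** A geometric sequence: [tau * ln (t n)] moves by full turns. The absolute value of [tau] makes t
    n tend to 0 for either sign. *)
Lemma phase_sequence (tau phi : R) : tau <> 0 -> exists t : nat -> R,
  filterlim t eventually (at_right 0) /\
  forall n, 0 < t n /\ Cexp (Ci * (tau * ln (t n))%R)%C = Cexp (Ci * phi)%C.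
Proof.
  intros Ht. exists (fun n => exp (phi / tau - 2 * PI * INR n / Rabs tau)). split.
  - intros P [d Hd]. unfold filtermap.
    assert (Ha : 0 < Rabs tau) by (apply Rabs_pos_lt, Ht).
    generalize PI_RGT_0; intros Hpi.
    destruct (nfloor_ex (Rabs ((phi / tau - ln d) * Rabs tau / (2 * PI)))) as [N [_ HN]];
      [apply Rabs_pos|].
    exists (N + 1)%nat. intros n Hn. apply Hd; [|apply exp_pos].
    change (Rabs (exp (phi / tau - 2 * PI * INR n / Rabs tau) - 0) < d).
    rewrite Rminus_0_r, Rabs_right by (left; apply exp_pos).
    rewrite <- (exp_ln d) by apply cond_pos. apply exp_increasing.
    apply le_INR in Hn. rewrite plus_INR in Hn. simpl in Hn.
    generalize (Rle_abs ((phi / tau - ln d) * Rabs tau / (2 * PI))); intros B.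
    assert (X : (phi / tau - ln d) * Rabs tau / (2 * PI) < INR n) by lra.
    apply Rmult_lt_compat_r with (r := 2 * PI / Rabs tau) in X; [|apply Rdiv_lt_0_compat; lra].
    replace ((phi / tau - ln d) * Rabs tau / (2 * PI) * (2 * PI / Rabs tau)) with (phi / tau - ln d) in X
      by (field; repeat split; try lra; exact Ht).
    replace (INR n * (2 * PI / Rabs tau)) with (2 * PI * INR n / Rabs tau) in X by (field; lra). lra.
  - intros n. split; [apply exp_pos|]. rewrite ln_exp, !Cexp_Ci.
    assert (Ha : 0 < Rabs tau) by (apply Rabs_pos_lt, Ht).
    unfold Rabs in *. destruct (Rcase_abs tau) as [L|L].
    + replace (tau * (phi / tau - 2 * PI * INR n / - tau)) with (phi + 2 * INR n * PI) by (field; lra).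
      rewrite cos_period, sin_period. reflexivity.
    + replace (tau * (phi / tau - 2 * PI * INR n / tau)) with (phi - 2 * INR n * PI) by (field; lra).
      rewrite <- (cos_period (phi - 2 * INR n * PI) n), <- (sin_period (phi - 2 * INR n * PI) n).
      replace (phi - 2 * INR n * PI + 2 * INR n * PI) with phi by ring. reflexivity.
Qed.

Lemma polar_exists (u : C) (r : R) : 0 < r -> Cmod u = r -> exists phi : R, u = (r * Cexp (Ci * phi))%C.
Proof.
  intros Hr Hu. exists (Carg u). rewrite <- Hu. apply Carg_spec. apply Cmod_pos_neq. lra.
Qed.

(* For [c - a - b = i s] the function has no limit along a ray: it behaves like
   [A + B (1 - z)^(i s)], and [u0] prescribes the value of [(1 - z)^(i s)] on a sequence. *)
Lemma oscillating_limit (a b c u0 : C) (s th : R) : ~ nonpos_int c -> s <> 0 ->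
  (c - a - b)%C = (s * Ci)%C -> - (PI / 2) < th < PI / 2 -> Cmod u0 = exp (- (s * th)) ->
  let L := (CGamma c * CGamma (1 + s * Ci) / (CGamma (c - a) * CGamma (c - b)))%C in
  let K := (CGamma c * CGamma (1 - s * Ci) / (CGamma a * CGamma b))%C in
  exists t : nat -> R, filterlim t eventually (at_right 0) /\
    Ctends eventually (fun n => hyp2F1 a b c (ray th (t n))) ((L - K * u0) / (s * Ci))%C /\
    Ctends eventually (fun n => Cexp (ln (t n), th) * hyp2F1' a b c (ray th (t n)))%C (K * u0)%C.
Proof.
  intros Hc Hs Hg Hth Hu L K.
  destruct (polar_exists u0 _ (exp_pos _) Hu) as [phi Hphi].
  destruct (phase_sequence s phi Hs) as [t [Ht1 Ht2]].
  exists t. split; [exact Ht1|].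
  (* On a ray |(1 - z)^(i s)| = e^(- s th) is constant; the hypothesis on |u0| fixes the modulus and
     the sequence fixes the phase, so the power equals [u0] for every n. *)
  assert (Hu0 : forall n, Cexp (s * Ci * (ln (t n), th))%C = u0).
  { intros n. rewrite Hphi, <- (proj2 (Ht2 n)), <- Cexp_RtoC, <- Cexp_plus. f_equal.
    apply injective_projections; simpl; ring. }
  assert (HsC : (s * Ci)%C <> 0) by (apply Cmult_neq_0; [apply RtoC_neq_0, Hs|exact Ci_nz]).
  assert (HF' : Ctends eventually (fun n => Cexp (ln (t n), th) * hyp2F1' a b c (ray th (t n)))%C (K * u0)%C).
  { assert (S := hyp2F1'_ray_singular a b c th Hc ltac:(rewrite Hg; unfold Re; simpl; lra) Hth).
    rewrite Hg in S. fold K in S. apply (Ctends_comp _ _ _ t _ Ht1) in S.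
    assert (S2 := Ctends_mult eventually _ _ _ _ S (Ctends_const eventually u0)).
    apply (Ctends_ext eventually) with (2 := S2). intros n. rewrite <- (Hu0 n) at 1.
    replace ((1 - s * Ci) * (ln (t n), th))%C with ((ln (t n), th) - s * Ci * (ln (t n), th))%C by ring.
    rewrite Cexp_minus. field. apply Cexp_neq_0. }
  split; [|exact HF'].
  (* L absorbs the factor (c-a)(c-b)/c of the contiguous relation through 1/Gamma(x) = x/Gamma(x+1),
     so it also makes sense when c - a or c - b is a pole. *)
  assert (HL : Ctends eventually (fun n => (c - a) * (c - b) / c * hyp2F1 a b (c + 1) (ray th (t n)))%C L).
  { assert (E1 : (c + 1 - a - b)%C = (1 + s * Ci)%C) by (rewrite <- Hg; ring).
    assert (S := gauss_limit a b (c + 1) th (regular_succ c Hc)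
      ltac:(rewrite E1; unfold Re; simpl; lra) Hth).
    apply (Ctends_comp _ _ _ t _ Ht1) in S.
    replace L with ((c - a) * (c - b) / c * (CGamma (c + 1) * CGamma (c + 1 - a - b) /
      (CGamma (c + 1 - a) * CGamma (c + 1 - b))))%C; [apply (Ctends_scal eventually), S|].
    unfold L. rewrite E1, CGamma_succ by (apply regular_neq_0, Hc).
    replace (c + 1 - a)%C with (c - a + 1)%C by ring. replace (c + 1 - b)%C with (c - b + 1)%C by ring.
    unfold Cdiv. rewrite !Cinv_mult, (inv_CGamma_succ (c - a)), (inv_CGamma_succ (c - b)).
    generalize (/ CGamma (c - a + 1))%C (/ CGamma (c - b + 1))%C; intros x y.
    field. apply regular_neq_0, Hc. }
  apply (Ctends_ext_loc eventually (fun n =>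
    ((c - a) * (c - b) / c * hyp2F1 a b (c + 1) (ray th (t n))
     - Cexp (ln (t n), th) * hyp2F1' a b c (ray th (t n))) / (s * Ci))%C).
  - assert (Hr := Ht1 _ (ray_in_disc th Hth)). unfold filtermap in Hr.
    revert Hr. apply filter_imp. intros n [_ [_ Hz]].
    assert (C1 := hyp2F1_contiguous_c a b c _ Hc Hz). rewrite Hg in C1.
    replace (1 - ray th (t n))%C with (Cexp (ln (t n), th)) in C1 by (unfold ray; ring).
    rewrite <- C1. field. split; [exact Ci_nz|apply RtoC_neq_0, Hs].
  - apply (Ctends_div eventually); [exact HsC| |apply (Ctends_const eventually)].
    apply (Ctends_minus eventually); assumption.
Qed.

(** * The five cases *)

Section Cases.
Context (a b c : C) (lam : R).
Context (hc : ~ nonpos_int c) (hlam : - (PI / 2) < lam < PI / 2).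
Context (hray : ray_spirallike a b c lam).

Lemma zero_angle : - (PI / 2) < 0 < PI / 2.
Proof. generalize PI_RGT_0; lra. Qed.

Lemma cos_lam_pos : 0 < cos lam.
Proof. apply cos_gt_0; lra. Qed.

Lemma gauss_value_neq_0 : 0 < Re (c - a - b)%C ->
  (CGamma c * CGamma (c - a - b) / (CGamma (c - a) * CGamma (c - b)))%C <> 0 /\
  CGamma (c - a)%C <> 0 /\ CGamma (c - b)%C <> 0.
Proof.
  intros Hg. destruct (spirallike_gauss_neq_0 a b c lam hc hlam hray Hg) as [H1 H2].
  assert (G1 := CGamma_neq_0 _ H1). assert (G2 := CGamma_neq_0 _ H2).
  split; [|tauto]. assert (G3 := CGamma_neq_0 _ hc).
  assert (G4 := CGamma_neq_0 _ (Re_pos_regular _ Hg)).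
  intros E. apply (Cmult_neq_0 _ _ G3 G4).
  replace (CGamma c * CGamma (c - a - b))%C with
    (CGamma c * CGamma (c - a - b) / (CGamma (c - a) * CGamma (c - b))
     * (CGamma (c - a) * CGamma (c - b)))%C by (field; tauto).
  rewrite E. ring.
Qed.

(** F and F' both have Gauss values at 1 and Gamma(g + 1) = g Gamma(g) reduces their quotient to
    ab/(c-a-b-1); the expression in the claim is the limit of w itself. *)
Lemma case_i : 1 < Re (c - a - b)%C ->
  Rabs (lam - Carg (1 + a * b / (c - a - b - 1))%C) <= PI / 2.
Proof.
  intros Hg. destruct (gauss_value_neq_0 ltac:(lra)) as [HV [G1 G2]].
  apply arg_bound_half; [exact hlam|].
  assert (S0 := gauss_limit a b c 0 hc ltac:(lra) zero_angle).
  assert (E1 : (c + 1 - (a + 1) - (b + 1))%C = (c - a - b - 1)%C) by ring.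
  assert (Hg1 : 0 < Re (c - a - b - 1)%C) by (rewrite Re_minus, re_RtoC; lra).
  assert (S1 := gauss_limit (a + 1) (b + 1) (c + 1) 0 (regular_succ c hc)
    ltac:(rewrite E1; exact Hg1) zero_angle).
  rewrite E1 in S1. replace (c + 1 - (a + 1))%C with (c - a)%C in S1 by ring.
  replace (c + 1 - (b + 1))%C with (c - b)%C in S1 by ring.
  rewrite <- (Cmult_1_r (1 + _)%C).
  apply (spirallike_limit (at_right 0) a b c lam 0 (fun t => t) (fun _ => 1)
    (fun t => 1 + ray 0 t * (a * b / c * hyp2F1 (a + 1) (b + 1) (c + 1) (ray 0 t) / hyp2F1 a b c (ray 0 t)))%C
    _ 1 hray zero_angle (filterlim_id _ _)).
  - apply filter_forall; intros; lra.
  - apply filter_forall; intros t. unfold hyp2F1'. ring.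
  - set (g := (c - a - b - 1)%C) in *.
    assert (Hg0 : g <> 0) by (apply regular_neq_0, Re_pos_regular, Hg1).
    assert (GS : CGamma (c - a - b)%C = (g * CGamma g)%C).
    { rewrite <- CGamma_succ by exact Hg0. f_equal. unfold g. ring. }
    assert (G3 := CGamma_neq_0 _ hc). assert (G4 := CGamma_neq_0 _ (Re_pos_regular _ Hg1)).
    assert (Hc0 := regular_neq_0 c hc).
    replace (a * b / g)%C with (1 * (a * b / c * (CGamma (c + 1) * CGamma g /
      (CGamma (c - a) * CGamma (c - b))) / (CGamma c * CGamma (c - a - b) /
      (CGamma (c - a) * CGamma (c - b)))))%C.
    2:{ rewrite GS, CGamma_succ by exact Hc0. field. tauto. }
    apply (Ctends_plus (at_right 0)); [apply (Ctends_const (at_right 0))|].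
    apply (Ctends_mult (at_right 0)); [apply ray_lim|].
    apply (Ctends_div (at_right 0)); [exact HV|apply (Ctends_scal (at_right 0)), S1|exact S0].
Qed.

(** F has a nonzero limit while F' grows like - ln t, so w / (- ln t) has a limit. As c - a = b + 1
    and c - b = a + 1, all Gamma factors cancel and ab remains. *)
Lemma case_iii : (c - a - b)%C = 1 -> Rabs (lam - Carg (a * b)%C) <= PI / 2.
Proof.
  intros Hg. assert (Hg' : 0 < Re (c - a - b)%C) by (rewrite Hg, re_RtoC; lra).
  destruct (gauss_value_neq_0 Hg') as [HV [G1 G2]].
  apply arg_bound_half; [exact hlam|].
  assert (S0 := gauss_limit a b c 0 hc Hg' zero_angle). rewrite Hg in S0, HV.
  assert (E1 : (c + 1)%C = (a + 1 + (b + 1))%C).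
  { replace c with (c - a - b + a + b)%C by ring. rewrite Hg. ring. }
  destruct (hyp2F1_ray_log (a + 1) (b + 1) (c + 1) 0 (regular_succ c hc) E1 zero_angle) as [_ S1].
  rewrite <- (Cmult_1_r (a * b)%C).
  apply (spirallike_limit (at_right 0) a b c lam 0 (fun t => t) (fun t => / (- ln t))
    (fun t => / (- ln t)%R + ray 0 t * (a * b / c * (/ (- ln t)%R * hyp2F1 (a + 1) (b + 1) (c + 1) (ray 0 t))
      / hyp2F1 a b c (ray 0 t)))%C
    _ 1 hray zero_angle (filterlim_id _ _)).
  - generalize (at_right_log_large 0). apply filter_imp. intros t Ht. apply Rinv_0_lt_compat, Ht.
  - generalize (at_right_log_large 0). apply filter_imp. intros t Ht.
    rewrite RtoC_inv by lra. unfold hyp2F1', Cdiv. ring.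
  - assert (Ea : (c - a)%C = (b + 1)%C).
    { replace (c - a)%C with (c - a - b + b)%C by ring. rewrite Hg. ring. }
    assert (Eb : (c - b)%C = (a + 1)%C).
    { replace (c - b)%C with (c - a - b + a)%C by ring. rewrite Hg. ring. }
    rewrite Ea, Eb in *.
    assert (G3 := CGamma_neq_0 _ hc). assert (Hc0 := regular_neq_0 c hc).
    assert (G4 : CGamma 1 <> 0) by (apply CGamma_neq_0, Re_pos_regular; rewrite re_RtoC; lra).
    assert (HE : (0 + 1 * (a * b / c * (CGamma (c + 1) * CGamma 1 /
      (CGamma (a + 1) * CGamma (b + 1))) / (CGamma c * CGamma 1 /
      (CGamma (b + 1) * CGamma (a + 1)))))%C = (a * b)%C)
      by (rewrite CGamma_succ by exact Hc0; field; tauto).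
    refine (eq_ind _ (Ctends (at_right 0) _) _ _ HE).
    apply (Ctends_plus (at_right 0)).
    + intros eps He. generalize (at_right_log_large (/ eps)). apply filter_imp. intros t Ht.
      assert (0 < / eps) by (apply Rinv_0_lt_compat, He).
      rewrite <- RtoC_inv, <- RtoC_minus, Cmod_R, Rminus_0_r, Rabs_right by
        (try apply Rle_ge, Rlt_le, Rinv_0_lt_compat; lra).
      rewrite <- (Rinv_inv eps). apply Rinv_lt_contravar; [|exact Ht].
      apply Rmult_lt_0_compat; lra.
    + apply (Ctends_mult (at_right 0)); [apply ray_lim|].
      apply (Ctends_div (at_right 0)); [exact HV|apply (Ctends_scal (at_right 0)), S1|exact S0].
Qed.

(** By Gamma(al + 1) = al Gamma(al) the constant of F' is al times that of F, so (1 - z) w tends to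
    al on every ray. Hence al is a multiple of e^(i lam), a positive one because Re al > 0. *)
Lemma case_v : ~ nonpos_int a -> ~ nonpos_int b -> Re (c - a - b)%C < 0 ->
  lam = Carg (a + b - c)%C.
Proof.
  intros Ha Hb Hg. set (al := (a + b - c)%C).
  assert (Eal : (c - a - b)%C = (- al)%C) by (unfold al; ring).
  assert (Hal : 0 < Re al).
  { replace (Re al) with (- Re (c - a - b)%C); [lra|]. rewrite Eal. unfold Re; simpl; ring. }
  assert (G1 := CGamma_neq_0 _ Ha). assert (G2 := CGamma_neq_0 _ Hb). assert (G3 := CGamma_neq_0 _ hc).
  assert (G4 := CGamma_neq_0 _ (Re_pos_regular _ Hal)).
  set (K := (CGamma c * CGamma al / (CGamma a * CGamma b))%C).
  assert (HK : K <> 0).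
  { intros E. apply (Cmult_neq_0 _ _ G3 G4).
    replace (CGamma c * CGamma al)%C with (K * (CGamma a * CGamma b))%C by (unfold K; field; tauto).
    rewrite E; ring. }
  assert (HL : forall th, - (PI / 2) < th < PI / 2 -> Ctends (at_right 0) (fun t => 1%R *
    (Cexp (ln t, th) * (1 + ray th t * (hyp2F1' a b c (ray th t) / hyp2F1 a b c (ray th t)))))%C al).
  { intros th Hth.
    assert (S0 := hyp2F1_ray_singular a b c th hc Hal Hth). fold al K in S0.
    assert (S1 := hyp2F1'_ray_singular a b c th hc ltac:(lra) Hth).
    rewrite Eal in S1. replace (1 - - al)%C with (al + 1)%C in S1 by ring.
    rewrite CGamma_succ in S1 by (apply regular_neq_0, Re_pos_regular, Hal).
    replace (CGamma c * (al * CGamma al) / (CGamma a * CGamma b))%C with (al * K)%C in S1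
      by (unfold K; field; tauto).
    replace al with (0 + 1 * (al * K / K))%C by (field; exact HK).
    apply (Ctends_ext_loc (at_right 0) (fun t => Cexp (ln t, th) + ray th t *
      (hyp2F1' a b c (ray th t) * Cexp ((al + 1) * (ln t, th)) /
       (hyp2F1 a b c (ray th t) * Cexp (al * (ln t, th)))))%C).
    - generalize (hray th Hth). apply filter_imp. intros t [HF _].
      replace ((al + 1) * (ln t, th))%C with (al * (ln t, th) + (ln t, th))%C by ring.
      rewrite Cexp_plus. assert (X := Cexp_neq_0 (al * (ln t, th))%C). field. tauto.
    - apply (Ctends_plus (at_right 0)); [apply Cexp_log_lim|].
      apply (Ctends_mult (at_right 0)); [apply ray_lim|].
      apply (Ctends_div (at_right 0)); assumption. }
  destruct (spirallike_direction a b c _ lam (fun _ => 1) hray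
    (filter_forall _ (fun _ => Rlt_0_1)) HL) as [x [Hx E]].
  assert (Hx' : 0 < x).
  { destruct Hx as [Hx|<-]; [exact Hx|exfalso]. rewrite E, Re_polar in Hal. lra. }
  rewrite E. symmetry. apply Carg_polar; assumption.
Qed.

(** The factor (1 - z)^(1 - g), where g = c - a - b, is not positive: its phase excludes a non-real
    g, and for real g it produces the sector in th. *)
Lemma power_limit (th : R) : 0 < Re (c - a - b)%C < 1 -> - (PI / 2) < th < PI / 2 ->
  let V := (CGamma c * CGamma (c - a - b) / (CGamma (c - a) * CGamma (c - b)))%C in
  let K' := (CGamma c * CGamma (1 - (c - a - b)) / (CGamma a * CGamma b))%C in
  Ctends (at_right 0) (fun t => Cexp ((1 - (c - a - b)) * (ln t, th)) *
    (1 + ray th t * (hyp2F1' a b c (ray th t) / hyp2F1 a b c (ray th t))))%C (K' / V)%C.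
Proof.
  intros Hg Hth V K'. destruct (gauss_value_neq_0 ltac:(lra)) as [HV _]. fold V in HV.
  assert (S0 := gauss_limit a b c th hc ltac:(lra) Hth). fold V in S0.
  assert (S1 := hyp2F1'_ray_singular a b c th hc ltac:(lra) Hth). fold K' in S1.
  replace (K' / V)%C with (0 + 1 * (K' / V))%C by ring.
  apply (Ctends_ext (at_right 0) (fun t => Cexp ((1 - (c - a - b)) * (ln t, th)) + ray th t *
      (hyp2F1' a b c (ray th t) * Cexp ((1 - (c - a - b)) * (ln t, th)) / hyp2F1 a b c (ray th t)))%C).
  - intros t. unfold Cdiv. ring.
  - apply (Ctends_plus (at_right 0)).
    + apply Cexp_scal_log_lim. rewrite Re_minus, re_RtoC. lra.
    + apply (Ctends_mult (at_right 0)); [apply ray_lim|].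
      apply (Ctends_div (at_right 0)); assumption.
Qed.

Lemma case_iv_pos : ~ nonpos_int a -> ~ nonpos_int b -> 0 < Re (c - a - b)%C < 1 ->
  Im (c - a - b)%C = 0 /\
  Rabs (lam - Carg (CGamma (c - a) * CGamma (c - b) / (CGamma a * CGamma b))%C)
    <= Re (c - a - b)%C * (PI / 2).
Proof.
  intros Ha Hb Hg. destruct (gauss_value_neq_0 ltac:(lra)) as [HV [G5 G6]].
  set (g := (c - a - b)%C) in *. set (V := (CGamma c * CGamma g / (CGamma (c - a) * CGamma (c - b)))%C) in *.
  set (K' := (CGamma c * CGamma (1 - g) / (CGamma a * CGamma b))%C).
  set (X := (CGamma (c - a) * CGamma (c - b) / (CGamma a * CGamma b))%C).
  assert (G1 := CGamma_neq_0 _ Ha). assert (G2 := CGamma_neq_0 _ Hb). assert (G3 := CGamma_neq_0 _ hc).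
  assert (G4 : CGamma g <> 0) by (apply CGamma_neq_0, Re_pos_regular; lra).
  assert (G7 : CGamma (1 - g)%C <> 0).
  { apply CGamma_neq_0, Re_pos_regular. rewrite Re_minus, re_RtoC. lra. }
  assert (HX : X <> 0).
  { intros E. apply (Cmult_neq_0 _ _ G5 G6).
    replace (CGamma (c - a) * CGamma (c - b))%C with (X * (CGamma a * CGamma b))%C by (unfold X; field; tauto).
    rewrite E; ring. }
  assert (EK : (K' / V)%C = (CGamma (1 - g) / CGamma g * X)%C) by (unfold K', V, X; field; tauto).
  assert (Him : Im g = 0).
  (* After multiplication by the positive t^(1 - Re g), w oscillates with the phase Im g ln t. Every
     phase is attained along a sequence, which forces the nonzero limit K'/V to be 0. *)
  { destruct (Req_dec (Im g) 0) as [E|Hi]; [exact E|exfalso].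
    assert (E0 : (Cexp (- (Ci * lam)) * (K' / V))%C = 0).
    { apply full_rotation_zero. intros phi.
      destruct (phase_sequence (Im g) phi Hi) as [t [Ht1 Ht2]].
      assert (S := power_limit 0 Hg zero_angle). cbv zeta in S. fold g V K' in S.
      apply (Ctends_comp _ _ _ t _ Ht1) in S.
      rewrite <- Cmult_assoc.
      apply (spirallike_limit eventually a b c lam 0 t (fun n => exp ((1 - Re g) * ln (t n))) _ (K' / V)%C
        (Cexp (Ci * phi)) hray zero_angle Ht1) with (3 := S).
      - apply filter_forall. intros n. apply exp_pos.
      - apply filter_forall. intros n.
        rewrite <- (proj2 (Ht2 n)), <- Cexp_RtoC.
        replace ((1 - g) * (ln (t n), 0))%C with (RtoC ((1 - Re g) * ln (t n)) - Ci * RtoC (Im g * ln (t n)))%C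
          by (apply injective_projections; unfold Re, Im; simpl; ring).
        rewrite Cexp_minus.
        generalize (hyp2F1' a b c (ray 0 (t n)) / hyp2F1 a b c (ray 0 (t n)))%C; intros q. field. apply Cexp_neq_0. }
    apply (Cmult_neq_0 (Cexp (- (Ci * lam))) (K' / V)%C); [apply Cexp_neq_0| |exact E0].
    rewrite EK. apply Cmult_neq_0; [|exact HX]. apply Cmult_neq_0; [exact G7|].
    intros Z. apply G4. rewrite <- (Cinv_invol (CGamma g)), Z. apply Cinv_0. }
  split; [exact Him|].
  set (r := Re g) in *.
  assert (Eg : g = RtoC r) by (apply injective_projections; [reflexivity|exact Him]).
  (* The power (1 - z)^(1 - r) has phase (1 - r) th, so [sector_bound] applies with [be = 1 - r].
     K'/V is a positive multiple of X because Gamma is positive at r and at 1 - r. *)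
  replace (r * (PI / 2)) with ((1 - (1 - r)) * (PI / 2)) by ring.
  apply sector_bound; [exact hlam|exact HX|lra|]. intros th Hth.
  destruct (CGamma_pos r ltac:(lra)) as [p [Hp Ep]].
  destruct (CGamma_pos (1 - r) ltac:(lra)) as [q [Hq Eq]].
  assert (EK2 : (K' / V)%C = (RtoC (q / p) * X)%C).
  { rewrite EK, Eg, <- RtoC_minus, Ep, Eq, RtoC_div by lra. reflexivity. }
  assert (S := power_limit th Hg Hth). cbv zeta in S. fold g V K' in S. rewrite EK2 in S.
  assert (P : 0 <= Re (Cexp (- (Ci * lam)) * (RtoC (q / p) * X * Cexp (- (Ci * ((1 - r) * th)%R))))%C).
  { apply (spirallike_limit (at_right 0) a b c lam th (fun t => t) (fun t => exp ((1 - r) * ln t)) _ _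
      (Cexp (- (Ci * ((1 - r) * th)%R))) hray Hth (filterlim_id _ _)) with (3 := S).
    - apply filter_forall. intros t. apply exp_pos.
    - apply filter_forall. intros t. rewrite <- Cexp_RtoC, Eg.
      replace ((1 - r) * (ln t, th))%C with (RtoC ((1 - r) * ln t) - - (Ci * ((1 - r) * th)%R))%C
        by (apply injective_projections; simpl; ring).
      rewrite Cexp_minus.
      generalize (hyp2F1' a b c (ray th t) / hyp2F1 a b c (ray th t))%C; intros y. field. apply Cexp_neq_0. }
  replace (Cexp (- (Ci * lam)) * (RtoC (q / p) * X * Cexp (- (Ci * ((1 - r) * th)%R))))%C
    with (RtoC (q / p) * (Cexp (- (Ci * lam)) * (X * Cexp (- (Ci * ((1 - r) * th)%R)))))%C in P by ring.
  rewrite re_scal_l in P.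
  assert (0 < q / p) by (apply Rdiv_lt_0_compat; assumption).
  apply Rmult_le_reg_l with (q / p); [assumption|]. rewrite Rmult_0_r. exact P.
Qed.

(** (1 - z) F' and F / (- ln t) have the same nonzero limit K, so (- ln t)(1 - z) w tends to 1, and
    1 has to be a positive multiple of e^(i lam). *)
Lemma case_iv_zero : ~ nonpos_int a -> ~ nonpos_int b -> (c - a - b)%C = 0 -> Carg 1 = lam.
Proof.
  intros Ha Hb Hg.
  assert (Ec : c = (a + b)%C) by (replace c with (c - a - b + a + b)%C by ring; rewrite Hg; ring).
  set (K := (CGamma c * CGamma 1 / (CGamma a * CGamma b))%C).
  assert (HK : K <> 0).
  { assert (G1 := CGamma_neq_0 _ Ha). assert (G2 := CGamma_neq_0 _ Hb). assert (G3 := CGamma_neq_0 _ hc).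
    assert (G4 : CGamma 1 <> 0) by (apply CGamma_neq_0, Re_pos_regular; rewrite re_RtoC; lra).
    intros E. apply (Cmult_neq_0 _ _ G3 G4).
    replace (CGamma c * CGamma 1)%C with (K * (CGamma a * CGamma b))%C by (unfold K; field; tauto).
    rewrite E; ring. }
  assert (HL : forall th, - (PI / 2) < th < PI / 2 -> Ctends (at_right 0) (fun t => (- ln t)%R *
    (Cexp (ln t, th) * (1 + ray th t * (hyp2F1' a b c (ray th t) / hyp2F1 a b c (ray th t)))))%C 1).
  { intros th Hth. destruct (hyp2F1_ray_log a b c th hc Ec Hth) as [S1 S0]. fold K in S0, S1.
    replace (RtoC 1) with (0 + 1 * (K / K))%C by (field; exact HK).
    apply (Ctends_ext_loc (at_right 0) (fun t => (- ln t)%R * Cexp (ln t, th) + ray th t *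
      (Cexp (ln t, th) * hyp2F1' a b c (ray th t) / (/ (- ln t)%R * hyp2F1 a b c (ray th t))))%C).
    - generalize (filter_and _ _ (hray th Hth) (at_right_log_large 0)).
      apply filter_imp. intros t [[HF _] Ht].
      assert (RtoC (- ln t) <> 0) by (apply RtoC_neq_0; lra). field. tauto.
    - apply (Ctends_plus (at_right 0)).
      (* t ln t tends to 0: with y = sqrt t, the bound x <= e^x at x = - ln t / 2 gives (- ln t) y^2
         <= 2 y. *)
      + intros eps He. generalize (filter_and _ _ at_right_pos (filter_and _ _ (at_right_log_large 0)
          (exp_scal_ln_small (/ 2) (eps / 2) ltac:(lra) ltac:(lra)))).
        apply filter_imp. intros t [Ht [Hl Hs]].
        replace ((- ln t)%R * Cexp (ln t, th) - 0)%C with ((- ln t)%R * Cexp (ln t, th))%C by ring.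
        rewrite Cmod_mult, Cmod_R, Rabs_right, Cmod_Cexp by lra. unfold Re; simpl.
        set (l := ln t) in *.
        assert (B : - l / 2 <= exp (- l / 2)) by (generalize (exp_ineq1_le (- l / 2)); lra).
        replace (exp l) with (exp (/ 2 * l) * exp (/ 2 * l)) by (rewrite <- exp_plus; f_equal; lra).
        assert (X : exp (- l / 2) * exp (/ 2 * l) = 1).
        { rewrite <- exp_plus. replace (- l / 2 + / 2 * l) with 0 by lra. apply exp_0. }
        assert (P := exp_pos (/ 2 * l)). set (y := exp (/ 2 * l)) in *.
        assert (- l / 2 * y <= 1) by (rewrite <- X; apply Rmult_le_compat_r; lra). nra.
      + apply (Ctends_mult (at_right 0)); [apply ray_lim|].
        apply (Ctends_div (at_right 0)); assumption. }
  destruct (spirallike_direction a b c _ lam (fun t => - ln t) hray (at_right_log_large 0) HL) as [x [Hx E]].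
  assert (Hx' : 0 < x).
  { destruct Hx as [Hx|<-]; [exact Hx|exfalso]. apply C1_nz. rewrite E. ring. }
  rewrite E. apply Carg_polar; assumption.
Qed.

(* Radii [rho = |K| e^(-s th) / |L|]: when [rho < 1], the circle [v / (L - v)], [|v| = rho |L|],
   winds around 0, which no half-plane allows; hence [rho > 1] for all angles. Then the point
   [v = rho L], where [v / (L - v) < 0], gives the direction of [-(c-a-b)], which is imaginary. *)
Lemma case_iv_imag (s : R) : ~ nonpos_int a -> ~ nonpos_int b -> (c - a - b)%C = (s * Ci)%C -> s = 0.
Proof.
  intros Ha Hb Hg. destruct (Req_dec s 0) as [E|Hs]; [exact E|exfalso].
  set (L := (CGamma c * CGamma (1 + s * Ci) / (CGamma (c - a) * CGamma (c - b)))%C).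
  set (K := (CGamma c * CGamma (1 - s * Ci) / (CGamma a * CGamma b))%C).
  set (e := Cexp (- (Ci * lam))).
  assert (HsC : (s * Ci)%C <> 0) by (apply Cmult_neq_0; [apply RtoC_neq_0, Hs|exact Ci_nz]).
  assert (HK : K <> 0).
  { assert (G1 := CGamma_neq_0 _ Ha). assert (G2 := CGamma_neq_0 _ Hb). assert (G3 := CGamma_neq_0 _ hc).
    assert (G4 : CGamma (1 - s * Ci)%C <> 0).
    { apply CGamma_neq_0, Re_pos_regular. unfold Re; simpl; lra. }
    intros E. apply (Cmult_neq_0 _ _ G3 G4).
    replace (CGamma c * CGamma (1 - s * Ci))%C with (K * (CGamma a * CGamma b))%C by (unfold K; field; tauto).
    rewrite E; ring. }
  assert (HKp : 0 < Cmod K) by (apply Cmod_gt_0, HK).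
  (* [v] is the value of K (1 - z)^(i s) along a sequence; there (1 - z) w tends to i s v / (L - v),
     and division by e^(i th) leaves the positive multiple t of w. *)
  assert (Hv : forall th v, - (PI / 2) < th < PI / 2 -> Cmod v = Cmod K * exp (- (s * th)) -> v <> L ->
    0 <= Re (e * (s * Ci * (v / (L - v)) * Cexp (- (Ci * th))))%C).
  { intros th v Hth Hm HvL.
    assert (Hu : Cmod (v / K)%C = exp (- (s * th))).
    { rewrite Cmod_div, Hm by exact HK. field. lra. }
    destruct (oscillating_limit a b c (v / K)%C s th hc Hs Hg Hth Hu) as [t [Ht [S0 S1]]].
    fold L K in S0, S1.
    replace (K * (v / K))%C with v in S0, S1 by (field; exact HK).
    assert (HLv : (L - v)%C <> 0).
    { intros E. apply HvL. replace v with (L - (L - v))%C by ring. rewrite E. ring. }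
    assert (HD : ((L - v) / (s * Ci))%C <> 0).
    { intros E. apply HLv. replace (L - v)%C with ((L - v) / (s * Ci) * (s * Ci))%C
        by (field; split; [exact Ci_nz|apply RtoC_neq_0, Hs]). rewrite E. ring. }
    apply (spirallike_limit eventually a b c lam th t t
      (fun n => Cexp (ln (t n), th) + ray th (t n) *
        (Cexp (ln (t n), th) * hyp2F1' a b c (ray th (t n)) / hyp2F1 a b c (ray th (t n))))%C
      _ (Cexp (- (Ci * th))) hray Hth Ht).
    - exact (Ht _ at_right_pos).
    - assert (Hp := Ht _ at_right_pos). unfold filtermap in Hp. revert Hp. apply filter_imp.
      intros n Hn.
      transitivity (Cexp (ln (t n), th) * Cexp (- (Ci * th)) * (1 + ray th (t n) *
        (hyp2F1' a b c (ray th (t n)) / hyp2F1 a b c (ray th (t n)))))%C; [unfold Cdiv; ring|].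
      rewrite Cexp_log_rotate by exact Hn. reflexivity.
    - replace (s * Ci * (v / (L - v)))%C with (0 + 1 * (v / ((L - v) / (s * Ci))))%C.
      2:{ field. repeat split; try assumption; [exact Ci_nz|apply RtoC_neq_0, Hs]. }
      apply (Ctends_plus eventually); [exact (Ctends_comp _ _ _ t _ Ht (Cexp_log_lim th))|].
      apply (Ctends_mult eventually); [exact (Ctends_comp _ _ _ t _ Ht (ray_lim th))|].
      apply (Ctends_div eventually); assumption. }
  (* [half_turn_direction] would make - i s a multiple of e^(i lam); the former has real part 0 and
     cos lam > 0, so s = 0. *)
  assert (Hdir : (forall th, - (PI / 2) < th < PI / 2 ->
      0 <= Re (e * (- (s * Ci) * Cexp (- (Ci * th))))%C) -> False).
  { intros H. destruct (half_turn_direction lam (- (s * Ci))%C H) as [x [Hx E]].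
    assert (ER := f_equal Re E). rewrite Re_polar in ER.
    replace (Re (- (s * Ci))%C) with 0 in ER by (unfold Re; simpl; ring).
    assert (x = 0) by (generalize cos_lam_pos; nra). subst x. apply HsC.
    replace (s * Ci)%C with (- - (s * Ci))%C by ring. rewrite E. ring. }
  destruct (Ceq_dec L 0) as [HL|HL].
  { apply Hdir. intros th Hth.
    assert (Hm : Cmod (K * exp (- (s * th)))%C = Cmod K * exp (- (s * th))).
    { rewrite Cmod_mult, Cmod_R, Rabs_right; [reflexivity|left; apply exp_pos]. }
    assert (Hn : (K * exp (- (s * th)))%C <> 0).
    { apply Cmod_pos_neq. rewrite Hm. apply Rmult_lt_0_compat; [exact HKp|apply exp_pos]. }
    specialize (Hv th _ Hth Hm ltac:(rewrite HL; exact Hn)). rewrite HL in Hv.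
    set (v := (K * exp (- (s * th)))%C) in *.
    replace (s * Ci * (v / (0 - v)))%C with (- (s * Ci))%C in Hv; [exact Hv|].
    field. intros Z. apply Hn. replace v with (- (0 - v))%C by ring. rewrite Z. ring. }
  assert (HLp : 0 < Cmod L) by (apply Cmod_gt_0, HL).
  set (rho th := Cmod K * exp (- (s * th)) / Cmod L).
  assert (Hrho : forall th, 0 < rho th).
  { intros th. apply Rdiv_lt_0_compat; [|exact HLp]. apply Rmult_lt_0_compat; [exact HKp|apply exp_pos]. }
  assert (Hw : forall th w, - (PI / 2) < th < PI / 2 -> Cmod w = rho th -> w <> 1 ->
    0 <= Re (e * (s * Ci * (w / (1 - w)) * Cexp (- (Ci * th))))%C).
  { intros th w Hth Hm Hw1.
    assert (H1 : (1 - w)%C <> 0).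
    { intros E. apply Hw1. replace w with (1 - (1 - w))%C by ring. rewrite E. ring. }
    replace (w / (1 - w))%C with (w * L / (L - w * L))%C.
    - apply Hv; [exact Hth| |].
      + rewrite Cmod_mult, Hm. unfold rho. field. lra.
      + intros E. apply H1. replace (1 - w)%C with ((L - w * L) / L)%C by (field; exact HL).
        rewrite E. field. exact HL.
    - replace (L - w * L)%C with (L * (1 - w))%C by ring. field. tauto. }
  assert (Hge : forall th, - (PI / 2) < th < PI / 2 -> 1 <= rho th).
  { intros th Hth. destruct (Rle_dec 1 (rho th)) as [P|P]; [exact P|exfalso].
    assert (R0 := Hrho th). set (r := rho th) in *.
    set (k := (e * (s * Ci * Cexp (- (Ci * th))))%C).
    assert (Hk : k <> 0).
    { apply Cmult_neq_0; [apply Cexp_neq_0|]. apply Cmult_neq_0; [exact HsC|apply Cexp_neq_0]. }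
    assert (Hkw : forall w, Cmod w = r -> w <> 1 -> 0 <= Re (w / (1 - w) * k)%C).
    { intros w H1 H2. specialize (Hw th w Hth H1 H2).
      replace (w / (1 - w) * k)%C with (e * (s * Ci * (w / (1 - w)) * Cexp (- (Ci * th))))%C
        by (unfold k; ring). exact Hw. }
    (* Four points of the circle suffice: w = r and w = - r give real values of both signs and kill
       Re k; then w = i r and w = - i r give imaginary parts of both signs and kill Im k. *)
    assert (W1 : 0 <= Re ((r / (1 - r))%R * k)%C).
    { replace (RtoC (r / (1 - r))%R) with (r / (1 - r))%C by (rewrite RtoC_div, RtoC_minus by lra; reflexivity).
      apply Hkw; [rewrite Cmod_R, Rabs_right; lra|]. intros E. apply RtoC_inj in E. lra. }
    assert (W2 : 0 <= Re ((- r / (1 + r))%R * k)%C).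
    { replace (RtoC (- r / (1 + r))%R) with (RtoC (- r) / (1 - RtoC (- r)))%C.
      - apply Hkw; [rewrite Cmod_R, Rabs_left; lra|]. intros E. apply RtoC_inj in E. lra.
      - rewrite RtoC_div by lra. replace (RtoC (1 + r)) with (1 - RtoC (- r))%C
          by (rewrite RtoC_plus, RtoC_opp; ring). reflexivity. }
    assert (W3 : forall y, y * y = r * r -> 0 <= Re (((- (y * y) / (1 + y * y))%R, (y / (1 + y * y))%R) * k)%C).
    { intros y Hy. replace ((- (y * y) / (1 + y * y), y / (1 + y * y)) : C) with (y * Ci / (1 - y * Ci))%C.
      - apply Hkw.
        + rewrite Cmod_mult, Cmod_R. replace (Cmod Ci) with 1.
          * assert (Rabs y * Rabs y = r * r) by (rewrite <- Rabs_mult, Rabs_right; nra).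
            generalize (Rabs_pos y); nra.
          * unfold Cmod, Ci; simpl. replace (0 * (0 * 1) + 1 * (1 * 1)) with 1 by ring. symmetry; apply sqrt_1.
        + intros E. apply (f_equal fst) in E. simpl in E. lra.
      - apply injective_projections; simpl; field; nra. }
    rewrite re_scal_l in W1, W2.
    assert (Hr1 : 0 < r / (1 - r)) by (apply Rdiv_lt_0_compat; lra).
    assert (Hr2 : 0 < r / (1 + r)) by (apply Rdiv_lt_0_compat; lra).
    replace (- r / (1 + r)) with (- (r / (1 + r))) in W2 by (field; lra).
    assert (K0 : Re k = 0) by nra.
    assert (W4 := W3 r eq_refl). assert (W5 := W3 (- r) ltac:(ring)).
    replace (- r * - r) with (r * r) in W5 by ring.
    replace (- r / (1 + r * r)) with (- (r / (1 + r * r))) in W5 by (field; nra).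
    assert (Hr3 : 0 < r / (1 + r * r)) by (apply Rdiv_lt_0_compat; nra).
    set (x1 := - (r * r) / (1 + r * r)) in *. set (y1 := r / (1 + r * r)) in *.
    assert (X : forall p q, Re ((p, q) * k)%C = p * Re k - q * Im k) by reflexivity.
    rewrite X, K0 in W4, W5.
    apply Hk. apply injective_projections; [exact K0|]. change (Im k = 0). nra. }
  (* rho is strictly monotone in th and the interval of angles is open, so rho = 1 somewhere would
     give rho < 1 nearby. *)
  assert (Hgt : forall th, - (PI / 2) < th < PI / 2 -> 1 < rho th).
  { intros th Hth. destruct (Hge th Hth) as [P|P]; [exact P|exfalso].
    assert (Hex : exists th', - (PI / 2) < th' < PI / 2 /\ s * th < s * th').
    { destruct (Rlt_dec s 0).
      - exists ((th - PI / 2) / 2). split; [lra|]. nra.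
      - exists ((th + PI / 2) / 2). split; [lra|]. nra. }
    destruct Hex as [th' [Hth' Hlt]]. assert (G := Hge th' Hth').
    assert (rho th' < rho th); [|lra]. unfold rho, Rdiv.
    apply Rmult_lt_compat_r; [apply Rinv_0_lt_compat, HLp|].
    apply Rmult_lt_compat_l; [exact HKp|]. apply exp_increasing. lra. }
  apply Hdir. intros th Hth. assert (G := Hgt th Hth).
  specialize (Hw th (RtoC (rho th)) Hth ltac:(rewrite Cmod_R, Rabs_right; lra)
    ltac:(intros E; apply RtoC_inj in E; lra)).
  set (r := rho th) in *.
  replace (e * (s * Ci * (r / (1 - r)) * Cexp (- (Ci * th))))%C
    with ((r / (r - 1))%R * (e * (- (s * Ci) * Cexp (- (Ci * th)))))%C in Hw.
  - rewrite re_scal_l in Hw.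
    assert (0 < r / (r - 1)) by (apply Rdiv_lt_0_compat; lra).
    apply Rmult_le_reg_l with (r / (r - 1)); [assumption|]. rewrite Rmult_0_r. exact Hw.
  - assert (N1 : RtoC (r - 1) <> 0) by (apply RtoC_neq_0; lra).
    rewrite RtoC_div by lra. replace (1 - r)%C with (- RtoC (r - 1))%C by (rewrite RtoC_minus; ring).
    field. exact N1.
Qed.

(** F has a nonzero limit while F' oscillates, so w accumulates on circles w1 - Q u with |u| = e^(-
    s th). Choosing the phase of u so that Q u counts fully against w1, and then letting th tend to
    the endpoint where - s th is largest, gives the exponential factor. *)
Lemma case_ii (s : R) : s <> 0 -> (c - a - b)%C = (1 + s * Ci)%C ->
  let w1 := (1 - Ci * (a * b) / s)%C in
  Cmod (CGamma (c - a) * CGamma (c - b) / (s * (CGamma a * CGamma b)))%C * exp (PI * Rabs s / 2)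
    <= Re (Cexp (- (Ci * lam)) * w1)%C.
Proof.
  intros Hs Hg w1. set (R0 := Cmod _). set (e := Cexp (- (Ci * lam))).
  assert (Hg' : 0 < Re (c - a - b)%C) by (rewrite Hg; unfold Re; simpl; lra).
  destruct (gauss_value_neq_0 Hg') as [HV [G1 G2]]. rewrite Hg in HV.
  set (V := (CGamma c * CGamma (1 + s * Ci) / (CGamma (c - a) * CGamma (c - b)))%C) in *.
  (* The last factor of Q has modulus 1, as 1 - is and 1 + is are conjugate; hence |Q| = R0. *)
  set (Q := (CGamma (c - a) * CGamma (c - b) / (s * (CGamma a * CGamma b)) *
    (CGamma (1 - s * Ci) / (Ci * CGamma (1 + s * Ci))))%C).
  assert (HsR : RtoC s <> 0) by (apply RtoC_neq_0, Hs).
  assert (HsC : (s * Ci)%C <> 0) by (apply Cmult_neq_0; [exact HsR|exact Ci_nz]).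
  assert (G3 := CGamma_neq_0 _ hc). assert (Hc0 := regular_neq_0 c hc).
  assert (G4 : CGamma (1 + s * Ci)%C <> 0).
  { apply CGamma_neq_0, Re_pos_regular. unfold Re; simpl; lra. }
  assert (HQ : Cmod Q = R0).
  { unfold Q. rewrite Cmod_mult. fold R0.
    rewrite Cmod_div by (apply Cmult_neq_0; [exact Ci_nz|exact G4]).
    replace (1 - s * Ci)%C with (Cconj (1 + s * Ci)) by (apply injective_projections; simpl; ring).
    rewrite Cmod_CGamma_conj, Cmod_mult. replace (Cmod Ci) with 1.
    - apply Cmod_gt_0 in G4. field. lra.
    - unfold Cmod, Ci; simpl. replace (0 * (0 * 1) + 1 * (1 * 1)) with 1 by ring. symmetry; apply sqrt_1. }
  assert (Hu : forall th u, - (PI / 2) < th < PI / 2 -> Cmod u = exp (- (s * th)) ->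
    0 <= Re (e * (w1 - Q * u))%C).
  { intros th u Hth Hm.
    assert (Hg1 : (c + 1 - (a + 1) - (b + 1))%C = (s * Ci)%C).
    { replace (c + 1 - (a + 1) - (b + 1))%C with (c - a - b - 1)%C by ring. rewrite Hg. ring. }
    destruct (oscillating_limit (a + 1) (b + 1) (c + 1) u s th (regular_succ c hc) Hs Hg1 Hth Hm)
      as [t [Ht [S1 _]]].
    replace (c + 1 - (a + 1))%C with (c - a)%C in S1 by ring.
    replace (c + 1 - (b + 1))%C with (c - b)%C in S1 by ring.
    assert (S0 := gauss_limit a b c th hc Hg' Hth). rewrite Hg in S0. fold V in S0.
    apply (Ctends_comp _ _ _ t _ Ht) in S0.
    rewrite <- (Cmult_1_r (w1 - Q * u)%C).
    apply (spirallike_limit eventually a b c lam th t (fun _ => 1)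
      (fun n => 1 + ray th (t n) * (a * b / c * hyp2F1 (a + 1) (b + 1) (c + 1) (ray th (t n)) /
        hyp2F1 a b c (ray th (t n))))%C _ 1 hray Hth Ht).
    - apply filter_forall; intros; lra.
    - apply filter_forall; intros n. unfold hyp2F1'. ring.
    - match type of S1 with Ctends _ _ ?l =>
        replace (w1 - Q * u)%C with (1 + 1 * (a * b / c * l / V))%C end.
      + apply (Ctends_plus eventually); [apply (Ctends_const eventually)|].
        apply (Ctends_mult eventually); [exact (Ctends_comp _ _ _ t _ Ht (ray_lim th))|].
        apply (Ctends_div eventually); [exact HV|apply (Ctends_scal eventually), S1|exact S0].
      + rewrite CGamma_succ by exact Hc0. unfold w1, Q, V, Cdiv.
        rewrite !Cinv_mult, !Cinv_invol, (inv_CGamma_succ a), (inv_CGamma_succ b).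
        generalize (/ CGamma (a + 1))%C (/ CGamma (b + 1))%C; intros x y.
        assert (HCi : (/ Ci)%C = (- Ci)%C) by (apply injective_projections; simpl; field).
        rewrite !HCi.
        assert (HCC : (Ci * Ci)%C = (-1)%C) by (apply injective_projections; simpl; ring).
        field. tauto. }
  set (X := Re (e * w1)%C).
  assert (HB : forall th, - (PI / 2) < th < PI / 2 -> R0 * exp (- (s * th)) <= X).
  { intros th Hth. set (r := exp (- (s * th))). assert (Hr : 0 < r) by apply exp_pos.
    (* Q is 0 when [a] or [b] is a pole of Gamma. Otherwise u is chosen so that e Q u is the
       positive number r R0. *)
    destruct (Ceq_dec Q 0) as [E|E].
    - rewrite E, Cmod_0 in HQ. rewrite <- HQ, Rmult_0_l.
      specialize (Hu th (RtoC r) Hth ltac:(rewrite Cmod_R; apply Rabs_right, Rle_ge, Rlt_le, exp_pos)).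
      rewrite E in Hu. replace (e * (w1 - 0 * r))%C with (e * w1)%C in Hu by ring. exact Hu.
    - set (m := (e * Q)%C). assert (Hm : m <> 0) by (apply Cmult_neq_0; [apply Cexp_neq_0|exact E]).
      assert (Hmm : Cmod m = R0).
      { unfold m, e. rewrite Cmod_mult, Cmod_Cexp, HQ.
        replace (Re (- (Ci * lam))%C) with 0 by (unfold Re; simpl; ring). rewrite exp_0. ring. }
      assert (HR0 : 0 < R0) by (rewrite <- Hmm; apply Cmod_gt_0, Hm).
      specialize (Hu th (RtoC (r * R0) / m)%C Hth).
      rewrite Cmod_div, Cmod_R, Hmm in Hu by exact Hm.
      rewrite Rabs_right in Hu by nra. specialize (Hu ltac:(unfold r; field; lra)).
      replace (e * (w1 - Q * (RtoC (r * R0) / m)))%C with (e * w1 - RtoC (r * R0))%C in Hu.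
      + rewrite Re_minus, re_RtoC in Hu. fold X in Hu. lra.
      + replace (RtoC (r * R0)) with (m * (RtoC (r * R0) / m))%C at 1 by (field; exact Hm).
        unfold m at 1. ring. }
  assert (Has : 0 < Rabs s) by (apply Rabs_pos_lt, Hs).
  assert (HB' : forall th, 0 <= th < PI / 2 -> R0 * exp (Rabs s * th) <= X).
  { intros th Hth. unfold Rabs in *. destruct (Rcase_abs s).
    - replace (- s * th) with (- (s * th)) by ring. apply HB; lra.
    - replace (s * th) with (- (s * - th)) by ring. apply HB; lra. }
  assert (HR0 : 0 <= R0) by apply Cmod_ge_0.
  replace (PI * Rabs s / 2) with (Rabs s * (PI / 2)) by field.
  generalize PI_RGT_0; intros Hpi.
  (* Were X smaller, R0 e^(|s| l) = X would hold for some l in [0, pi/2), and the midpoint of l and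
     pi/2 would contradict [HB']. The equation can be solved only if R0 > 0. *)
  destruct (Rle_dec (R0 * exp (Rabs s * (PI / 2))) X) as [P|P]; [exact P|exfalso].
  destruct HR0 as [HR0|HR0].
  2:{ specialize (HB' 0 ltac:(lra)). rewrite <- HR0 in *. lra. }
  assert (HX0 := HB' 0 ltac:(lra)). rewrite Rmult_0_r, exp_0, Rmult_1_r in HX0.
  set (y := X / R0). assert (Hy : R0 * y = X) by (unfold y; field; lra).
  assert (Hy1 : 1 <= y) by nra.
  assert (Hy2 : y < exp (Rabs s * (PI / 2))) by nra.
  set (l := ln y / Rabs s).
  assert (El : exp (Rabs s * l) = y).
  { unfold l. replace (Rabs s * (ln y / Rabs s)) with (ln y) by (field; lra). apply exp_ln. lra. }
  assert (Hl0 : 0 <= l).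
  { apply Rdiv_le_0_compat; [|exact Has]. rewrite <- ln_1. apply ln_le; lra. }
  assert (Hl1 : l < PI / 2).
  { rewrite <- El in Hy2. apply exp_lt_inv in Hy2. apply Rmult_lt_reg_l in Hy2; assumption. }
  specialize (HB' ((l + PI / 2) / 2) ltac:(lra)).
  assert (exp (Rabs s * l) < exp (Rabs s * ((l + PI / 2) / 2))).
  { apply exp_increasing, Rmult_lt_compat_l; lra. }
  rewrite El in H. nra.
Qed.

End Cases.

Theorem theorem1p1 (a b c : C) (lam : R)
  (hab : (a * b)%C <> 0) (hc : ~ nonpos_int c)
  (hlam : - (PI / 2) < lam < PI / 2)
  (hf : spirallike lam (fun z : C => (z * hyp2F1 a b c z)%C)) :
  (* (i) *)
  (1 < Re (c - a - b)%C ->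
     Rabs (lam - Carg (1 + a * b / (c - a - b - 1))%C) <= PI / 2) /\
  (* (ii) *)
  (forall s : R, s <> 0 -> (c - a - b)%C = (1 + s * Ci)%C ->
     let w1 : C := (1 - Ci * (a * b) / s)%C in
     let R1 : R :=
       Cmod (CGamma (c - a) * CGamma (c - b) / (s * (CGamma a * CGamma b)))%C
       * exp (PI * Rabs s / 2) in
     ((a + Ci * s)%C <> 0 -> (b + Ci * s)%C <> 0 ->
        R1 =
        Cmod ((a + Ci * s) * (b + Ci * s) / s *
              (CGamma (a + Ci * s) * CGamma (b + Ci * s)
               / (CGamma a * CGamma b)))%C
        * exp (PI * Rabs s / 2)) /\
     R1 <= Cmod w1 /\
     Rabs (lam - Carg w1) <= acos (R1 / Cmod w1)) /\
  (* (iii) *)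
  ((c - a - b)%C = 1 -> Rabs (lam - Carg (a * b)%C) <= PI / 2) /\
  (* (iv) *)
  (~ nonpos_int a -> ~ nonpos_int b ->
   0 <= Re (c - a - b)%C < 1 ->
     Im (c - a - b)%C = 0 /\
     Rabs (lam - Carg (CGamma (c - a) * CGamma (c - b)
                       / (CGamma a * CGamma b))%C)
       <= Re (c - a - b)%C * (PI / 2)) /\
  (* (v) *)
  (~ nonpos_int a -> ~ nonpos_int b ->
   Re (c - a - b)%C < 0 -> lam = Carg (a + b - c)%C).
Proof.
  assert (hr := spirallike_ray a b c lam hc hf).
  split; [apply case_i; assumption|].
  split; [|split; [apply case_iii; assumption|split; [|apply case_v; assumption]]].
  - intros s Hs Hg w1 R1. split.
    (* Here c - a = b + is + 1 and c - b = a + is + 1, so one step of the functional equation in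
       each factor gives the second form. *)
    + intros Ha Hb. unfold R1. f_equal. f_equal.
      replace (c - a)%C with (b + Ci * s + 1)%C
        by (replace (c - a)%C with (c - a - b + b)%C by ring; rewrite Hg; ring).
      replace (c - b)%C with (a + Ci * s + 1)%C
        by (replace (c - b)%C with (c - a - b + a)%C by ring; rewrite Hg; ring).
      rewrite !CGamma_succ by assumption. unfold Cdiv. rewrite !Cinv_mult. ring.
    + assert (H := case_ii a b c lam hc hlam hr s Hs Hg). cbv zeta in H. fold w1 R1 in H.
      assert (HR : 0 <= R1) by (apply Rmult_le_pos; [apply Cmod_ge_0|left; apply exp_pos]).
      assert (Hw : R1 <= Cmod w1).
      { eapply Rle_trans; [exact H|]. eapply Rle_trans; [apply Rle_abs|].
        eapply Rle_trans; [apply re_le_Cmod|]. rewrite Cmod_mult, Cmod_Cexp.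
        replace (Re (- (Ci * lam))%C) with 0 by (unfold Re; simpl; ring). rewrite exp_0. lra. }
      split; [exact Hw|]. destruct (Ceq_dec w1 0) as [E|E].
      (* If w1 = 0 then R1 = 0 as well and the quotient is 0, so the bound is acos 0 = pi/2, and
         [Carg 0 = 0] satisfies it. *)
      * replace (R1 / Cmod w1) with 0.
        -- rewrite acos_0. apply arg_bound_half; [exact hlam|]. lra.
        -- rewrite E, Cmod_0 in *. replace R1 with 0 by lra. unfold Rdiv; ring.
      * assert (0 < Cmod w1) by (apply Cmod_gt_0, E).
        apply arg_bound; [exact hlam|exact E|apply Rdiv_le_0_compat; assumption|].
        unfold Rdiv. rewrite Rmult_assoc, Rinv_l, Rmult_1_r by lra. exact H.
  - intros Ha Hb [[Hg|Hg] Hg1]; [apply case_iv_pos; auto|].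
    assert (Eg : (c - a - b)%C = (Im (c - a - b)%C * Ci)%C).
    { apply injective_projections; [|simpl; unfold Im; simpl; ring].
      transitivity 0; [symmetry; exact Hg|simpl; ring]. }
    (* On the line Re (c - a - b) = 0 only c = a + b survives. The Gamma quotient is then 1 and the
       bound is 0, so the claim becomes lam = Carg 1. *)
    assert (Hi := case_iv_imag a b c lam hc hlam hr _ Ha Hb Eg).
    split; [exact Hi|]. rewrite Hi in Eg.
    assert (Eg0 : (c - a - b)%C = 0) by (rewrite Eg; ring).
    assert (Ea : (c - a)%C = b) by (replace (c - a)%C with (c - a - b + b)%C by ring; rewrite Eg0; ring).
    assert (Eb : (c - b)%C = a) by (replace (c - b)%C with (c - a - b + a)%C by ring; rewrite Eg0; ring).
    rewrite <- Hg, Ea, Eb.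
    replace (CGamma b * CGamma a / (CGamma a * CGamma b))%C with (RtoC 1).
    + rewrite (case_iv_zero a b c lam hc hlam hr Ha Hb Eg0).
      replace (lam - lam) with 0 by ring. rewrite Rabs_R0. lra.
    + field. split; apply CGamma_neq_0; assumption.
Qed.
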